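(* Let $\varphi_1,\varphi_2,\varphi_3\in B_\omega$ be defined by $\widehat{\varphi_1}(x)=\chi_{[-\omega,\omega]}(x)$, $\widehat{\varphi_2}(x)=ix\,\chi_{[-\omega,\omega]}(x)$, $\widehat{\varphi_3}(x)=-x^2\chi_{[-\omega,\omega]}(x)$, and let $\Phi=(\varphi_1,\varphi_2,\varphi_3)$. If $\frac{2\omega}{3}\le h<\omega$ then $E_{\Phi,t_o}$ is a frame for $B_\omega$; if $h=\frac{2\omega}3$ it is a Riesz basis for $B_\omega$. The Fourier transform of the vector of dual generators $\Phi^*=(\varphi_1^*,\varphi_2^*,\varphi_3^* )$ is $$\widehat{\Phi^*}(x)=\begin{cases}\frac{1}{2h^3}\big(x^2+3hx+2h^2,\,-i(2x+3h),\,-1\big) & -\omega<x<\omega-2h,\\ \big(A_h(x),B_h(x),C_h(x)\big) & \omega-2h<x<h-\omega,\\ \frac1{h^3}\big(h^2-x^2,\,2ix,\,1\big) & h-\omega<x<\omega-h,\\ -\big(A_{-h}(x),B_{-h}(x),C_{-h}(x)\big) & \omega-h<x<2h-\omega,\\ \frac{1}{2h^3}\big(x^2-3hx+2h^2,\,-i(2x-3h),\,-1\big) & 2h-\omega<x<\omega,\end{cases}$$ where, for $s\in\{h,-h\}$, $$A_s(x)=\frac{1}{s^2}\,\frac{(x+s)+(2x+s)(x+s)^2}{1+(2x+s)^2+x^2(x+s)^2},\qquad B_s(x)=\frac{-i}{s^2}\,\frac{1-x(x+s)^3}{1+(2x+s)^2+x^2(x+s)^2},$$ $$C_s(x)=\frac{1}{s^2}\,\frac{s+2x+x(x+s)^2}{1+(2x+s)^2+x^2(x+s)^2}.$$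 If $h=\frac23\omega$ the intervals $(\omega-h,2h-\omega)$ and $(\omega-2h,h-\omega)$ are empty.
   Context: Conventions: $\hat f(\xi)=\frac{1}{\sqrt{2\pi}}\int f(t)e^{-it\xi}\,dt$ (extended to $L^2(\mathbb R)$); $\tau_a f(x)=f(x+a)$. Fix $\omega>0$ and $B_\omega=\{f\in L^2(\mathbb R):\operatorname{supp}\hat f\subset[-\omega,\omega]\}$; $t_o>0$ and $h=2\pi/t_o$. $E_{\Phi,t_o}=\{\tau_{nt_o}\varphi_j:n\in\mathbb Z,\ 1\le j\le3\}$ is a frame for $B_\omega$ if there are $0<A\le B$ with $A\|f\|^2\le\sum_j\sum_n|\langle f,\tau_{nt_o}\varphi_j\rangle|^2\le B\|f\|^2$ for all $f\in B_\omega$; it is a Riesz basis if moreover $c\mapsto\sum_j\sum_nc_j(n)\tau_{nt_o}\varphi_j$ is injective on $\ell^2(\mathbb Z;\mathbb C^3)$. The dual generators of a frame are $\varphi_j^*=S^{-1}\varphi_j$, where $Sf=\sum_j\sum_n\langle f,\tau_{nt_o}\varphi_j\rangle\tau_{nt_o}\varphi_j$ is the frame operator on $B_\omega$. Equalities of Fourier transforms hold almost everywhere. *)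

(* Defs.v *)
From HB Require Import structures.
From mathcomp Require Import all_boot all_order all_algebra finmap.
From mathcomp Require Import all_classical all_reals all_analysis.
From mathcomp Require Import summability.
From mathcomp.real_closed Require Export complex.
Import Order.TTheory GRing.Theory Num.Theory.
Import numFieldNormedType.Exports.

Set Implicit Arguments.
Unset Strict Implicit.
Unset Printing Implicit Defensive.

Local Open Scope classical_set_scope.
Local Open Scope ring_scope.
Local Open Scope complex_scope.

Section Definitions.
Variable R : realType.
Implicit Types (f g : R -> R[i]) (omega h x : R).

Local Notation mu := (@lebesgue_measure R).
Local Notation normc := (@ComplexField.Normc.normc R).

(* Elements of L^p are represented by Borel functions; equality of classes is
   equality almost everywhere, and all the predicates below respect it. *)

Definition cintegral f : R[i] :=
  (\int[mu]_x complex.Re (f x)) +i* (\int[mu]_x complex.Im (f x)).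

Definition cLfun (p : \bar R) f : Prop :=
  (@complex.Re R \o f \in Lfun mu p) /\ (@complex.Im R \o f \in Lfun mu p).

Definition L2norm f : \bar R := 'N[mu]_2%:E[EFin \o normc \o f].

Definition inner f g : R[i] := cintegral (fun x => f x * (g x)^*%C).

Definition tau (a : R) f : R -> R[i] := fun x => f (x + a).

Definition expi (theta : R) : R[i] := cos theta +i* sin theta.

Definition fourierL1 f : R -> R[i] :=
  fun xi => ((Num.sqrt (2 * pi))^-1)%:C *
            cintegral (fun t => f t * expi (- (t * xi))).

(* [is_fourier f g]: the class of g is the Fourier transform of f in L^2,
   i.e. (f, g) lies in the closure, in L^2 x L^2, of the graph of the integral
   transform on the intersection of L^1 and L^2. *)
Definition is_fourier f g : Prop :=
  [/\ cLfun 2%:E f, cLfun 2%:E g &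
    exists u : nat -> R -> R[i],
      [/\ forall n, cLfun 1 (u n) /\ cLfun 2%:E (u n),
          L2norm (u n \- f) @[n --> \oo] --> 0%E &
          L2norm (fourierL1 (u n) \- g) @[n --> \oo] --> 0%E]].

(* The support of a class of functions is its essential support; it lies in
   the closed interval [-omega, omega] iff the function vanishes a.e. outside. *)
Definition bandlimited omega f : Prop :=
  exists2 g, is_fourier f g &
    {ae mu, forall x, x \notin `[- omega, omega] -> g x = 0}.

Section Frames.
Variables (t0 : R) (Phi : 'I_3 -> R -> R[i]).
Implicit Types c : 'I_3 -> int -> R[i].

Definition translate (j : 'I_3) (n : int) : R -> R[i] := tau (n%:~R * t0) (Phi j).

Definition coef f : 'I_3 -> int -> R[i] := fun j n => inner f (translate j n).

Definition sqsum c : \bar R :=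
  (\sum_(j < 3) \esum_(n in [set: int]) (normc (c j n) ^+ 2)%:E)%E.

(* Unconditional convergence in L^2: the limit is taken along the net of finite
   sets of integers ordered by inclusion. *)
Definition is_synthesis c f : Prop :=
  cLfun 2%:E f /\
  (fun N : {fset int} =>
     L2norm ((fun x => \sum_(j < 3) \sum_(n <- N) c j n * translate j n x) \- f))
    @ totally --> 0%E.

Definition is_frame omega : Prop :=
  exists A B : R, [/\ 0 < A, A <= B &
    forall f, bandlimited omega f ->
      (A%:E * L2norm f ^+ 2 <= sqsum (coef f) <= B%:E * L2norm f ^+ 2)%E].

Definition in_l2 c : Prop := (sqsum c < +oo)%E.

(* The second clause says that the synthesis map, whose graph is
   [is_synthesis], is defined on the whole of l^2. *)
Definition is_riesz_basis omega : Prop :=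
  [/\ is_frame omega,
      forall c, in_l2 c -> exists f, is_synthesis c f &
      forall c c' f, in_l2 c -> in_l2 c' ->
        is_synthesis c f -> is_synthesis c' f -> c = c'].

(* S f = g, the frame operator S being given by its graph. *)
Definition is_frame_op f g : Prop := is_synthesis (coef f) g.

(* Psi_j is S^{-1} phi_j, S being viewed as an operator on B_omega. *)
Definition is_dual omega (Psi : 'I_3 -> R -> R[i]) : Prop :=
  forall j, bandlimited omega (Psi j) /\ is_frame_op (Psi j) (Phi j).

End Frames.

Definition vec3 (a b c : R[i]) : 'I_3 -> R[i] := tnth [tuple a; b; c].

Definition phi_hat omega (j : 'I_3) x : R[i] :=
  if x \in `[- omega, omega] then vec3 1 ('i%C * x%:C) (- (x ^+ 2)%:C) j else 0.

Definition den (s x : R) : R :=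
  1 + (2 * x + s) ^+ 2 + x ^+ 2 * (x + s) ^+ 2.

Definition Afun (s x : R) : R[i] :=
  ((s ^+ 2)^-1 * (((x + s) + (2 * x + s) * (x + s) ^+ 2) / den s x))%:C.

Definition Bfun (s x : R) : R[i] :=
  - 'i%C * ((s ^+ 2)^-1 * ((1 - x * (x + s) ^+ 3) / den s x))%:C.

Definition Cfun (s x : R) : R[i] :=
  ((s ^+ 2)^-1 * ((s + 2 * x + x * (x + s) ^+ 2) / den s x))%:C.

(* Set to 0 at the finitely many breakpoints, which are irrelevant, and outside
   ]-omega, omega[. *)
Definition dual_hat omega h (j : 'I_3) x : R[i] :=
  if x \in `]- omega, omega - 2 * h[ then
    ((2 * h ^+ 3)^-1)%:C *
      vec3 (x ^+ 2 + 3 * h * x + 2 * h ^+ 2)%:C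
           (- 'i%C * (2 * x + 3 * h)%:C) (- 1) j
  else if x \in `]omega - 2 * h, h - omega[ then
    vec3 (Afun h x) (Bfun h x) (Cfun h x) j
  else if x \in `]h - omega, omega - h[ then
    ((h ^+ 3)^-1)%:C * vec3 (h ^+ 2 - x ^+ 2)%:C ('i%C * (2 * x)%:C) 1 j
  else if x \in `]omega - h, 2 * h - omega[ then
    - vec3 (Afun (- h) x) (Bfun (- h) x) (Cfun (- h) x) j
  else if x \in `]2 * h - omega, omega[ then
    ((2 * h ^+ 3)^-1)%:C *
      vec3 (x ^+ 2 - 3 * h * x + 2 * h ^+ 2)%:C
           (- 'i%C * (2 * x - 3 * h)%:C) (- 1) j
  else 0.

End Definitions.

(* Main.v *)
(** On the Fourier side the translates of [phi_j] by [n t0] are the functions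
    [q_j(y) exp(i n t0 y)] on [[-omega, omega]], with [q = (1, i y, -y^2)].
    Hence the frame coefficients of [f] are the Fourier coefficients, over the
    period cell [[-h/2, h/2[], of [W_j(x) = sum_k (g (conj q_j))(x + k h)], where
    [g] is the transform of [f]. As [omega <= 3h/2], only [k = -1, 0, 1]
    contribute, and Parseval reduces the frame inequalities to the uniform
    invertibility of the Vandermonde-type matrix [(q_j(x + k h))]: Lagrange
    interpolation at the nodes [x - h, x, x + h] bounds its inverse. The same
    coefficients invert the synthesis map when the three nodes stay in the band,
    i.e. when [omega = 3h/2].

    The frame operator becomes [g |-> h sum_j q_j per(W_j)], a pointwise linear
    system in the values of [g] at the nodes lying in the band. The dual
    generators solve it: by interpolation where all three nodes are in the band,
    through the pseudo-inverse of a 2 x 3 matrix where only two are. Uniqueness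
    comes from [<S f, f> = h sum_j |W_j|^2].

    Parseval rests on the totality of the exponentials; Plancherel follows by
    applying Parseval to [u(x) exp(- i x xi)] for compactly supported [u] and
    integrating over [xi] in a period. *)

Require Import Defs.
From HB Require Import structures.
From mathcomp Require Import all_boot all_order all_algebra finmap.
From mathcomp Require Import all_classical all_reals all_analysis.
From mathcomp.real_closed Require Import complex.
From mathcomp Require Import measurable_realfun ring lra summability.
Import Order.TTheory GRing.Theory Num.Theory.
Import numFieldNormedType.Exports.

Local Open Scope classical_set_scope.
Local Open Scope ring_scope.

Set Implicit Arguments.
Unset Strict Implicit.
Unset Printing Implicit Defensive.

(** The factors [1], [i], [-1] in [q] are unimodular, so up to a diagonal unitary the matrix over a
    fibre [x + h Z] is a real Vandermonde matrix, and the algebra is interpolation by quadratics.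
    When [h < omega] the band meets a fibre in two or three nodes. The frame bounds ignore this
    distinction: a transform supported in the band vanishes at the nodes outside it, so the
    invertible three-node matrix serves over every fibre. The distinction matters only for the dual
    generators, where it produces the five branches of [dual_hat].

    Frames, synthesis and duals are stated in the time variable, while the L^2 Fourier transform is
    given only by its graph. Each claim is therefore moved to the frequency side by the isometry of
    that graph, and existence claims also need an inverse transform, built here for compactly
    supported functions.

    Norm estimates are made on squared norms, taken as real numbers, with crude constants; exact
    values occur only in the identities of Parseval and Plancherel type. *)

Local Notation Re := complex.Re.
Local Notation Im := complex.Im.
Local Notation normc := ComplexField.Normc.normc.

(** * Complex numbers *)

Section ComplexBasics.
Variable R : realType.
Implicit Types (z w : R[i]) (x y : R).

(** The squared modulus as a real polynomial: no square root appears, and estimates are within reach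
    of [nra] and [lra]. *)
Definition nsq z : R := Re z ^+ 2 + Im z ^+ 2.

Lemma nsqE z : nsq z = normc z ^+ 2.
Proof. by case: z => a b; rewrite /nsq /= sqr_sqrtr// addr_ge0 ?sqr_ge0. Qed.

Lemma nsq_ge0 z : 0 <= nsq z.
Proof. by rewrite addr_ge0// sqr_ge0. Qed.

Lemma nsq0 : nsq 0 = 0.
Proof. by rewrite /nsq /= expr0n addr0. Qed.

Lemma nsq_eq0 z : nsq z = 0 -> z = 0.
Proof.
case: z => a b; rewrite /nsq/= => /eqP.
by rewrite paddr_eq0 ?sqr_ge0// !sqrf_eq0 => /andP[/eqP-> /eqP->].
Qed.

Lemma cReD z w : Re (z + w) = Re z + Re w. Proof. by case: z; case: w. Qed.
Lemma cImD z w : Im (z + w) = Im z + Im w. Proof. by case: z; case: w. Qed.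
Lemma cReN z : Re (- z) = - Re z. Proof. by case: z. Qed.
Lemma cImN z : Im (- z) = - Im z. Proof. by case: z. Qed.
Lemma cReM z w : Re (z * w) = Re z * Re w - Im z * Im w.
Proof. by case: z; case: w. Qed.
Lemma cImM z w : Im (z * w) = Re z * Im w + Im z * Re w.
Proof. by case: z; case: w. Qed.
Lemma cReJ z : Re (conjc z) = Re z. Proof. by case: z. Qed.
Lemma cImJ z : Im (conjc z) = - Im z. Proof. by case: z. Qed.
Lemma cReC x : Re (x%:C)%C = x. Proof. by []. Qed.
Lemma cImC x : Im (x%:C)%C = 0. Proof. by []. Qed.
Lemma cRe0 : Re (0 : R[i]) = 0. Proof. by []. Qed.
Lemma cIm0 : Im (0 : R[i]) = 0. Proof. by []. Qed.
Lemma cRe1 : Re (1 : R[i]) = 1. Proof. by []. Qed.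
Lemma cIm1 : Im (1 : R[i]) = 0. Proof. by []. Qed.
Lemma Rei : Re ('i%C : R[i]) = 0. Proof. by []. Qed.
Lemma Imi : Im ('i%C : R[i]) = 1. Proof. by []. Qed.
Lemma Reexpi x : Re (expi x) = cos x. Proof. by []. Qed.
Lemma Imexpi x : Im (expi x) = sin x. Proof. by []. Qed.

Definition reim := (cReD, cImD, cReN, cImN, cReM, cImM, cReJ, cImJ,
  cRe0, cIm0, cRe1, cIm1, Rei, Imi).
(* [cReC] is kept apart: its left-hand side unifies with any [Re z]. *)
Definition reimx := (reim, Reexpi, Imexpi, cReC, cImC).

Lemma complexP z w : Re z = Re w -> Im z = Im w -> z = w.
Proof. by case: z w => [a b] [c d] /= -> ->. Qed.

Lemma nsqM z w : nsq (z * w) = nsq z * nsq w.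
Proof. rewrite /nsq !reim; ring. Qed.

Lemma nsqN z : nsq (- z) = nsq z.
Proof. by rewrite /nsq !reim !sqrrN. Qed.

Lemma nsqB z w : nsq (z - w) = nsq (w - z).
Proof. by rewrite -nsqN opprB. Qed.

Lemma nsqJ z : nsq (conjc z) = nsq z.
Proof. by rewrite /nsq !reim sqrrN. Qed.

Lemma nsqC x : nsq (x%:C)%C = x ^+ 2.
Proof. by rewrite /nsq !reimx expr0n addr0. Qed.

Lemma nsqD_le z w : nsq (z + w) <= 2 * nsq z + 2 * nsq w.
Proof.
rewrite /nsq !reim.
have := sqr_ge0 (Re z - Re w); have := sqr_ge0 (Im z - Im w); nra.
Qed.

Lemma expiD x y : expi (x + y) = expi x * expi y :> R[i].
Proof. by apply: complexP; rewrite !reimx ?cosD ?sinD; ring. Qed.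

Lemma expi0 : expi 0 = 1 :> R[i].
Proof. by apply: complexP; rewrite !reimx ?cos0 ?sin0. Qed.

Lemma expiJ x : conjc (expi x) = expi (- x) :> R[i].
Proof. by apply: complexP; rewrite !reimx ?cosN ?sinN. Qed.

Lemma nsq_expi x : nsq (expi x) = 1.
Proof. by rewrite /nsq !reimx cos2Dsin2. Qed.

Lemma expi_2pin (n : nat) : expi (n%:R * (2 * pi)) = 1 :> R[i].
Proof.
elim: n => [|n IH]; first by rewrite mul0r expi0.
rewrite -natr1 mulrDl mul1r expiD IH mul1r; apply: complexP; rewrite !reimx.
  by rewrite mulr_natl cos2pi.
by rewrite mulr_natl sin2pi.
Qed.

Lemma expi_2piz (n : int) : expi (n%:~R * (2 * pi)) = 1 :> R[i].
Proof.
case: n => n; first exact: expi_2pin.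
rewrite NegzE mulrNz mulNr -expiJ expi_2pin; exact: conjc1.
Qed.

End ComplexBasics.

(** * Square-integrable complex functions *)

Section Integration.
Variable R : realType.
Local Notation mu := (@lebesgue_measure R).
Implicit Types (f g k : R -> R[i]).

Definition cmeas f := measurable_fun [set: R] (fun x => Re (f x)) /\
  measurable_fun [set: R] (fun x => Im (f x)).

Lemma cmeas_cst z : cmeas (fun=> z).
Proof. by split; exact: measurable_cst. Qed.

Lemma cmeasD f g : cmeas f -> cmeas g -> cmeas (fun x => f x + g x).
Proof.
move=> [f1 f2] [g1 g2]; split.
  by under eq_fun do rewrite reim; exact: measurable_funD.
by under eq_fun do rewrite reim; exact: measurable_funD.
Qed.

Lemma cmeasN f : cmeas f -> cmeas (fun x => - f x).
Proof.
move=> [f1 f2]; split; under eq_fun do rewrite reim.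
  exact: measurable_funN.
exact: measurable_funN.
Qed.

Lemma cmeasB f g : cmeas f -> cmeas g -> cmeas (fun x => f x - g x).
Proof. by move=> mf mg; apply: cmeasD => //; exact: cmeasN. Qed.

Lemma cmeasM f g : cmeas f -> cmeas g -> cmeas (fun x => f x * g x).
Proof.
move=> [f1 f2] [g1 g2]; split.
  under eq_fun do rewrite reim.
  by apply: measurable_funB; exact: measurable_funM.
under eq_fun do rewrite reim.
by apply: measurable_funD; exact: measurable_funM.
Qed.

Lemma cmeasJ f : cmeas f -> cmeas (fun x => conjc (f x)).
Proof.
move=> [f1 f2]; split; under eq_fun do rewrite reim; first exact: f1.
exact: measurable_funN.
Qed.

Lemma cmeas_real (r : R -> R) : measurable_fun [set: R] r ->
  cmeas (fun x => (r x)%:C%C).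
Proof. by move=> mr; split => //=; exact: measurable_cst. Qed.

Lemma cmeas_expi (r : R -> R) : measurable_fun [set: R] r ->
  cmeas (fun x => expi (r x)).
Proof.
move=> mr; split => /=.
  apply: (measurableT_comp _ mr).
  exact: continuous_measurable_fun (@continuous_cos R).
apply: (measurableT_comp _ mr).
exact: continuous_measurable_fun (@continuous_sin R).
Qed.

Lemma cmeas_comp f (r : R -> R) : measurable_fun [set: R] r ->
  cmeas f -> cmeas (fun x => f (r x)).
Proof.
move=> mr [f1 f2]; split.
  exact: (measurableT_comp f1 mr).
exact: (measurableT_comp f2 mr).
Qed.

Lemma cmeas_if f g (b : R -> bool) : measurable_fun [set: R] b ->
  cmeas f -> cmeas g -> cmeas (fun x => if b x then f x else g x).
Proof.
move=> mb [f1 f2] [g1 g2]; split.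
  under eq_fun do rewrite (fun_if (@complex.Re R)).
  exact: measurable_fun_ifT.
under eq_fun do rewrite (fun_if (@complex.Im R)).
exact: measurable_fun_ifT.
Qed.

Lemma measurable_nsq f : cmeas f -> measurable_fun [set: R] (fun x => nsq (f x)).
Proof.
by move=> [f1 f2]; apply: measurable_funD; exact: measurable_funX.
Qed.

Lemma measurable_itv_fun (i : interval R) :
  measurable_fun [set: R] (fun x => x \in i).
Proof.
apply: (measurable_fun_bool true) => //=.
rewrite setTI (_ : _ @^-1` _ = [set` i]) //.
Qed.

Definition L1 f := mu.-integrable setT (EFin \o (fun x => Re (f x))) /\
  mu.-integrable setT (EFin \o (fun x => Im (f x))).

Lemma L1_cmeas f : L1 f -> cmeas f.
Proof.
by move=> [/measurable_int/measurable_EFinP ? /measurable_int/measurable_EFinP].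
Qed.

Lemma L1_dom f (g : R -> R) : cmeas f -> mu.-integrable setT (EFin \o g) ->
  (forall x, `|Re (f x)| <= g x) -> (forall x, `|Im (f x)| <= g x) -> L1 f.
Proof.
move=> [f1 f2] ig h1 h2; split; apply: (le_integrable measurableT _ _ ig).
- exact/measurable_EFinP.
- by move=> x _ /=; rewrite lee_fin (le_trans (h1 x)) ?ler_norm.
- exact/measurable_EFinP.
- by move=> x _ /=; rewrite lee_fin (le_trans (h2 x)) ?ler_norm.
Qed.

Lemma L1D f g : L1 f -> L1 g -> L1 (fun x => f x + g x).
Proof.
move=> [f1 f2] [g1 g2]; split.
  under eq_fun do rewrite reim.
  by have := integrableD measurableT f1 g1.
under eq_fun do rewrite reim.
by have := integrableD measurableT f2 g2.
Qed.

Lemma integrableDR (r s : R -> R) : mu.-integrable setT (EFin \o r) ->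
  mu.-integrable setT (EFin \o s) ->
  mu.-integrable setT (EFin \o (fun x => r x + s x)).
Proof. by move=> ir is_; have := integrableD measurableT ir is_. Qed.

Lemma integrableZR (c : R) (r : R -> R) : mu.-integrable setT (EFin \o r) ->
  mu.-integrable setT (EFin \o (fun x => c * r x)).
Proof.
move=> ir; have := integrableZl measurableT c ir.
by apply: eq_integrable => // x _ /=; rewrite EFinM.
Qed.

Lemma integrable_normR (r : R -> R) : mu.-integrable setT (EFin \o r) ->
  mu.-integrable setT (EFin \o (fun x => `|r x|)).
Proof. by move=> ir; have := integrable_norm ir; apply: eq_integrable. Qed.

(** Comes from [2 |a| <= 1 + a^2]. A bound on a squared modulus yields one on the components without
    a square root. *)
Lemma le_1_sqr (a : R) (M : R) : a ^+ 2 <= M -> `|a| <= 1 + M.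
Proof.
move=> aM; rewrite -real_normK ?num_real// in aM.
by have := sqr_ge0 (`|a| - 1); have := normr_ge0 a; nra.
Qed.

Lemma L1_bnd f k (M : R) : L1 f -> cmeas k -> (forall x, nsq (k x) <= M) ->
  L1 (fun x => f x * k x).
Proof.
move=> lf mk kM; have mf := L1_cmeas lf; have [f1 f2] := lf.
have i1 := integrableZR (1 + M) (integrableDR (integrable_normR f1) (integrable_normR f2)).
have kr x : `|Re (k x)| <= 1 + M.
  by apply: le_1_sqr; apply: le_trans (kM x); rewrite /nsq lerDl sqr_ge0.
have ki x : `|Im (k x)| <= 1 + M.
  by apply: le_1_sqr; apply: le_trans (kM x); rewrite /nsq lerDr sqr_ge0.
apply: (L1_dom (cmeasM mf mk) i1) => x; rewrite reim.
- apply: le_trans (ler_normB _ _) _; rewrite !normrM mulrDr.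
  by rewrite !(mulrC (1 + M)); apply: lerD; exact: ler_wpM2l.
- apply: le_trans (ler_normD _ _) _; rewrite !normrM mulrDr.
  by rewrite !(mulrC (1 + M)); apply: lerD; exact: ler_wpM2l.
Qed.

Lemma L1Z (c : R[i]) f : L1 f -> L1 (fun x => c * f x).
Proof.
move=> lf; under eq_fun do rewrite mulrC.
by apply: (L1_bnd lf (cmeas_cst c)) => x; exact: lexx.
Qed.

Lemma L1N f : L1 f -> L1 (fun x => - f x).
Proof. by move=> lf; under eq_fun do rewrite -mulN1r; exact: L1Z. Qed.

Lemma L1J f : L1 f -> L1 (fun x => conjc (f x)).
Proof.
move=> [f1 f2]; split; under eq_fun do rewrite reim; first exact: f1.
by have := integrableN f2; apply: eq_integrable.
Qed.

Lemma Re_cint f : Re (cintegral f) = \int[mu]_x Re (f x). Proof. by []. Qed.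
Lemma Im_cint f : Im (cintegral f) = \int[mu]_x Im (f x). Proof. by []. Qed.

Lemma cintD f g : L1 f -> L1 g ->
  cintegral (fun x => f x + g x) = cintegral f + cintegral g.
Proof.
move=> [f1 f2] [g1 g2]; apply: complexP; rewrite ?(Re_cint, Im_cint) ?reim ?(Re_cint, Im_cint).
  by under eq_Rintegral do rewrite reim; rewrite RintegralD.
by under eq_Rintegral do rewrite reim; rewrite RintegralD.
Qed.

Lemma cintZ (c : R[i]) f : L1 f -> cintegral (fun x => c * f x) = c * cintegral f.
Proof.
move=> [f1 f2]; apply: complexP; rewrite ?(Re_cint, Im_cint) ?reim ?(Re_cint, Im_cint).
  under eq_Rintegral do rewrite reim.
  by rewrite RintegralB ?RintegralZl//; exact: integrableZR.
under eq_Rintegral do rewrite reim.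
by rewrite RintegralD ?RintegralZl//; exact: integrableZR.
Qed.

Lemma cintN f : L1 f -> cintegral (fun x => - f x) = - cintegral f.
Proof. by move=> lf; under eq_fun do rewrite -mulN1r; rewrite cintZ// mulN1r. Qed.

Lemma cintB f g : L1 f -> L1 g ->
  cintegral (fun x => f x - g x) = cintegral f - cintegral g.
Proof. by move=> lf lg; rewrite cintD ?cintN//; exact: L1N. Qed.

Lemma cintJ f : L1 f -> cintegral (fun x => conjc (f x)) = conjc (cintegral f).
Proof.
move=> [f1 f2]; apply: complexP; rewrite ?(Re_cint, Im_cint) ?reim ?(Re_cint, Im_cint).
  by apply: eq_Rintegral => x _; rewrite reim.
under eq_Rintegral do rewrite reim -mulN1r.
by rewrite RintegralZl// mulN1r.
Qed.

Lemma cint0 : cintegral (fun=> 0 : R[i]) = 0 :> R[i].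
Proof. by apply: complexP; rewrite ?(Re_cint, Im_cint) ?reim Rintegral_cst// mul0r. Qed.

Lemma L1_0 : L1 (fun=> 0 : R[i]).
Proof. by split; exact: integrable0. Qed.

Definition L2 f := cmeas f /\ (\int[mu]_x (nsq (f x))%:E < +oo)%E.
(** A real integral, hence 0 when the extended integral is infinite; this is why most lemmas below
    carry hypotheses [L2]. *)
Definition sqn f : R := \int[mu]_x nsq (f x).

Lemma sqn_ge0 f : 0 <= sqn f.
Proof. by apply: Rintegral_ge0 => x _; exact: nsq_ge0. Qed.

Lemma sqnE f : L2 f -> (\int[mu]_x (nsq (f x))%:E = (sqn f)%:E)%E.
Proof.
move=> [mf fi]; rewrite /sqn /Rintegral fineK// ge0_fin_numE//.
by apply: integral_ge0 => x _; rewrite lee_fin nsq_ge0.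
Qed.

Lemma L2_int f : L2 f -> mu.-integrable setT (EFin \o (fun x => nsq (f x))).
Proof.
move=> [mf fi]; apply/integrableP; split.
  by apply/measurable_EFinP; exact: measurable_nsq.
by under eq_integral do rewrite gee0_abs ?lee_fin ?nsq_ge0//.
Qed.

Lemma L2_dom f (g : R -> R) : cmeas f -> mu.-integrable setT (EFin \o g) ->
  (forall x, nsq (f x) <= g x) -> L2 f.
Proof.
move=> mf /integrableP[mg ig] fg; split=> //; apply: le_lt_trans ig.
apply: ge0_le_integral => //.
- by move=> x _; rewrite lee_fin nsq_ge0.
- by apply/measurable_EFinP; exact: measurable_nsq.
- exact: measurableT_comp.
- by move=> x _ /=; rewrite lee_fin (le_trans (fg x)) ?ler_norm.
Qed.

Lemma L2_0 : L2 (fun=> 0).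
Proof. by apply: (L2_dom (cmeas_cst 0) (integrable0 _ _)) => x; rewrite nsq0. Qed.

Lemma L2D f g : L2 f -> L2 g -> L2 (fun x => f x + g x).
Proof.
move=> lf lg; apply: (L2_dom (cmeasD lf.1 lg.1)
  (integrableDR (integrableZR 2 (L2_int lf)) (integrableZR 2 (L2_int lg)))) => x.
exact: nsqD_le.
Qed.

Lemma L2_bnd f k (M : R) : L2 f -> cmeas k -> (forall x, nsq (k x) <= M) ->
  L2 (fun x => f x * k x).
Proof.
move=> lf mk kM; apply: (L2_dom (cmeasM lf.1 mk) (integrableZR M (L2_int lf))).
by move=> x; rewrite nsqM mulrC ler_wpM2r ?nsq_ge0.
Qed.

Lemma L2Z c f : L2 f -> L2 (fun x => c * f x).
Proof.
move=> lf; under eq_fun do rewrite mulrC.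
by apply: (L2_bnd lf (cmeas_cst c)) => x; exact: lexx.
Qed.

Lemma L2N f : L2 f -> L2 (fun x => - f x).
Proof. by move=> lf; under eq_fun do rewrite -mulN1r; exact: L2Z. Qed.

Lemma L2B f g : L2 f -> L2 g -> L2 (fun x => f x - g x).
Proof. by move=> lf lg; apply: L2D => //; exact: L2N. Qed.

Lemma L2J f : L2 f -> L2 (fun x => conjc (f x)).
Proof.
by move=> lf; apply: (L2_dom (cmeasJ lf.1) (L2_int lf)) => x; rewrite nsqJ.
Qed.

Lemma L2_sum (I : Type) (s : seq I) (F : I -> R -> R[i]) :
  (forall i, L2 (F i)) -> L2 (fun x => \sum_(i <- s) F i x).
Proof.
move=> mF; elim: s => [|i s IH].
  by under eq_fun do rewrite big_nil; exact: L2_0.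
by under eq_fun do rewrite big_cons; exact: L2D.
Qed.

Lemma L2_mulJ f g : L2 f -> L2 g -> L1 (fun x => f x * conjc (g x)).
Proof.
move=> lf lg; apply: (L1_dom (cmeasM lf.1 (cmeasJ lg.1))
   (integrableDR (L2_int lf) (L2_int lg))) => x; rewrite ?reim ler_norml /nsq.
- have := sqr_ge0 (Re (f x) - Re (g x)); have := sqr_ge0 (Re (f x) + Re (g x)).
  have := sqr_ge0 (Im (f x) - Im (g x)); have := sqr_ge0 (Im (f x) + Im (g x)).
  by move=> ????; apply/andP; split; nra.
- have := sqr_ge0 (Re (f x) - Im (g x)); have := sqr_ge0 (Re (f x) + Im (g x)).
  have := sqr_ge0 (Im (f x) - Re (g x)); have := sqr_ge0 (Im (f x) + Re (g x)).
  by move=> ????; apply/andP; split; nra.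
Qed.

Lemma innerDl f g k : L2 f -> L2 g -> L2 k ->
  inner (fun x => f x + g x) k = inner f k + inner g k.
Proof.
move=> lf lg lk; rewrite /inner -cintD; [|exact: L2_mulJ..].
by under eq_fun do rewrite mulrDl.
Qed.

Lemma innerZl c f k : L2 f -> L2 k -> inner (fun x => c * f x) k = c * inner f k.
Proof.
move=> lf lk; rewrite /inner -cintZ; last exact: L2_mulJ.
by under eq_fun do rewrite -mulrA.
Qed.

Lemma innerC f g : L2 f -> L2 g -> inner g f = conjc (inner f g).
Proof.
move=> lf lg; rewrite /inner -cintJ; last exact: L2_mulJ.
by under [in RHS]eq_fun do rewrite rmorphM/= conjcK mulrC.
Qed.

Lemma innerNl f k : L2 f -> L2 k -> inner (fun x => - f x) k = - inner f k.
Proof.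
by move=> lf lk; under eq_fun do rewrite -mulN1r; rewrite innerZl// mulN1r.
Qed.

Lemma innerBl f g k : L2 f -> L2 g -> L2 k ->
  inner (fun x => f x - g x) k = inner f k - inner g k.
Proof. by move=> lf lg lk; rewrite innerDl ?innerNl//; exact: L2N. Qed.

Lemma inner_suml (I : Type) (s : seq I) (F : I -> R -> R[i]) k :
  (forall i, L2 (F i)) -> L2 k ->
  inner (fun x => \sum_(i <- s) F i x) k = \sum_(i <- s) inner (F i) k.
Proof.
move=> mF lk; elim: s => [|i s IH].
  rewrite big_nil /inner.
  by under eq_fun do rewrite big_nil mul0r; exact: cint0.
by under eq_fun do rewrite big_cons; rewrite big_cons innerDl// ?IH//; exact: L2_sum.
Qed.

Lemma nsqE_mulJ (z : R[i]) : z * conjc z = ((nsq z)%:C)%C.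
Proof. by case: z => a b; apply: complexP; rewrite /nsq /=; ring. Qed.

Lemma inner_self f : inner f f = ((sqn f)%:C)%C.
Proof.
rewrite /inner; under eq_fun do rewrite nsqE_mulJ.
apply: complexP; rewrite ?(Re_cint, Im_cint)//.
by under eq_Rintegral do rewrite /=; rewrite Rintegral_cst// mul0r.
Qed.

Lemma sqnD f g : L2 f -> L2 g ->
  sqn (fun x => f x + g x) = sqn f + sqn g + 2 * Re (inner f g).
Proof.
move=> lf lg; have [i1 i2] := L2_mulJ lf lg.
rewrite /inner Re_cint /sqn -RintegralZl// -RintegralD//; [|exact: L2_int..].
rewrite -RintegralD//; last 2 first.
- by apply: integrableDR; exact: L2_int.
- exact: integrableZR.
by apply: eq_Rintegral => x _; rewrite /nsq !reim; ring.
Qed.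

Lemma sqnZ c f : L2 f -> sqn (fun x => c * f x) = nsq c * sqn f.
Proof.
move=> lf; rewrite /sqn -RintegralZl//; last exact: L2_int.
by apply: eq_Rintegral => x _; rewrite nsqM.
Qed.

Lemma sqnN f : sqn (fun x => - f x) = sqn f.
Proof. by apply: eq_Rintegral => x _; rewrite nsqN. Qed.

Lemma sqnBC f g : sqn (fun x => f x - g x) = sqn (fun x => g x - f x).
Proof. by apply: eq_Rintegral => x _; rewrite nsqB. Qed.

Lemma sqnB f g : L2 f -> L2 g ->
  sqn (fun x => f x - g x) = sqn f + sqn g - 2 * Re (inner f g).
Proof.
move=> lf lg; rewrite sqnD//; last exact: L2N.
rewrite sqnN; congr (_ + _); rewrite -mulrN; congr (_ * _).
by rewrite innerC ?innerNl//; [rewrite innerC// !reim|exact: L2N].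
Qed.

Lemma sqnD_le f g : L2 f -> L2 g ->
  sqn (fun x => f x + g x) <= 2 * sqn f + 2 * sqn g.
Proof.
move=> lf lg; rewrite /sqn -!RintegralZl//; [|exact: L2_int..].
rewrite -RintegralD//; [|apply: integrableZR; exact: L2_int..].
apply: le_Rintegral => //.
- by apply: L2_int; exact: L2D.
- by apply: integrableDR; apply: integrableZR; exact: L2_int.
- by move=> x _; exact: nsqD_le.
Qed.

Lemma sqn_tri f g k : L2 f -> L2 g -> L2 k ->
  sqn (fun x => f x - k x) <=
  2 * sqn (fun x => f x - g x) + 2 * sqn (fun x => g x - k x).
Proof.
move=> lf lg lk; apply: le_trans (sqnD_le (L2B lf lg) (L2B lg lk)).
by under [X in _ <= sqn X]eq_fun do rewrite addrA subrK.
Qed.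

(** Expanding the squared norm of [f - t z g], with [z] the inner product and [t] real, gives a
    nonnegative quadratic in [t], minimal at [t = 1 / sqn g]. *)
Lemma cauchy_schwarz f g : L2 f -> L2 g -> nsq (inner f g) <= sqn f * sqn g.
Proof.
move=> lf lg; set z := inner f g; set N := nsq z.
have H (t : R) : 0 <= sqn f + t ^+ 2 * N * sqn g - 2 * t * N.
  have := sqn_ge0 (fun x => f x - (t%:C%C * z) * g x).
  rewrite sqnB//; last exact: L2Z.
  rewrite sqnZ// nsqM nsqC (innerC (L2Z _ lg) lf) innerZl// (innerC lf lg) -/z.
  rewrite (_ : Re _ = t * N); first by rewrite mulrA.
  by rewrite cReJ -(mulrA _ z) nsqE_mulJ !reim !reimx mul0r subr0.
have := sqn_ge0 g; rewrite le_eqVlt => /orP[/eqP g0|g0].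
  rewrite -g0 mulr0 leNgt; apply/negP => N0.
  (* When [sqn g = 0] the quadratic is affine of slope [-2 N]; this [t] gives it the value -1. *)
  have := H ((sqn f + 1) / (2 * N)).
  rewrite -g0 mulr0 addr0 (_ : 2 * _ * N = sqn f + 1); first lra.
  by field; rewrite gt_eqF.
have := H (sqn g)^-1.
rewrite (_ : _ - _ = sqn f - N / sqn g); last by field; rewrite gt_eqF.
by rewrite subr_ge0 ler_pdivrMr.
Qed.

Lemma ae_imp (P Q : R -> Prop) : (forall x, P x -> Q x) ->
  {ae mu, forall x, P x} -> {ae mu, forall x, Q x}.
Proof. by move=> PQ; apply: (@filterS _ _ (ae_filter_ringOfSetsType mu)). Qed.

Lemma ae_imp2 (P Q S : R -> Prop) : (forall x, P x -> Q x -> S x) ->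
  {ae mu, forall x, P x} -> {ae mu, forall x, Q x} -> {ae mu, forall x, S x}.
Proof. by move=> PQ; apply: (@filterS2 _ _ (ae_filter_ringOfSetsType mu)). Qed.

Lemma sqn_eq0_ae f : L2 f -> sqn f = 0 -> {ae mu, forall x, f x = 0}.
Proof.
move=> lf f0.
have : (\int[mu]_x `|(nsq (f x))%:E| = 0)%E.
  rewrite -[RHS]/(0%:E)%E -f0 -sqnE//.
  by apply: eq_integral => x _; rewrite gee0_abs// lee_fin nsq_ge0.
move/(ae_eq_integral_abs mu measurableT) => /=.
have mf : measurable_fun [set: R] (fun x => (nsq (f x))%:E).
  by apply/measurable_EFinP; exact: measurable_nsq lf.1.
move=> /(_ mf); apply: filterS => x /(_ I) [].
exact: nsq_eq0.
Qed.

Lemma sqn_ae f g : L2 f -> L2 g -> {ae mu, forall x, f x = g x} -> sqn f = sqn g.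
Proof.
move=> lf lg fg; apply: EFin_inj; rewrite -!sqnE//; apply: ae_eq_integral => //.
- by apply/measurable_EFinP; exact: measurable_nsq lf.1.
- by apply/measurable_EFinP; exact: measurable_nsq lg.1.
- by apply: ae_imp fg => x -> _.
Qed.

Lemma sqn0 : sqn (fun=> 0) = 0.
Proof. by rewrite /sqn; under eq_Rintegral do rewrite nsq0; rewrite Rintegral_cst// mul0r. Qed.

(** * Comparison with the L^p classes and the norm of the statement *)

Lemma cLfun1P f : cLfun 1 f <-> L1 f.
Proof.
rewrite /cLfun; split=> [[/Lfun1_integrable ? /Lfun1_integrable //]|[f1 f2]].
by split; apply/Lfun1_integrable.
Qed.

Lemma Lfun2P (r : R -> R) : r \in Lfun mu 2%:E <->
  measurable_fun [set: R] r /\ mu.-integrable setT (EFin \o (fun x => r x ^+ 2)).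
Proof.
split=> [rL|[mr ir]].
  split; last exact: Lfun2_integrable_sqr.
  by move: rL; rewrite inE => /andP[/[!inE]].
rewrite inE; apply/andP; split; rewrite inE//= /finite_norm unlock poweR_lty//.
move/integrableP : ir => [_]; apply: le_lt_trans.
under [leRHS]eq_integral do rewrite /= ger0_norm ?sqr_ge0//.
apply: ge0_le_integral => //.
- by move=> x _; exact: poweR_ge0.
- apply/measurable_EFinP; apply: (measurableT_comp (measurable_powR _)).
  exact: measurableT_comp.
- by apply/measurable_EFinP; apply: measurable_funX.
- by move=> x _ /=; rewrite lee_fin powR_mulrn// real_normK ?num_real.
Qed.

Lemma cLfun2P f : cLfun 2%:E f <-> L2 f.
Proof.
rewrite /cLfun; split=> [[/Lfun2P[m1 i1] /Lfun2P[m2 i2]]|lf].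
  by apply: (L2_dom (conj m1 m2) (integrableDR i1 i2)) => x.
have := lf.1 => -[m1 m2]; split; apply/Lfun2P; split => //.
  apply: (le_integrable _ _ _ (L2_int lf)) => //.
    by apply/measurable_EFinP; exact: measurable_funX.
  by move=> x _ /=; rewrite lee_fin !ger0_norm ?nsq_ge0 ?sqr_ge0// lerDl sqr_ge0.
apply: (le_integrable _ _ _ (L2_int lf)) => //.
  by apply/measurable_EFinP; exact: measurable_funX.
by move=> x _ /=; rewrite lee_fin !ger0_norm ?nsq_ge0 ?sqr_ge0// lerDr sqr_ge0.
Qed.

Lemma L2normE f : L2 f -> L2norm f = (Num.sqrt (sqn f))%:E.
Proof.
move=> lf; rewrite /L2norm unlock.
rewrite (_ : (\int[mu]_x _)%E = (sqn f)%:E).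
  by rewrite poweR_EFin powR12_sqrt// sqn_ge0.
rewrite -sqnE//; apply: eq_integral => x _ /=.
by rewrite powR_mulrn// real_normK ?num_real// nsqE.
Qed.

Lemma L2norm_sqr f : L2 f -> (L2norm f ^+ 2 = (sqn f)%:E)%E.
Proof. by move=> lf; rewrite L2normE// -EFin_expe sqr_sqrtr// sqn_ge0. Qed.

(** The bridge between convergence as stated, in the extended-real norm, and convergence of the real
    squared norms used in the proof. The filter is arbitrary so as to cover both sequences and the
    net of finite sets. *)
Lemma L2norm_cvg0 (T : Type) (F : set_system T) (u : T -> R -> R[i]) :
  Filter F -> (forall i, L2 (u i)) ->
  ((L2norm (u i) @[i --> F] --> 0%E) <-> (sqn (u i) @[i --> F] --> 0)).
Proof.
move=> FF lu.
have -> : (fun i => L2norm (u i)) = EFin \o (fun i => Num.sqrt (sqn (u i))).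
  by apply/funext => i /=; rewrite L2normE.
split=> [/fine_cvgP[_] /= h|h].
  rewrite (_ : (fun i => sqn (u i)) = (fun i => Num.sqrt (sqn (u i)) * Num.sqrt (sqn (u i)))).
    rewrite -[X in _ --> X](mulr0 0); exact: cvgM.
  by apply/funext => i; rewrite -expr2 sqr_sqrtr// sqn_ge0.
apply/fine_cvgP; split; first by near=> i.
rewrite -[X in _ --> X]sqrtr0.
apply: (cvg_comp _ _ h); exact: sqrt_continuous.
Unshelve. all: by end_near. Qed.

End Integration.

(** * Translation invariance of the Lebesgue integral *)

Section Translation.
Variable R : realType.
Local Notation mu := (@lebesgue_measure R).
Implicit Types (f g : R -> R[i]).

Lemma measurable_shift (a : R) : measurable_fun [set: R] (fun x : R => x + a).
Proof. exact: measurable_funD. Qed.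

(** The image of the measure under the shift gives []b, c]] the length of []b - a, c - a]], and the
    Lebesgue measure is determined by its values on such intervals. *)
Lemma lebesgue_measure_shift (a : R) (A : set R) : measurable A ->
  pushforward mu ((fun x => x + a) : _ -> measurableTypeR R) A = mu A.
Proof.
move=> mA; apply/esym.
pose m := @measure_function_pushforward__canonical__measure_function_Measure
  _ _ _ _ _ mu _ (measurable_shift a : measurable_fun _ (_ : _ -> measurableTypeR R)).
apply: (@lebesgue_measure_unique R m) => //= _ [[b c]] _ <-; rewrite {}/m /=.
have -> : pushforward mu ((fun x => x + a) : _ -> measurableTypeR R) `]b, c]%classic
    = mu `]b - a, c - a]%classic.
  rewrite /pushforward; congr (mu _); apply/seteqP; split => x /=.
    by rewrite !in_itv/= ltrBlDr lerBrDr.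
  by rewrite !in_itv/= ltrBlDr lerBrDr.
rewrite !lebesgue_measure_itv/= !lte_fin ltrD2r.
by case: ifPn => // _; rewrite -!EFinB; congr EFin; ring.
Qed.

Lemma ge0_integral_shift (a : R) (f : R -> \bar R) :
  measurable_fun [set: R] f -> (forall x, 0 <= f x)%E ->
  (\int[mu]_x f ((x : R) + a)%R = \int[mu]_x f x)%E.
Proof.
move=> mf f0.
transitivity (\int[pushforward mu ((fun x => x + a)%R : _ -> measurableTypeR R)]_y f y)%E.
  by rewrite (@ge0_integral_pushforward _ _ (measurableTypeR R) (measurableTypeR R) _ _
    (measurable_shift a) mu setT f).
apply: eq_measure_integral => [|ma A mA _]; first exact: measurable_shift.
exact: lebesgue_measure_shift.
Qed.

Lemma integral_shift (a : R) (f : R -> \bar R) :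
  measurable_fun [set: R] f ->
  (\int[mu]_x f ((x : R) + a)%R = \int[mu]_x f x)%E.
Proof.
move=> mf; rewrite integralE [RHS]integralE; congr (_ - _)%E.
  rewrite -(@ge0_integral_shift a f^\+)%E//; last exact: measurable_funepos.
  by apply: eq_integral => x _; rewrite !funeposE.
rewrite -(@ge0_integral_shift a f^\-)%E//.
  by apply: eq_integral => x _; rewrite !funenegE.
exact: measurable_funeneg.
Qed.

Lemma cint_shift (a : R) f : cmeas f ->
  cintegral (fun x => f (x + a)) = cintegral f.
Proof.
move=> [f1 f2]; apply: complexP; rewrite ?(Re_cint, Im_cint) /Rintegral.
  by rewrite (@integral_shift a (EFin \o (fun x => Re (f x))))//; exact/measurable_EFinP.
by rewrite (@integral_shift a (EFin \o (fun x => Im (f x))))//; exact/measurable_EFinP.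
Qed.

Lemma L2_shift (a : R) f : L2 f -> L2 (fun x => f (x + a)).
Proof.
move=> [mf fi]; split; first exact: cmeas_comp (measurable_shift a) mf.
rewrite (@ge0_integral_shift a (fun x => (nsq (f x))%:E))//.
  by apply/measurable_EFinP; exact: measurable_nsq.
by move=> x; rewrite lee_fin nsq_ge0.
Qed.

Lemma sqn_shift (a : R) f : cmeas f -> sqn (fun x => f (x + a)) = sqn f.
Proof.
move=> mf; rewrite /sqn /Rintegral (@ge0_integral_shift a (fun x => (nsq (f x))%:E))//.
  by apply/measurable_EFinP; exact: measurable_nsq.
by move=> x; rewrite lee_fin nsq_ge0.
Qed.

Lemma L1_shift (a : R) f : L1 f -> L1 (fun x => f (x + a)).
Proof.
move=> lf; have [f1 f2] := lf; have [m1 m2] := L1_cmeas lf.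
move/integrableP : f1 => [_ f1]; move/integrableP : f2 => [_ f2].
have ma := measurable_shift a; split; apply/integrableP; split.
- by apply/measurable_EFinP; exact: (measurableT_comp m1 ma).
- rewrite (@ge0_integral_shift a (fun x => `|(EFin \o (fun x => Re (f x))) x|)%E)//.
  by apply: measurableT_comp => //; exact/measurable_EFinP.
- by apply/measurable_EFinP; exact: (measurableT_comp m2 ma).
- rewrite (@ge0_integral_shift a (fun x => `|(EFin \o (fun x => Im (f x))) x|)%E)//.
  by apply: measurableT_comp => //; exact/measurable_EFinP.
Qed.

End Translation.

(** * Limits in L^2 *)

Section Convergence.
Variable R : realType.
Local Notation mu := (@lebesgue_measure R).
Implicit Types (f g : R -> R[i]).

Lemma cvg_EFin_seq (v : nat -> R) l : v n @[n --> \oo] --> l ->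
  (v n)%:E @[n --> \oo] --> l%:E.
Proof. by move=> vl; apply: cvg_EFin => //; exact: nearW. Qed.

Lemma Rintegral_dct (u : nat -> R -> R) (r g : R -> R) :
  (forall n, measurable_fun [set: R] (u n)) ->
  (forall x, u n x @[n --> \oo] --> r x) ->
  mu.-integrable setT (EFin \o g) ->
  (forall n x, `|u n x| <= g x) ->
  (\int[mu]_x u n x) @[n --> \oo] --> \int[mu]_x r x.
Proof.
move=> mu_ ur ig ug; have [mg _] := integrableP _ _ _ ig.
have mr : measurable_fun [set: R] r.
  by apply: (measurable_fun_cvg mu_) => x _; exact: ur.
have rg x : `|r x| <= g x.
  have h : `|u n x| @[n --> \oo] --> `|r x| by apply: cvg_norm; exact: ur.
  have hc : cvgn (fun n => `|u n x|) by apply/cvg_ex; exists `|r x|.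
  rewrite -(cvg_lim _ h)//; apply: limr_le => //.
  by apply: nearW => n; exact: ug.
have ir : mu.-integrable setT (EFin \o r).
  apply: (le_integrable _ _ _ ig) => //; first exact/measurable_EFinP.
  by move=> x _ /=; rewrite lee_fin (le_trans (rg x)) ?ler_norm.
have H := @dominated_cvg _ _ _ mu setT measurableT (fun n => EFin \o u n)
  (EFin \o r) (EFin \o g).
rewrite /Rintegral; apply: fine_cvg; rewrite fineK; last exact: integrable_fin_num.
apply: H => //.
- by move=> n; apply/measurable_EFinP; exact: mu_.
- by move=> x _; apply: cvg_EFin; [exact: nearW|exact: ur].
- by move=> n x _ /=; rewrite lee_fin.
Qed.

Lemma cint_dct (F : nat -> R -> R[i]) f (g : R -> R) :
  (forall n, cmeas (F n)) ->
  (forall x, Re (F n x) @[n --> \oo] --> Re (f x)) ->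
  (forall x, Im (F n x) @[n --> \oo] --> Im (f x)) ->
  mu.-integrable setT (EFin \o g) ->
  (forall n x, `|Re (F n x)| <= g x) -> (forall n x, `|Im (F n x)| <= g x) ->
  (Re (cintegral (F n)) @[n --> \oo] --> Re (cintegral f)) /\
  (Im (cintegral (F n)) @[n --> \oo] --> Im (cintegral f)).
Proof.
move=> mF c1 c2 ig g1 g2; split.
  by apply: (@Rintegral_dct (fun n x => Re (F n x)) _ g) => // n; case: (mF n).
by apply: (@Rintegral_dct (fun n x => Im (F n x)) _ g) => // n; case: (mF n).
Qed.

Lemma limn_einf_le (u : nat -> \bar R) C : (forall n, (u n <= C)%E) ->
  (limn_einf u <= C)%E.
Proof.
move=> uC; rewrite limn_einf_lim; apply: lime_le; first exact: is_cvg_einfs.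
apply: nearW => n; apply: le_trans (uC n).
by apply: ereal_inf_lbound; exists n => /=.
Qed.

(** Fatou's lemma for squared norms. It yields membership of the limit in [L2] together with the
    bound, which is how limits are placed in [L2] both for completeness and for the Fourier
    transform. *)
Lemma fatou_sqn (u : nat -> R -> R[i]) f C :
  (forall n, L2 (u n)) -> cmeas f ->
  {ae mu, forall x, nsq (u n x) @[n --> \oo] --> nsq (f x)} ->
  (forall n, sqn (u n) <= C) -> L2 f /\ sqn f <= C.
Proof.
move=> lu mf uf uC.
have mu_ n : measurable_fun [set: R] (fun x => (nsq (u n x))%:E).
  by apply/measurable_EFinP; exact: (measurable_nsq (lu n).1).
have H : (\int[mu]_x (nsq (f x))%:E <= C%:E)%E.
  have -> : (\int[mu]_x (nsq (f x))%:E = \int[mu]_x limn_einf (fun n => (nsq (u n x))%:E))%E.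
    apply: ae_eq_integral => //.
    - by apply/measurable_EFinP; exact: measurable_nsq.
    - under eq_fun do rewrite -[limn_einf _]oppeK -limn_esupN.
      apply: measurableT_comp => //; apply: measurable_fun_limn_esup => n.
      by apply/measurable_EFinP/measurable_funN; exact: (measurable_nsq (lu n).1).
    - apply: ae_imp uf => x h _; apply/esym.
      by have [] := cvg_limn_einf_sup (cvg_EFin_seq h).
  apply: le_trans (fatou _ _ _ _) _ => //.
    by move=> n x _; rewrite lee_fin nsq_ge0.
  by apply: limn_einf_le => n; rewrite (sqnE (lu n)) lee_fin.
have lf : L2 f by split => //; apply: le_lt_trans H _; exact: ltry.
by split => //; rewrite -lee_fin -(sqnE lf).
Qed.

Lemma nsq_cvg (u : nat -> R[i]) z : Re (u n) @[n --> \oo] --> Re z ->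
  Im (u n) @[n --> \oo] --> Im z -> nsq (u n) @[n --> \oo] --> nsq z.
Proof. by move=> h1 h2; rewrite /nsq; apply: cvgD; apply: cvgM. Qed.

(** With [t = 2^-n], [|a n| <= t + (a n)^2 / t]: the series is dominated by a geometric one plus the
    weighted series of squares. *)
Lemma cvgn_le_weighted (a b : nat -> R) (C : R) :
  (forall n, (a n) ^+ 2 <= b n) ->
  (forall n, \sum_(0 <= k < n) 2 ^+ k * b k <= C) -> cvgn (series a).
Proof.
move=> ab bC; apply: normed_cvg.
have b0 n : 0 <= b n by apply: le_trans (ab n); exact: sqr_ge0.
apply: (@series_le_cvg _ _ (fun n => geometric 1 (1/2) n + 2 ^+ n * b n)).
- by move=> n; exact: normr_ge0.
- by move=> n; rewrite /geometric /= addr_ge0// mulr_ge0// exprn_ge0.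
- move=> n; rewrite /= mul1r.
  set t := (1 / 2) ^+ n; have t0 : 0 < t by rewrite exprn_gt0.
  have tE : 2 ^+ n = t^-1 by rewrite /t -exprVn; congr (_ ^+ _); rewrite div1r invrK.
  rewrite tE; apply: (@le_trans _ _ (t + t^-1 * (a n) ^+ 2)); last first.
    by rewrite lerD2l ler_wpM2l// invr_ge0 ltW.
  rewrite -(@ler_pM2l _ t)// mulrDr mulrA divff ?gt_eqF// mul1r.
  rewrite -(real_normK (num_real (a n))).
  by have := sqr_ge0 (`|a n| - t); have := sqr_ge0 (`|a n|); nra.
- rewrite (_ : series _ = series (geometric 1 (1/2)) \+ series (fun n => 2 ^+ n * b n)).
    apply: is_cvgD; first by apply: is_cvg_geometric_series; rewrite ger0_norm; lra.
    apply: nondecreasing_is_cvgn.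
      by apply: nondecreasing_series => n _ _; rewrite mulr_ge0// exprn_ge0.
    by exists C => _ [n _ <-]; exact: bC.
  by apply/funext => n; rewrite /series /= big_split.
Qed.

(** Integrated term by term, the weighted series is at most the sum of [2^k 4^-k], that is 2; a
    function with finite integral is finite almost everywhere. *)
Lemma sqn_cvg_weighted (d : nat -> R -> R[i]) : (forall n, L2 (d n)) ->
  (forall n, sqn (d n) <= 4^-1 ^+ n) ->
  {ae mu, forall x, exists C : R, forall n,
    \sum_(0 <= k < n) 2 ^+ k * nsq (d k x) <= C}.
Proof.
move=> ld sd.
pose D x := (\sum_(0 <= k <oo) (2 ^+ k * nsq (d k x))%:E)%E.
have m1 n : measurable_fun [set: R] (fun x => (2 ^+ n * nsq (d n x))%:E).
  apply/measurable_EFinP; apply: measurable_funM; first exact: measurable_cst.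
  exact: (measurable_nsq (ld n).1).
have p1 n x : (0 <= (2 ^+ n * nsq (d n x))%:E)%E.
  by rewrite lee_fin mulr_ge0 ?nsq_ge0// exprn_ge0.
have ID : (\int[mu]_x D x <= 2%:E)%E.
  rewrite /D integral_nneseries//.
  apply: lime_le; first by apply: is_cvg_nneseries => n _ _; exact: integral_ge0.
  apply: nearW => n.
  apply: (@le_trans _ _ (\sum_(0 <= k < n) ((1/2) ^+ k)%:E)%E).
    apply: lee_sum => k _; under eq_integral do rewrite EFinM.
    rewrite ge0_integralZl//; last 2 first.
    - by apply/measurable_EFinP; exact: (measurable_nsq (ld k).1).
    - by move=> x _; rewrite lee_fin nsq_ge0.
    rewrite sqnE// -EFinM lee_fin.
    apply: (@le_trans _ _ (2 ^+ k * 4^-1 ^+ k)).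
      by rewrite ler_wpM2l// exprn_ge0.
    rewrite -exprMn (_ : 2 * 4^-1 = 1 / 2 :> R)//; lra.
  rewrite sumEFin lee_fin.
  rewrite (_ : \sum_(0 <= i < n) (1 / 2) ^+ i = 2 - 2 * (1 / 2) ^+ n :> R).
    by rewrite gerBl mulr_ge0// exprn_ge0// divr_ge0.
  elim: n => [|n IH]; first by rewrite big_geq// expr0; ring.
  by rewrite big_nat_recr//= IH exprS; field.
have iD : mu.-integrable setT D.
  apply/integrableP; split.
    by apply: ge0_emeasurable_sum => [n x _ _|n _]; [exact: p1|exact: m1].
  under eq_integral do rewrite gee0_abs ?nneseries_ge0//.
  by apply: le_lt_trans ID _; exact: ltry.
have := integrable_ae measurableT iD; apply: ae_imp => x /(_ I) Dx.
exists (fine (D x)) => n; rewrite -lee_fin fineK// -sumEFin.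
exact: nneseries_lim_ge.
Qed.

(** Multiplying by the indicator of the complement of a measurable null set makes the sequence
    converge everywhere, so the limit is measurable. *)
Lemma pointwise_limit (v : nat -> R -> R[i]) : (forall n, cmeas (v n)) ->
  {ae mu, forall x, cvgn (fun n => Re (v n x)) /\ cvgn (fun n => Im (v n x))} ->
  exists f, cmeas f /\ {ae mu, forall x, (Re (v n x) @[n --> \oo] --> Re (f x)) /\
    (Im (v n x) @[n --> \oo] --> Im (f x))}.
Proof.
move=> mv [N [mN N0 vN]].
have cN x : ~ N x -> cvgn (fun n => Re (v n x)) /\ cvgn (fun n => Im (v n x)).
  by move=> nN; apply: contrapT => h; apply: nN; exact: vN.
have mI : measurable_fun [set: R] (\1_(~` N) : R -> R).
  by apply: measurable_indic; exact: measurableC.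
pose a n x := Re (v n x) * \1_(~` N) x; pose b n x := Im (v n x) * \1_(~` N) x.
have ca x : cvgn (a ^~ x).
  rewrite /a indicE; case: (boolP (x \in _)) => [|_].
    by rewrite inE => /cN[h _]; rewrite /=; under eq_fun do rewrite mulr1.
  by under eq_fun do rewrite mulr0; exact: is_cvg_cst.
have cb x : cvgn (b ^~ x).
  rewrite /b indicE; case: (boolP (x \in _)) => [|_].
    by rewrite inE => /cN[_ h]; rewrite /=; under eq_fun do rewrite mulr1.
  by under eq_fun do rewrite mulr0; exact: is_cvg_cst.
exists (fun x => (limn (a ^~ x) +i* limn (b ^~ x))%C); split.
  split => /=.
    apply: (@measurable_fun_cvg _ _ _ _ a) => [n|x _]; last exact: ca.
    by apply: measurable_funM => //; case: (mv n).
  apply: (@measurable_fun_cvg _ _ _ _ b) => [n|x _]; last exact: cb.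
  by apply: measurable_funM => //; case: (mv n).
exists N; split => // x /= h; apply: contrapT => nN; apply: h.
have xN : x \in ~` N by rewrite inE.
split.
  have := ca x; rewrite /a indicE xN /=; under eq_fun do rewrite mulr1.
  exact.
have := cb x; rewrite /b indicE xN /=; under eq_fun do rewrite mulr1.
exact.
Qed.

(** A subsequence whose successive differences have squared norm at most [4^-k] converges almost
    everywhere; Fatou's lemma along it, with the other index fixed, turns the Cauchy estimate into
    an estimate of the distance to the limit. *)
Lemma L2_complete (u : nat -> R -> R[i]) : (forall n, L2 (u n)) ->
  (forall e, 0 < e -> exists N, forall m n, (N <= m)%N -> (N <= n)%N ->
     sqn (fun x => u m x - u n x) <= e) ->
  exists f, L2 f /\ sqn (fun x => u n x - f x) @[n --> \oo] --> 0.
Proof.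
move=> lu cu.
have /choice[phi phiP] : forall k, exists N, forall m n, (N <= m)%N -> (N <= n)%N ->
    sqn (fun x => u m x - u n x) <= 4^-1 ^+ k.
  by move=> k; apply: cu; rewrite exprn_gt0.
(* Summing the thresholds makes [psi] monotone and at least [phi k]; the successor in each term
   gives [k <= psi k]. *)
pose psi k := (\sum_(i < k.+1) (phi i).+1)%N.
have psiS k : (psi k <= psi k.+1)%N by rewrite /psi [in leqRHS]big_ord_recr/= leq_addr.
have phi_psi k : (phi k <= psi k)%N.
  by rewrite /psi big_ord_recr/=; apply: leq_trans (leq_addl _ _).
have k_psi k : (k <= psi k)%N.
  elim: k => // k IH; rewrite /psi big_ord_recr/= addnS ltnS.
  by apply: leq_trans IH _; exact: leq_addr.
pose v k := u (psi k); pose d k x := v k.+1 x - v k x.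
have ld k : L2 (d k) by apply: L2B; exact: lu.
have sd k : sqn (d k) <= 4^-1 ^+ k.
  by apply: phiP; rewrite ?(leq_trans (phi_psi k)).
have aec : {ae mu, forall x, cvgn (fun n => Re (v n x)) /\ cvgn (fun n => Im (v n x))}.
  apply: ae_imp (sqn_cvg_weighted ld sd) => x [C dC]; split.
    have h : cvgn (series (fun k => Re (d k x))).
      apply: cvgn_le_weighted dC => n; by rewrite /nsq lerDl sqr_ge0.
    rewrite (_ : (fun n => _) = cst (Re (v 0%N x)) \+ series (fun k => Re (d k x))).
      by apply: is_cvgD => //; exact: is_cvg_cst.
    apply/funext => n /=; rewrite /series/=; elim: n => [|n IH].
      by rewrite big_geq// addr0.
    by rewrite big_nat_recr//= addrA -IH /d reim cReN addrC subrK.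
  have h : cvgn (series (fun k => Im (d k x))).
    apply: cvgn_le_weighted dC => n; by rewrite /nsq lerDr sqr_ge0.
  rewrite (_ : (fun n => _) = cst (Im (v 0%N x)) \+ series (fun k => Im (d k x))).
    by apply: is_cvgD => //; exact: is_cvg_cst.
  apply/funext => n /=; rewrite /series/=; elim: n => [|n IH].
    by rewrite big_geq// addr0.
  by rewrite big_nat_recr//= addrA -IH /d reim cImN addrC subrK.
have [f [mf fP]] := pointwise_limit (fun n => (lu (psi n)).1) aec.
have key e : 0 < e -> exists N, forall m, (N <= m)%N ->
    L2 (fun x => u m x - f x) /\ sqn (fun x => u m x - f x) <= e.
  move=> e0; have [N NP] := cu e e0; exists N => m Nm.
  (* The shift by [N] puts every index [psi (k + N)] beyond [N]. *)
  apply: (@fatou_sqn (fun k x => u m x - v (k + N)%N x)).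
  - by move=> k; apply: L2B; exact: lu.
  - by apply: cmeasB => //; exact: (lu m).1.
  - apply: ae_imp fP => x [h1 h2]; apply: nsq_cvg.
      under eq_fun do rewrite !reim; rewrite !reim; apply: cvgB; first exact: cvg_cst.
      by have := h1; rewrite -(cvg_shiftn N).
    under eq_fun do rewrite !reim; rewrite !reim; apply: cvgB; first exact: cvg_cst.
    by have := h2; rewrite -(cvg_shiftn N).
  - move=> k; apply: NP => //.
    by apply: leq_trans (k_psi _); exact: leq_addl.
have lf : L2 f.
  have [N /(_ N (leqnn _))[h _]] := key 1 ltr01.
  have := L2B (lu N) h; congr L2; apply/funext => x; ring.
exists f; split => //; apply/cvgrPdist_le => e e0.
have [N NP] := key e e0; near=> n.
rewrite sub0r normrN ger0_norm ?sqn_ge0//; apply: (NP n _).2.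
by near: n; exists N.
Unshelve. all: by end_near. Qed.

Lemma cvg_sqr0 (T : Type) (F : set_system T) (FF : Filter F) (a b : T -> R) :
  (forall i, a i ^+ 2 <= b i) -> b i @[i --> F] --> 0 -> a i @[i --> F] --> 0.
Proof.
move=> ab b0; apply/cvgrPdist_le => e e0; near=> i.
rewrite sub0r normrN -(@ler_pXn2r _ 2)// ?nnegrE ?(ltW e0)//.
rewrite real_normK ?num_real//; apply: le_trans (ab i) _.
apply: le_trans (ler_norm _) _; rewrite -normrN -sub0r.
by near: i; move/cvgrPdist_le : b0; apply; exact: exprn_gt0.
Unshelve. all: by end_near. Qed.

Lemma inner_cvg0 (T : Type) (F : set_system T) (FF : Filter F) (u : T -> R -> R[i]) g :
  (forall i, L2 (u i)) -> L2 g -> sqn (u i) @[i --> F] --> 0 ->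
  nsq (inner (u i) g) @[i --> F] --> 0.
Proof.
move=> lu lg u0; apply: (@squeeze_cvgr _ _ _ _ (cst 0) (fun i => sqn (u i) * sqn g)).
- by apply: nearW => i; rewrite nsq_ge0/= cauchy_schwarz.
- exact: cvg_cst.
- by rewrite -[X in _ --> X](mul0r (sqn g)); apply: cvgM => //; exact: cvg_cst.
Qed.

Lemma sqn_cvg (T : Type) (F : set_system T) (FF : Filter F) (u : T -> R -> R[i]) f :
  (forall i, L2 (u i)) -> L2 f ->
  sqn (fun x => u i x - f x) @[i --> F] --> 0 -> sqn (u i) @[i --> F] --> sqn f.
Proof.
move=> lu lf uf; have lB i := L2B (lu i) lf.
have -> : (fun i => sqn (u i)) = (fun i => sqn (fun x => u i x - f x) + sqn f +
    2 * Re (inner (fun x => u i x - f x) f)).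
  apply/funext => i; rewrite -(sqnD (lB i) lf).
  by congr sqn; apply/funext => x; rewrite subrK.
rewrite [X in _ --> X](_ : _ = 0 + sqn f + 2 * 0); last by rewrite mulr0 add0r addr0.
apply: cvgD; first by apply: cvgD => //; exact: cvg_cst.
apply: cvgM; first exact: cvg_cst.
apply: (@cvg_sqr0 _ F FF _ _ _ (inner_cvg0 FF lB lf uf)) => i.
by rewrite /nsq lerDl sqr_ge0.
Qed.

End Convergence.

(** * Integrals over bounded intervals *)

Section IntervalIntegrals.
Variable R : realType.
Local Notation mu := (@lebesgue_measure R).
Implicit Types (f g k : R -> R[i]) (a b c x : R).

Lemma integrable_itv a b c :
  mu.-integrable setT (EFin \o (fun x => if x \in `[a, b[ then c else 0)).
Proof.
have -> : EFin \o (fun x => if x \in `[a, b[ then c else 0) =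
    (EFin \o cst c) \_ `[a, b[%classic.
  apply/funext => x; rewrite /patch /= mem_setE.
  by case: ifPn.
apply/(integrable_mkcond _ _).1 => //; apply: measurable_bounded_integrable => //=.
- rewrite lebesgue_measure_itv /=; case: ifPn => _; rewrite ?ltry// -EFinB ltry.
- by exists `|c|; split; [exact: num_real|move=> M cM x _ /=; exact: ltW].
Qed.

Lemma L2_itv a b k (M : R) : cmeas k -> (forall x, x \in `[a, b[ -> nsq (k x) <= M) ->
  L2 (fun x => if x \in `[a, b[ then k x else 0).
Proof.
move=> mk kM; apply: (L2_dom _ (integrable_itv a b M)).
  exact: cmeas_if (measurable_itv_fun _) mk (cmeas_cst 0).
by move=> x; case: ifPn => [/kM//|_]; rewrite nsq0.
Qed.

(** Each component is dominated by the indicator of the interval plus [nsq f]. *)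
Lemma L2_L1_itv a b f : L2 f -> (forall x, x \notin `[a, b[ -> f x = 0) -> L1 f.
Proof.
move=> lf f0; apply: (L1_dom lf.1 (integrableDR (integrable_itv a b 1) (L2_int lf))) => x.
- case: ifPn => [_|/f0 ->]; last by rewrite !reim nsq0 normr0 addr0.
  by apply: le_1_sqr; rewrite /nsq lerDl sqr_ge0.
- case: ifPn => [_|/f0 ->]; last by rewrite !reim nsq0 normr0 addr0.
  by apply: le_1_sqr; rewrite /nsq lerDr sqr_ge0.
Qed.

Lemma Rintegral_itv a b (r : R -> R) :
  measurable_fun [set: R] r ->
  \int[mu]_x (if x \in `[a, b[ then r x else 0) = \int[mu]_(x in `[a, b]) r x.
Proof.
move=> mr; rewrite /Rintegral; congr fine.
rewrite -integral_itv_bndo_bndc; last first.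
  by apply/measurable_EFinP; exact: measurable_funTS.
rewrite [RHS]integral_mkcond; apply: eq_integral => x _.
by rewrite /patch mem_setE; case: ifPn.
Qed.

Lemma Rintegral_cos c a b : c != 0 -> a < b ->
  \int[mu]_(x in `[a, b]) cos (c * x) = (sin (c * b) - sin (c * a)) / c.
Proof.
move=> c0 ab.
have dF x : is_derive x 1 (fun x : R => sin (c * x) / c) (cos (c * x)).
  have := is_deriveZ c^-1 (is_derive1_comp (is_derive_sin (c * x))
    (is_deriveZ c (is_derive_id x 1))).
  rewrite (_ : _ \*: _ = (fun x : R => sin (c * x) / c)); last first.
    by apply/funext => y; rewrite mulrC.
  by move/is_derive_eq; apply; rewrite /GRing.scale/=; field.
rewrite /Rintegral (@continuous_FTC2 _ _ (fun x => sin (c * x) / c))//.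
- by rewrite /= mulrBl.
- apply: continuous_subspaceT => x.
  apply: (@continuous_comp _ _ _ ( *%R c) cos); last exact: continuous_cos.
  exact: mulrl_continuous.
- have cF : continuous (fun x : R => sin (c * x) / c).
    by move=> x; apply/differentiable_continuous/derivable1_diffP; case: (dF x).
  split.
  + by move=> x _; case: (dF x).
  + by apply: cvg_at_right_filter; exact: cF.
  + by apply: cvg_at_left_filter; exact: cF.
- by move=> x _; rewrite derive1E; case: (dF x).
Qed.

Lemma Rintegral_sin c a b : c != 0 -> a < b ->
  \int[mu]_(x in `[a, b]) sin (c * x) = (cos (c * a) - cos (c * b)) / c.
Proof.
move=> c0 ab.
have dF x : is_derive x 1 (fun x : R => - cos (c * x) / c) (sin (c * x)).
  have := is_deriveZ (- c^-1) (is_derive1_comp (is_derive_cos (c * x))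
    (is_deriveZ c (is_derive_id x 1))).
  rewrite (_ : _ \*: _ = (fun x : R => - cos (c * x) / c)); last first.
    by apply/funext => y; rewrite /= /GRing.scale /=; ring.
  by move/is_derive_eq; apply; rewrite /GRing.scale/=; field.
rewrite /Rintegral (@continuous_FTC2 _ _ (fun x => - cos (c * x) / c))//.
- by rewrite /= mulrBl; ring.
- apply: continuous_subspaceT => x.
  apply: (@continuous_comp _ _ _ ( *%R c) sin); last exact: continuous_sin.
  exact: mulrl_continuous.
- have cF : continuous (fun x : R => - cos (c * x) / c).
    by move=> x; apply/differentiable_continuous/derivable1_diffP; case: (dF x).
  split.
  + by move=> x _; case: (dF x).
  + by apply: cvg_at_right_filter; exact: cF.
  + by apply: cvg_at_left_filter; exact: cF.
- by move=> x _; rewrite derive1E; case: (dF x).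
Qed.

Lemma sin_npi (n : nat) : sin (n%:R * pi) = 0 :> R.
Proof.
elim: n => [|n IH]; first by rewrite mul0r sin0.
by rewrite -natr1 mulrDl mul1r sinD IH mul0r sinpi mulr0 addr0.
Qed.

Lemma sin_zpi (n : int) : sin (n%:~R * pi) = 0 :> R.
Proof.
case: n => n; first exact: sin_npi.
by rewrite NegzE mulrNz mulNr sinN sin_npi oppr0.
Qed.

End IntervalIntegrals.

(** * Fourier series *)

Section FourierSeries.
Variable R : realType.
Local Notation mu := (@lebesgue_measure R).
Variables p w : R.
Hypotheses (p0 : 0 < p) (wp : w * p = 2 * pi).
Implicit Types (f g F : R -> R[i]) (x : R) (n m : int).

Definition ev n x : R[i] := expi (n%:~R * (w * x)).
Local Notation cell := `[- (p / 2), p / 2[.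
Definition evI n x : R[i] := if x \in cell then ev n x else 0.
(** The integral is over the whole line: [F] is meant to vanish off the cell. There is no division
    by the period, so [fc] is [p] times the usual coefficient, which is [coefs] below. *)
Definition fc F n : R[i] := cintegral (fun x => F x * ev (- n) x).

Lemma w_neq0 : w != 0.
Proof. by apply: contra_eq_neq wp => ->; rewrite mul0r eq_sym mulf_neq0// gt_eqF ?pi_gt0. Qed.

Lemma cmeas_ev n : cmeas (ev n).
Proof.
apply: cmeas_expi; apply: measurable_funM; first exact: measurable_cst.
exact: measurable_funM.
Qed.

Lemma evD n m x : ev (n + m) x = ev n x * ev m x.
Proof. by rewrite /ev intrD mulrDl expiD. Qed.

Lemma ev0 x : ev 0 x = 1. Proof. by rewrite /ev mul0r expi0. Qed.

Lemma evJ n x : conjc (ev n x) = ev (- n) x.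
Proof. by rewrite /ev expiJ mulrNz mulNr. Qed.

Lemma nsq_ev n x : nsq (ev n x) = 1. Proof. exact: nsq_expi. Qed.

Lemma ev_shift n (k : int) x : ev n (x + k%:~R * p) = ev n x.
Proof.
rewrite /ev mulrDr mulrDr expiD.
have -> : n%:~R * (w * (k%:~R * p)) = (n * k)%:~R * (2 * pi) :> R.
  by rewrite -wp intrM; ring.
by rewrite expi_2piz mulr1.
Qed.

Lemma L2_evI n : L2 (evI n).
Proof. by apply: (L2_itv (M := 1) (cmeas_ev n)) => x _; rewrite nsq_ev. Qed.

Lemma inner_evI F n : (forall x, x \notin cell -> F x = 0) ->
  inner F (evI n) = fc F n.
Proof.
move=> F0; rewrite /inner /fc; congr cintegral; apply/funext => x.
by rewrite /evI; case: ifPn => [_|/F0 ->]; rewrite ?mul0r// evJ.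
Qed.

Lemma evI_out n x : x \notin cell -> evI n x = 0.
Proof. by rewrite /evI => /negbTE ->. Qed.

Lemma fc_evI n m : fc (evI n) m = if n == m then (p%:C)%C else 0.
Proof.
have -> : fc (evI n) m = cintegral (evI (n - m)).
  rewrite /fc; congr cintegral; apply/funext => x; rewrite /evI.
  by case: ifPn => _; rewrite ?mul0r// -evD.
set k := n - m; have [nm|nm] := eqVneq n m.
  rewrite /k nm subrr; apply: complexP; rewrite ?(Re_cint, Im_cint).
    rewrite (_ : (fun x => _) = (fun x => if x \in cell then (cst 1 x) else 0)).
      rewrite Rintegral_itv//.
      rewrite Rintegral_cst//= mul1r lebesgue_measure_itv/= lte_fin.
      by rewrite ifT ?gtrN ?divr_gt0//=; field.
    by apply/funext => x; rewrite /evI; case: ifPn => // _; rewrite ev0.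
  rewrite (_ : (fun x => _) = cst 0) ?Rintegral_cst ?mul0r//.
  by apply/funext => x; rewrite /evI; case: ifPn => // _; rewrite ev0.
have k0 : k%:~R != 0 :> R by rewrite intr_eq0 subr_eq0.
have kw0 : k%:~R * w != 0 by rewrite mulf_neq0// w_neq0.
have p2 : - (p / 2) < p / 2 by have := p0; lra.
have kwp : k%:~R * w * (p / 2) = k%:~R * pi.
  by rewrite -mulrA; congr (_ * _); have := wp; lra.
apply: complexP; rewrite ?(Re_cint, Im_cint).
  rewrite (_ : (fun x => _) = (fun x => if x \in cell then cos (k%:~R * w * x) else 0)).
    rewrite Rintegral_itv; last first.
      apply: (measurableT_comp (continuous_measurable_fun (@continuous_cos R))).
      exact: measurable_funM.
    by rewrite Rintegral_cos// mulrN sinN kwp sin_zpi oppr0 subrr mul0r.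
  by apply/funext => x; rewrite /evI; case: ifPn => // _; rewrite /ev mulrA.
rewrite (_ : (fun x => _) = (fun x => if x \in cell then sin (k%:~R * w * x) else 0)).
  rewrite Rintegral_itv; last first.
    apply: (measurableT_comp (continuous_measurable_fun (@continuous_sin R))).
    exact: measurable_funM.
  by rewrite Rintegral_sin// mulrN cosN subrr mul0r.
by apply/funext => x; rewrite /evI; case: ifPn => // _; rewrite /ev mulrA.
Qed.

Definition trig (a : int -> R[i]) (s : seq int) x : R[i] := \sum_(n <- s) a n * evI n x.

Lemma L2_trig a s : L2 (trig a s).
Proof. by apply: L2_sum => n; apply: L2Z; exact: L2_evI. Qed.

Lemma trig_out a s x : x \notin cell -> trig a s x = 0.
Proof. by move=> xI; rewrite /trig big1// => n _; rewrite evI_out// mulr0. Qed.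

Lemma inner_trig a s m : uniq s -> inner (trig a s) (evI m) =
  if m \in s then a m * (p%:C)%C else 0.
Proof.
move=> us; rewrite inner_suml; [|by move=> n; apply: L2Z; exact: L2_evI|exact: L2_evI].
have E n : inner (fun x => a n * evI n x) (evI m) = a n * (if n == m then p%:C%C else 0).
  rewrite innerZl; [|exact: L2_evI..].
  by rewrite inner_evI ?fc_evI// => x; exact: evI_out.
under eq_bigr do rewrite E.
case: ifPn => ms.
  rewrite (bigD1_seq m)//= eqxx big1 ?addr0// => n /negbTE ->.
  by rewrite mulr0.
rewrite big_seq big1// => n ns; case: eqP => [nm|_]; last by rewrite mulr0.
by rewrite nm in ns; rewrite ns in ms.
Qed.

(** Arbitrary coefficients [a] make one induction serve twice: the last sum vanishes for the
    coefficients of [F] (Bessel), and [F = 0] gives the norm of a trigonometric polynomial. *)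
Lemma pythagoras F a s : L2 F -> (forall x, x \notin cell -> F x = 0) -> uniq s ->
  sqn (fun x => F x - trig a s x) =
  sqn F - p^-1 * \sum_(n <- s) nsq (fc F n)
    + p * \sum_(n <- s) nsq (a n - (p^-1)%:C%C * fc F n).
Proof.
move=> lF F0; elim: s => [_|n s IH /= /andP[ns us]].
  rewrite !big_nil !mulr0 subr0 addr0; congr sqn; apply/funext => x.
  by rewrite /trig big_nil subr0.
rewrite !big_cons.
have -> : (fun x => F x - trig a (n :: s) x) =
    (fun x => (F x - trig a s x) - a n * evI n x).
  by apply/funext => x; rewrite /trig big_cons; ring.
rewrite sqnB; [|by apply: L2B => //; exact: L2_trig|by apply: L2Z; exact: L2_evI].
rewrite IH// sqnZ; last exact: L2_evI.
have lB : L2 (fun x => F x - trig a s x) by apply: L2B => //; exact: L2_trig.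
have -> : sqn (evI n) = p.
  by have := inner_self (evI n); rewrite inner_evI ?fc_evI ?eqxx => [[]//|]; exact: evI_out.
rewrite (innerC (L2Z _ (L2_evI n)) lB) innerZl//; last exact: L2_evI.
rewrite (innerC lB (L2_evI n)) innerBl//; [|exact: L2_trig|exact: L2_evI].
rewrite inner_trig// (negbTE ns) subr0 inner_evI//.
rewrite cReJ /nsq; case: (fc F n) => b c; case: (a n) => d e /=.
by field; rewrite gt_eqF.
Qed.

Lemma bernoulli_ge (y : R) (n : nat) : 0 <= y -> 1 + n%:R * y <= (1 + y) ^+ n.
Proof.
move=> y0; elim: n => [|n IH]; first by rewrite mul0r addr0 expr0.
rewrite exprS; apply: (@le_trans _ _ ((1 + y) * (1 + n%:R * y))).
  have : 0 <= n%:R :> R by []; rewrite -natr1; nra.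
by rewrite ler_wpM2l// addr_ge0.
Qed.

Lemma bernoulli_le (y : R) (n : nat) : 0 <= y <= 1 -> 1 - n%:R * y <= (1 - y) ^+ n.
Proof.
move=> /andP[y0 y1]; elim: n => [|n IH]; first by rewrite mul0r subr0 expr0.
rewrite exprS; apply: (@le_trans _ _ ((1 - y) * (1 - n%:R * y))).
  have : 0 <= n%:R :> R by []; rewrite -natr1; nra.
by rewrite ler_wpM2l// subr_ge0.
Qed.

(* A polynomial in [r] tending boundedly on [[0, 1]] to the indicator of
   [r < 1/2]; applied to an affine function of a cosine, it localizes a function
   whose Fourier coefficients vanish. *)
Definition stepq (k : nat) (r : R) : R := (1 - r ^+ (2 * k)) ^+ (k * 4 ^ k).

Lemma stepq_bnd k (r : R) : 0 <= r <= 1 -> 0 <= stepq k r <= 1.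
Proof.
move=> /andP[r0 r1].
have y0 : 0 <= r ^+ (2 * k) by rewrite exprn_ge0.
have y1 : r ^+ (2 * k) <= 1 by rewrite exprn_ile1.
by rewrite /stepq exprn_ge0 ?subr_ge0//= exprn_ile1 ?subr_ge0// lerBlDr lerDl.
Qed.

(** Put [y = r^(2k)], [M = k 4^k] and [z = 2 r], so that [M y = k z^(2k)]. If [z < 1], Bernoulli
    gives [(1 - y)^M >= 1 - M y], which tends to 1. If [z >= 1], then [(1 - y)^M (1 + y)^M <= 1] and
    [(1 + y)^M >= 1 + k]. The factor [k] in the exponent is what forces the limit 0 at [r = 1/2]. *)
Lemma stepq_cvg (r : R) : 0 <= r <= 1 ->
  stepq k r @[k --> \oo] --> (if r < 1 / 2 then 1 else 0 : R).
Proof.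
move=> r01; have /andP[r0 r1] := r01.
have y01 k : 0 <= r ^+ (2 * k) <= 1 by rewrite exprn_ge0// exprn_ile1.
pose z := 2 * r.
have tE k : (k * 4 ^ k)%:R * r ^+ (2 * k) = k%:R * z ^+ k * z ^+ k.
  by rewrite /z natrM natrX (natrM _ 2 2) mul2n -addnn exprD !exprMn; ring.
case: ifPn => [rl|]; last rewrite -leNgt => rg.
- have z0 : 0 <= z by rewrite mulr_ge0.
  have z1 : z < 1 by rewrite /z; move: rl; lra.
  (* This is [k z^k <= 1 + z + ... + z^(k-1)] multiplied by [1 - z]. *)
  have kz k : k%:R * z ^+ k * (1 - z) <= 1 - z ^+ k.
    elim: k => [|k IH]; first by rewrite mul0r mul0r expr0 subrr.
    rewrite exprS -natr1.
    have h0 : 0 <= z ^+ k by rewrite exprn_ge0.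
    have h1 : z ^+ k <= 1 by rewrite exprn_ile1// ltW.
    have h2 := ler_wpM2l z0 IH.
    have h3 : z * z ^+ k <= 1 by rewrite mulr_ile1// ltW.
    have h4 : 0 <= (1 - z) * (1 - z * z ^+ k) by rewrite mulr_ge0 ?subr_ge0 ?(ltW z1).
    by move: h2 h4; lra.
  apply: (@squeeze_cvgr _ _ _ _ (fun k => 1 - z ^+ k / (1 - z)) (cst 1)).
  + apply: nearW => k; have /andP[_ ->] := stepq_bnd k r01; rewrite andbT.
    apply: le_trans (bernoulli_le _ (y01 k)); rewrite tE lerD2l lerN2.
    rewrite ler_pdivlMr ?subr_gt0//.
    have h0 : 0 <= z ^+ k by rewrite exprn_ge0.
    have := kz k; nra.
  + rewrite [X in _ --> X](_ : 1 = 1 - 0 / (1 - z)); last by rewrite mul0r subr0.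
    apply: cvgB; first exact: cvg_cst.
    apply: cvgM; last exact: cvg_cst.
    by apply: cvg_expr; rewrite ger0_norm.
  + exact: cvg_cst.
- have z1 : 1 <= z by rewrite /z; move: rg; lra.
  apply: (@squeeze_cvgr _ _ _ _ (cst 0) (fun k => (k.+1%:R)^-1)).
  + apply: nearW => k; have /andP[-> _] := stepq_bnd k r01; rewrite /=.
    have /andP[y0 y1] := y01 k.
    set y := r ^+ (2 * k) in y0 y1 *; set M := (k * 4 ^ k)%N.
    have Mk : k.+1%:R <= (1 + y) ^+ M.
      apply: le_trans (bernoulli_ge M y0); rewrite -natr1 addrC lerD2l /M /y tE.
      rewrite -mulrA ler_peMr// -exprMn exprn_ege1//.
      by have := z1; nra.
    rewrite -[leRHS]mul1r ler_pdivlMr//.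
    apply: (@le_trans _ _ (stepq k r * (1 + y) ^+ M)).
      by rewrite ler_wpM2l//; have /andP[] := stepq_bnd k r01.
    rewrite /stepq -/M -/y -exprMn exprn_ile1//.
      by rewrite mulr_ge0 ?subr_ge0// addr_ge0.
    by have := sqr_ge0 y; lra.
  + exact: cvg_cst.
  + exact: cvg_harmonic.
Qed.

(** * Totality of the exponentials *)

Section Totality.
Variable g : R -> R[i].
Hypotheses (lg : L1 g) (g0 : forall x, x \notin cell -> g x = 0)
  (fc0 : forall n, fc g n = 0).

(* The bounded multipliers [q] such that all the Fourier coefficients of [g * q]
   vanish are stable under multiplication by trigonometric polynomials. *)
Definition annih (q : R -> R) := [/\ measurable_fun [set: R] q,
  exists M, forall x, `|q x| <= M &
  forall n, cintegral (fun x => g x * (q x)%:C%C * ev n x) = 0].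

Lemma L1_annih (q : R -> R) n : measurable_fun [set: R] q ->
  (exists M, forall x, `|q x| <= M) -> L1 (fun x => g x * (q x)%:C%C * ev n x).
Proof.
move=> mq [M qM].
apply: (@L1_bnd _ _ _ 1); last by move=> x; rewrite nsq_ev.
  apply: (@L1_bnd _ _ _ (M ^+ 2) lg (cmeas_real mq)) => x.
  rewrite nsqC -real_normK ?num_real// ler_pXn2r ?nnegrE//.
  exact: le_trans (qM x).
exact: cmeas_ev.
Qed.

Lemma annih1 : annih (cst 1).
Proof.
split; [exact: measurable_cst|by exists 1 => x; rewrite normr1|move=> n].
have := fc0 (- n); rewrite /fc opprK; congr (_ = _).
by congr cintegral; apply/funext => x; rewrite mulr1.
Qed.

Lemma annihD q1 q2 : annih q1 -> annih q2 -> annih (fun x => q1 x + q2 x).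
Proof.
move=> [m1 [M1 b1] a1] [m2 [M2 b2] a2]; split.
- exact: measurable_funD.
- by exists (M1 + M2) => x; rewrite (le_trans (ler_normD _ _))// lerD.
move=> n; under eq_fun do rewrite rmorphD/= mulrDr mulrDl.
by rewrite cintD ?a1 ?a2 ?addr0//; apply: L1_annih => //; [exists M1|exists M2].
Qed.

Lemma annihZ c q : annih q -> annih (fun x => c * q x).
Proof.
move=> [m1 [M1 b1] a1]; split.
- exact: measurable_funM.
- by exists (`|c| * M1) => x; rewrite normrM ler_wpM2l.
move=> n.
rewrite (_ : (fun x => _) = (fun x => c%:C%C * (g x * (q x)%:C%C * ev n x))).
  by rewrite cintZ ?a1 ?mulr0//; apply: L1_annih => //; exists M1.
by apply/funext => x; rewrite rmorphM/=; ring.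
Qed.

Lemma cosE_ev (t : R) x : (cos (w * x - t))%:C%C =
  (1 / 2)%:C%C * expi (- t) * ev 1 x + (1 / 2)%:C%C * expi t * ev (-1) x :> R[i].
Proof.
rewrite -!mulrA /ev -!expiD.
have -> : t + (-1)%:~R * (w * x) = - (- t + 1%:~R * (w * x)).
  by rewrite mulrN1z; ring.
have -> : w * x - t = - t + 1%:~R * (w * x) by rewrite mul1r addrC.
set y := - t + _; rewrite -expiJ.
by apply: complexP; rewrite /= ; field.
Qed.

Lemma annih_cos (t : R) q : annih q -> annih (fun x => q x * cos (w * x - t)).
Proof.
move=> [m1 [M1 b1] a1].
have mc : measurable_fun [set: R] (fun x => cos (w * x - t)).
  apply: (measurableT_comp (continuous_measurable_fun (@continuous_cos R))).
  by apply: measurable_funB => //; exact: measurable_funM.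
split.
- exact: measurable_funM.
- by exists (M1 * 1) => x; rewrite normrM ler_pM// ler_norml cos_geN1 cos_le1.
move=> n.
rewrite (_ : (fun x => _) = (fun x =>
    (1 / 2)%:C%C * expi (- t) * (g x * (q x)%:C%C * ev (1 + n) x) +
    (1 / 2)%:C%C * expi t * (g x * (q x)%:C%C * ev (-1 + n) x))).
  have l1 m : L1 (fun x => g x * (q x)%:C%C * ev m x).
    by apply: L1_annih => //; exists M1.
  by rewrite cintD ?cintZ ?a1 ?mulr0 ?addr0//; exact: L1Z.
by apply/funext => x; rewrite rmorphM /= cosE_ev !evD; ring.
Qed.

Definition multiplier (r : R -> R) := forall q, annih q -> annih (fun x => q x * r x).

Lemma multiplierX r (n : nat) : multiplier r -> multiplier (fun x => r x ^+ n).
Proof.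
move=> mr; elim: n => [|n IH] q aq.
  by under eq_fun do rewrite expr0 mulr1.
by under eq_fun do rewrite exprSr mulrA; apply: mr; exact: IH.
Qed.

Lemma multiplier_affine r a b : multiplier r -> multiplier (fun x => a + b * r x).
Proof.
move=> mr q aq.
under eq_fun do rewrite mulrDr (mulrC _ a) mulrCA.
by apply: annihD; apply: annihZ => //; exact: mr.
Qed.

Lemma multiplier_cos (t : R) : multiplier (fun x => cos (w * x - t)).
Proof. by move=> q; exact: annih_cos. Qed.

(** The affine function [r] of the cosine takes values in [[0, 1]] and is below [1/2] exactly where
    the cosine is below [c]. Each [stepq k (r x)] is a polynomial in that cosine, so [g] integrates
    to 0 against it; dominated convergence reaches the indicator. *)
Lemma cint_halfspace (t c : R) : -1 <= c <= 1 ->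
  cintegral (fun x => if cos (w * x - t) < c then g x else 0) = 0.
Proof.
move=> /andP[c1 c2].
pose r x := (1 / 2 - c / 4) + 4^-1 * cos (w * x - t).
have r01 x : 0 <= r x <= 1.
  by rewrite /r; have := cos_le1 (w * x - t); have := cos_geN1 (w * x - t); lra.
have mr : multiplier r by apply: multiplier_affine; exact: multiplier_cos.
have aq k : annih (fun x => stepq k (r x)).
  have : multiplier (fun x => stepq k (r x)).
    apply: multiplierX; have := multiplier_affine 1 (-1) (multiplierX (2 * k) mr).
    by under eq_fun do rewrite mulN1r.
  by move=> /(_ _ annih1); under eq_fun do rewrite mul1r.
have lq k : L1 (fun x => g x * (stepq k (r x))%:C%C * ev 0 x).
  by case: (aq k) => ? ? _; exact: L1_annih.
pose b x := `|Re (g x)| + `|Im (g x)|.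
have ib : mu.-integrable setT (EFin \o b).
  by apply: integrableDR; apply: integrable_normR; case: lg.
have sq k x : 0 <= stepq k (r x) <= 1 by exact: stepq_bnd.
have [H1 H2] : (Re (cintegral (fun x => g x * (stepq k (r x))%:C%C * ev 0 x)) @[k --> \oo] -->
   Re (cintegral (fun x => if cos (w * x - t) < c then g x else 0))) /\
   (Im (cintegral (fun x => g x * (stepq k (r x))%:C%C * ev 0 x)) @[k --> \oo] -->
   Im (cintegral (fun x => if cos (w * x - t) < c then g x else 0))).
  have rc x : (r x < 1 / 2) = (cos (w * x - t) < c).
    by rewrite /r; apply/idP/idP; lra.
  apply: (cint_dct (g := b)).
  - by move=> k; exact: L1_cmeas.
  - move=> x; rewrite -rc.
    rewrite (_ : Re _ = Re (g x) * (if r x < 1 / 2 then 1 else 0)); last first.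
      by case: ifP; rewrite ?mulr1 ?mulr0.
    under eq_fun do rewrite ev0 mulr1 cReM /= mulr0 subr0.
    by apply: cvgM; [exact: cvg_cst|exact: stepq_cvg].
  - move=> x; rewrite -rc.
    rewrite (_ : Im _ = Im (g x) * (if r x < 1 / 2 then 1 else 0)); last first.
      by case: ifP; rewrite ?mulr1 ?mulr0.
    under eq_fun do rewrite ev0 mulr1 cImM /= mulr0 add0r.
    by apply: cvgM; [exact: cvg_cst|exact: stepq_cvg].
  - exact: ib.
  - move=> k x; rewrite ev0 mulr1 cReM /= mulr0 subr0 normrM /b.
    have /andP[s0 s1] := sq k x; rewrite (ger0_norm s0).
    by rewrite (@le_trans _ _ `|Re (g x)|) ?ler_piMr// lerDl.
  - move=> k x; rewrite ev0 mulr1 cImM /= mulr0 add0r normrM /b.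
    have /andP[s0 s1] := sq k x; rewrite (ger0_norm s0).
    by rewrite (@le_trans _ _ `|Im (g x)|) ?ler_piMr// lerDr.
have cq k : cintegral (fun x => g x * (stepq k (r x))%:C%C * ev 0 x) = 0.
  by case: (aq k) => _ _ ->.
apply: complexP.
  apply: (cvg_unique _ H1) => //.
  rewrite (_ : (fun k => Re _) = cst 0); first exact: cvg_cst.
  by apply/funext => k; rewrite cq.
apply: (cvg_unique _ H2) => //.
rewrite (_ : (fun k => Im _) = cst 0); first exact: cvg_cst.
by apply/funext => k; rewrite cq.
Qed.

Lemma w_gt0 : 0 < w.
Proof.
have : 0 < w * p by rewrite wp mulr_gt0// pi_gt0.
by rewrite pmulr_lgt0.
Qed.

(** Within one period the points up to [b] form an arc, cut out by a cosine centred at its midpoint.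
    Since [cos (A + B) - cos (A - B) = - 2 sin A sin B] and [A] lies in [[0, pi[], the sign is
    decided by [B], a positive multiple of [x - b]. *)
Lemma cell_le_cos x (b : R) : x \in cell -> - (p / 2) < b < p / 2 ->
  (x <= b) = ~~ (cos (w * x - w * ((b - p / 2) / 2)) < cos (w * ((b + p / 2) / 2))).
Proof.
rewrite in_itv/= => /andP[x1 x2] /andP[b1 b2]; rewrite -leNgt.
pose A := w * (x + p / 2) / 2; pose B := w * (x - b) / 2.
have -> : w * x - w * ((b - p / 2) / 2) = A + B by rewrite /A /B; field.
have -> : w * ((b + p / 2) / 2) = A - B by rewrite /A /B; field.
rewrite -[cos _ <= _]subr_ge0 cosD cosB.
rewrite (_ : _ - _ = - (2 * (sin A * sin B))); last by ring.
rewrite oppr_ge0 pmulr_rle0//.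
have w0 := w_gt0.
have A0 : 0 <= A by rewrite /A divr_ge0// mulr_ge0 ?(ltW w0)//; lra.
have Api : A < pi.
  have -> : pi = w * p / 2 by rewrite wp; field.
  by rewrite /A ltr_pM2r ?invr_gt0// ltr_pM2l//; lra.
have Bpi : w * p / 2 = pi by rewrite wp; field.
have [xb|bx] := leP x b.
- apply/esym/mulr_ge0_le0; first by apply: sin_ge0_pi; rewrite A0 ltW.
  rewrite -oppr_ge0 -sinN; apply: sin_ge0_pi.
  rewrite /B -mulNr -mulrN opprB -Bpi; apply/andP; split.
    by rewrite divr_ge0// mulr_ge0 ?(ltW w0)// subr_ge0.
  by rewrite ler_pM2r ?invr_gt0// ler_pM2l//; lra.
- apply/esym/negbTE; rewrite -ltNge; apply: mulr_gt0.
    apply: sin_gt0_pi; rewrite Api andbT /A divr_gt0// mulr_gt0//; lra.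
  apply: sin_gt0_pi; rewrite /B -Bpi; apply/andP; split.
    by rewrite divr_gt0// mulr_gt0// subr_gt0.
  by rewrite ltr_pM2r ?invr_gt0// ltr_pM2l//; lra.
Qed.

Lemma cint_le_eq0 (b : R) : - (p / 2) < b < p / 2 ->
  cintegral (fun x => if x <= b then g x else 0) = 0.
Proof.
move=> bp; set t := w * ((b - p / 2) / 2); set c := cos (w * ((b + p / 2) / 2)).
have E : (fun x => if x <= b then g x else 0) =
    (fun x => g x - (if cos (w * x - t) < c then g x else 0)).
  apply/funext => x; have [xI|/g0->] := boolP (x \in cell); last by rewrite !if_same subr0.
  by rewrite (cell_le_cos xI bp) -/t -/c; case: (_ < c); rewrite /= ?subr0 ?subrr.
have G0 : cintegral g = 0.
  have := fc0 0; rewrite /fc oppr0 => <-; congr cintegral; apply/funext => x.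
  by rewrite ev0 mulr1.
rewrite E cintB ?G0 ?cint_halfspace ?subr0//.
  by rewrite cos_le1 cos_geN1.
have mc : cmeas (fun x => if cos (w * x - t) < c then (1 : R[i]) else 0).
  apply: cmeas_if; [|exact: cmeas_cst|exact: cmeas_cst].
  apply: measurable_fun_ltr; last exact: measurable_cst.
  apply: (measurableT_comp (continuous_measurable_fun (@continuous_cos R))).
  by apply: measurable_funB => //; exact: measurable_funM.
rewrite (_ : (fun x => _) = (fun x => g x * (if cos (w * x - t) < c then 1 else 0))).
  apply: (L1_bnd (M := 1) lg mc) => x.
  by case: ifP => _; rewrite /nsq /= ?expr0n ?expr1n ?addr0.
by apply/funext => x; case: ifP; rewrite ?mulr1 ?mulr0.
Qed.

(** The primitive of [r] vanishes on the open cell, so its derivative is 0 there, and by Lebesgue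
    differentiation that derivative is [r] almost everywhere. The left endpoint is discarded to have
    a neighbourhood inside the cell. *)
Lemma real_ae0 (r : R -> R) : mu.-integrable setT (EFin \o r) ->
  (forall x, x \notin cell -> r x = 0) ->
  (forall b, - (p / 2) < b < p / 2 -> \int[mu]_x (if x <= b then r x else 0) = 0) ->
  {ae mu, forall x, r x = 0}.
Proof.
move=> ir r0 intr0.
have mr : measurable_fun [set: R] r by apply/measurable_EFinP; exact: measurable_int ir.
have iy y : mu.-integrable `]-oo, y] (EFin \o r) by exact: integrableS ir.
have lr : locally_integrable [set: R] r.
  by apply: open_integrable_locally => //; exact: openT.
have F0 (b : R) : - (p / 2) < b < p / 2 -> \int[mu]_(t in `]-oo, b]) r t = 0.
  move=> bp; rewrite -[RHS](intr0 b bp) Rintegral_mkcond; apply: eq_Rintegral => x _.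
  by rewrite /patch mem_setE in_itv.
have ne : {ae mu, forall x, x != - (p / 2)}.
  exists [set - (p / 2)]; split => //; first exact: lebesgue_measure_set1.
  by move=> x /= /negP; rewrite negbK => /eqP.
move: ne (FTC1Ny iy lr); apply: ae_imp2 => x xp [_ Fx].
have [|/r0//] := boolP (x \in cell); rewrite in_itv/= => /andP[x1 x2].
rewrite -Fx derive1E (@near_eq_derive _ _ _ _ (cst 0)).
  by rewrite -derive1E derive1_cst.
have xo : x \in `]- (p / 2), p / 2[ by rewrite in_itv/= x2 lt_neqAle x1 eq_sym xp.
near=> y; apply: F0.
have : y \in `]- (p / 2), p / 2[ by near: y; exact: near_in_itvoo.
by rewrite in_itv.
Unshelve. all: by end_near. Qed.

Lemma fc_total : {ae mu, forall x, g x = 0}.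
Proof.
have [ir ii] := lg.
have h1 : {ae mu, forall x, Re (g x) = 0}.
  apply: real_ae0 => // [x /g0->//|b bp].
  rewrite -[RHS](congr1 (@complex.Re R) (cint_le_eq0 bp)) Re_cint.
  by apply: eq_Rintegral => x _; case: ifP.
have h2 : {ae mu, forall x, Im (g x) = 0}.
  apply: real_ae0 => // [x /g0->//|b bp].
  rewrite -[RHS](congr1 (@complex.Im R) (cint_le_eq0 bp)) Im_cint.
  by apply: eq_Rintegral => x _; case: ifP.
by apply: ae_imp2 h1 h2 => x h3 h4; apply: complexP; rewrite ?h3 ?h4.
Qed.

End Totality.

(** * Bessel, Riesz-Fischer and Parseval *)

Definition zenum (n : nat) : int := if odd n then Negz n./2 else Posz n./2.
Definition zrank (z : int) : nat := match z with Posz k => k.*2 | Negz k => k.*2.+1 end.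

Lemma zenumK : cancel zenum zrank.
Proof.
move=> n; rewrite /zenum; have := odd_double_half n.
by case: (odd n) => /= E; rewrite -[RHS]E.
Qed.

Lemma zrankK : cancel zrank zenum.
Proof.
by case=> k; rewrite /zenum /zrank /= odd_double /= ?uphalf_double ?doubleK.
Qed.

Lemma zenum_bij : set_bij [set: nat] [set: int] zenum.
Proof.
split => //; first by move=> x y _ _; exact: (can_inj zenumK).
by move=> z _; exists (zrank z) => //; exact: zrankK.
Qed.

Definition zseq (n : nat) : seq int := map zenum (iota 0 n).

Lemma zseq_uniq (n : nat) : uniq (zseq n).
Proof. by rewrite map_inj_uniq ?iota_uniq//; exact: (can_inj zenumK). Qed.

Lemma big_zseq (V : nmodType) (F : int -> V) (n : nat) :
  \sum_(m <- zseq n) F m = \sum_(0 <= i < n) F (zenum i).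
Proof. by rewrite /zseq big_map /index_iota subn0. Qed.

Lemma mem_zseq (m : int) (n : nat) : (zrank m < n)%N -> m \in zseq n.
Proof.
move=> mn; apply/mapP; exists (zrank m); last by rewrite zrankK.
by rewrite mem_iota add0n.
Qed.

(** Sums over the integers in the statement are unordered. For nonnegative terms they equal the
    limit along the enumeration 0, -1, 1, -2, ... of [zenum]. *)
Lemma esum_int (a : int -> R) (l : R) : (forall n, 0 <= a n) ->
  \sum_(0 <= i < n) a (zenum i) @[n --> \oo] --> l ->
  (\esum_(n in [set: int]) (a n)%:E = l%:E)%E.
Proof.
move=> a0 al; rewrite (reindex_esum _ _ _ _ zenum_bij) -nneseries_esumT; last first.
  by move=> n; rewrite lee_fin.
apply: cvg_lim => //; under eq_fun do rewrite sumEFin.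
exact: cvg_EFin_seq.
Qed.

Lemma esum_int_bnd (a : int -> R) : (forall n, 0 <= a n) ->
  (\esum_(n in [set: int]) (a n)%:E < +oo)%E ->
  exists C, forall n : nat, \sum_(0 <= i < n) a (zenum i) <= C.
Proof.
move=> a0; rewrite (reindex_esum _ _ _ _ zenum_bij) -nneseries_esumT; last first.
  by move=> n; rewrite lee_fin.
set X := (\sum_(0 <= i <oo) _)%E => Xoo.
have X0 : (0 <= X)%E by apply: nneseries_ge0 => n _ _; rewrite lee_fin.
exists (fine X) => n; rewrite -lee_fin fineK ?ge0_fin_numE// -sumEFin.
by apply: nneseries_lim_ge => k _ _; rewrite lee_fin.
Qed.

Lemma sum_subset_le (a : int -> R) (s t : seq int) : (forall n, 0 <= a n) ->
  uniq s -> uniq t -> {subset s <= t} -> \sum_(n <- s) a n <= \sum_(n <- t) a n.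
Proof.
move=> a0 us ut st; rewrite [leRHS](bigID (mem s))/= -[leLHS]addr0 lerD//; last first.
  exact: sumr_ge0.
rewrite -[leRHS]big_filter (perm_big [seq n <- t | n \in s])//.
apply: uniq_perm => //; first exact: filter_uniq.
move=> n; rewrite mem_filter; apply/idP/andP => [ns|[]//]; split => //; exact: st.
Qed.

Definition coefs F (n : int) : R[i] := (p^-1)%:C%C * fc F n.

Lemma bessel F s : L2 F -> (forall x, x \notin cell -> F x = 0) -> uniq s ->
  sqn (fun x => F x - trig (coefs F) s x) =
  sqn F - p^-1 * \sum_(n <- s) nsq (fc F n).
Proof.
move=> lF F0 us; rewrite pythagoras//.
rewrite (_ : \sum_(n <- s) nsq (_ - _) = 0) ?mulr0 ?addr0// big1// => n _.
by rewrite subrr nsq0.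
Qed.

Lemma sqn_trig a s : uniq s -> sqn (trig a s) = p * \sum_(n <- s) nsq (a n).
Proof.
move=> us; have := @pythagoras (fun=> 0) a s (L2_0 R) (fun _ _ => erefl) us.
have f0 n : fc (fun=> 0) n = 0.
  by rewrite /fc -[RHS](@cint0 R); congr cintegral; apply/funext => x; rewrite mul0r.
have -> : \sum_(n <- s) nsq (fc (fun=> 0) n) = 0.
  by rewrite big1// => n _; rewrite f0 nsq0.
rewrite sqn0 mulr0 subr0 add0r -(sqnN (trig a s)).
under [X in sqn X = _]eq_fun do rewrite sub0r.
by move=> ->; congr (_ * _); apply: eq_bigr => n _; rewrite f0 mulr0 subr0.
Qed.

Lemma trig_zseqB a (m n : nat) x : (n <= m)%N ->
  trig a (zseq m) x - trig a (zseq n) x = trig a (map zenum (iota n (m - n))) x.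
Proof.
move=> nm; rewrite /trig /zseq -{1}(subnKC nm) iotaD map_cat big_cat/= add0n.
by rewrite [X in X - _]addrC addrK.
Qed.

(** The partial sums are Cauchy by [sqn_trig]. Cutting their limit to the cell does not increase its
    distance to sums supported there, and its coefficients are found by continuity of the inner
    product, those of the partial sums being eventually constant. *)
Lemma riesz_fischer (c : int -> R[i]) (C : R) :
  (forall n : nat, \sum_(0 <= i < n) nsq (c (zenum i)) <= C) ->
  exists F, [/\ L2 F, forall x, x \notin cell -> F x = 0,
    forall n, fc F n = c n &
    sqn (fun x => trig (fun m => (p^-1)%:C%C * c m) (zseq n) x - F x) @[n --> \oo] --> 0].
Proof.
move=> cC; set a := fun m => (p^-1)%:C%C * c m.
pose u (n : nat) := trig a (zseq n).
have lu (n : nat) : L2 (u n) by exact: L2_trig.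
pose P (n : nat) := \sum_(0 <= i < n) nsq (c (zenum i)).
have cP : cvgn P.
  apply: nondecreasing_is_cvgn; last by exists C => _ [n _ <-]; exact: cC.
  by apply: nondecreasing_series => n _ _; exact: nsq_ge0.
have diff (m n : nat) : (n <= m)%N -> sqn (fun x => u m x - u n x) = p^-1 * (P m - P n).
  move=> nm; under eq_fun do rewrite trig_zseqB//.
  rewrite sqn_trig; last by rewrite map_inj_uniq ?iota_uniq//; exact: (can_inj zenumK).
  rewrite /P (big_cat_nat (leq0n n) nm)//= [X in _ * (X - _)]addrC addrK big_map /a.
  under eq_bigr do rewrite nsqM nsqC.
  rewrite -mulr_sumr mulrA expr2 mulrA divff ?mul1r ?gt_eqF//.
have cu e : 0 < e -> exists N, forall m n : nat, (N <= m)%N -> (N <= n)%N ->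
     sqn (fun x => u m x - u n x) <= e.
  move=> e0; have e1 : 0 < e * p / 2 by rewrite divr_gt0// mulr_gt0.
  have /cvgrPdist_le/(_ _ e1) [N _ NP] := cP.
  exists N => m n Nm Nn.
  wlog nm : m n Nm Nn / (n <= m)%N => [H|].
    case/orP: (leq_total n m) => [|mn]; first exact: H.
    by rewrite sqnBC; exact: H.
  rewrite diff// ler_pdivrMl//.
  have := NP m Nm; have := NP n Nn; rewrite /= !ler_norml => /andP[h1 h2] /andP[h3 h4].
  by move: h1 h2 h3 h4; lra.
have [G [lG Gu]] := L2_complete lu cu.
pose F x := if x \in cell then G x else 0.
have lF : L2 F.
  apply: (L2_dom _ (L2_int lG)).
    exact: cmeas_if (measurable_itv_fun _) lG.1 (cmeas_cst 0).
  by move=> x; rewrite /F; case: ifP => // _; rewrite nsq0 nsq_ge0.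
have F0 x : x \notin cell -> F x = 0 by rewrite /F => /negbTE ->.
have Fu : sqn (fun x => u n x - F x) @[n --> \oo] --> 0.
  apply: (@squeeze_cvgr _ _ _ _ (cst 0) (fun n : nat => sqn (fun x => u n x - G x))) => //.
    apply: nearW => n; rewrite sqn_ge0/=; apply: le_Rintegral => //.
    - by apply: L2_int; exact: L2B.
    - by apply: L2_int; exact: L2B.
    - move=> x _; rewrite /F; case: ifPn => // xI.
      by rewrite /u trig_out// subrr nsq0 nsq_ge0.
  exact: cvg_cst.
exists F; split => // m.
have H := inner_cvg0 _ (fun n : nat => L2B (lu n) lF) (L2_evI m) Fu.
have E : nsq (inner (fun x => u n x - F x) (evI m)) @[n --> \oo] --> nsq (c m - fc F m).
  apply: cvg_near_cst; exists (zrank m).+1 => // n /= mn.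
  rewrite innerBl//; last exact: L2_evI.
  rewrite inner_trig ?zseq_uniq// mem_zseq// inner_evI// /a.
  congr (nsq (_ - _)); rewrite mulrAC -rmorphM/= mulVf ?gt_eqF// mul1r.
  by [].
have /esym/nsq_eq0/eqP : 0 = nsq (c m - fc F m).
  by apply: (cvg_unique _ (H _) E) => //; exact: Rhausdorff.
by rewrite subr_eq0 => /eqP ->.
Qed.

Lemma fc_bnd F (n : nat) : L2 F -> (forall x, x \notin cell -> F x = 0) ->
  \sum_(0 <= i < n) nsq (fc F (zenum i)) <= p * sqn F.
Proof.
move=> lF F0; have := sqn_ge0 (fun x => F x - trig (coefs F) (zseq n) x).
by rewrite bessel ?zseq_uniq// big_zseq subr_ge0 ler_pdivrMl.
Qed.

(** The series converges to some [G] with the coefficients of [F], Bessel's inequality providing the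
    bound that Riesz-Fischer requires; totality applied to [F - G] identifies the limit. *)
Lemma fourier_series_cvg F : L2 F -> (forall x, x \notin cell -> F x = 0) ->
  sqn (fun x => F x - trig (coefs F) (zseq n) x) @[n --> \oo] --> 0.
Proof.
move=> lF F0.
have [G [lG G0 Gc Gu]] := riesz_fischer (fun k => fc_bnd k lF F0).
have L1F : L1 F := L2_L1_itv lF F0.
have L1G : L1 G := L2_L1_itv lG G0.
have FG : {ae mu, forall x, F x - G x = 0}.
  apply: fc_total; first by apply: L1D => //; exact: L1N.
    by move=> x xI; rewrite F0// G0// subrr.
  move=> n; rewrite /fc; under eq_fun do rewrite mulrBl.
  rewrite cintB; [|apply: (@L1_bnd _ _ _ 1) => //..]; rewrite ?nsq_ev//.
  - by apply/eqP; rewrite subr_eq0; apply/eqP/esym; exact: Gc.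
  - exact: cmeas_ev.
  - by move=> x; rewrite nsq_ev.
  - exact: cmeas_ev.
  - by move=> x; rewrite nsq_ev.
rewrite (_ : (fun k : nat => _) = (fun k : nat => sqn (fun x => trig (coefs F) (zseq k) x - G x)))//.
apply/funext => n; rewrite sqnBC; apply: sqn_ae.
- by apply: L2B => //; exact: L2_trig.
- by apply: L2B => //; exact: L2_trig.
- by apply: ae_imp FG => x /eqP; rewrite subr_eq0 => /eqP ->.
Qed.

Lemma parseval_cvg F : L2 F -> (forall x, x \notin cell -> F x = 0) ->
  \sum_(0 <= i < n) nsq (fc F (zenum i)) @[n --> \oo] --> p * sqn F.
Proof.
move=> lF F0.
rewrite (_ : (fun k : nat => _) = (fun k : nat => p * (sqn F - sqn (fun x => F x - trig (coefs F) (zseq k) x)))).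
  rewrite -[X in _ --> p * X]subr0; apply: cvgM; first exact: cvg_cst.
  apply: cvgB; first exact: cvg_cst.
  exact: fourier_series_cvg.
apply/funext => n; rewrite bessel ?zseq_uniq// big_zseq opprB addrC subrK.
by rewrite mulrA divff ?mul1r// gt_eqF.
Qed.

Lemma parseval F : L2 F -> (forall x, x \notin cell -> F x = 0) ->
  (\esum_(n in [set: int]) (nsq (fc F n))%:E = (p * sqn F)%:E)%E.
Proof.
move=> lF F0; apply: esum_int; first by move=> n; exact: nsq_ge0.
exact: parseval_cvg.
Qed.

(** By Bessel's identity the error decreases when the finite set of frequencies grows, so
    convergence along one enumeration gives convergence along the net of all finite sets. *)
Lemma fourier_series_uncond F : L2 F -> (forall x, x \notin cell -> F x = 0) ->
  sqn (fun x => F x - trig (coefs F) (N : {fset int}) x) @[N --> totally] --> 0.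
Proof.
move=> lF F0; have tF : ProperFilter (@totally int) := totally_filter.
apply/cvgrPdist_le => e e0.
have /cvgrPdist_le/(_ _ e0)[n _ /(_ n (leqnn _))] := fourier_series_cvg lF F0.
rewrite /= sub0r normrN ger0_norm ?sqn_ge0// => ne.
exists [fset x in zseq n]%fset => // N /= /fsubsetP sN.
rewrite sub0r normrN ger0_norm ?sqn_ge0//; apply: le_trans ne.
rewrite !bessel ?zseq_uniq//; last exact: fset_uniq.
rewrite lerD2l lerN2 ler_wpM2l ?invr_ge0 ?(ltW p0)//.
apply: sum_subset_le.
- by move=> m; exact: nsq_ge0.
- exact: zseq_uniq.
- exact: fset_uniq.
by move=> m mn; apply: sN; rewrite inE.
Qed.

End FourierSeries.

(** * The Fourier transform on L^2 *)

Section FourierTransform.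
Variable R : realType.
Local Notation mu := (@lebesgue_measure R).
Implicit Types (u v f g : R -> R[i]) (x xi : R).

Lemma L1_expi u (a : R -> R) : L1 u -> measurable_fun [set: R] a ->
  L1 (fun t => u t * expi (a t)).
Proof.
move=> lu ma; apply: (@L1_bnd _ _ _ 1 lu); first exact: cmeas_expi.
by move=> t; rewrite nsq_expi.
Qed.

Lemma L2_expi u (a : R -> R) : L2 u -> measurable_fun [set: R] a ->
  L2 (fun t => u t * expi (a t)).
Proof.
move=> lu ma; apply: (@L2_bnd _ _ _ 1 lu); first exact: cmeas_expi.
by move=> t; rewrite nsq_expi.
Qed.

Lemma measurable_Nmulr xi : measurable_fun [set: R] (fun t : R => - (t * xi)).
Proof. by apply: measurable_funN; exact: measurable_funM. Qed.

Lemma L1_kernel u xi : L1 u -> L1 (fun t => u t * expi (- (t * xi))).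
Proof. by move=> lu; apply: L1_expi => //; exact: measurable_Nmulr. Qed.

Lemma fourierL1B u v : L1 u -> L1 v ->
  fourierL1 (fun t => u t - v t) = (fun xi => fourierL1 u xi - fourierL1 v xi).
Proof.
move=> lu lv; apply/funext => xi; rewrite /fourierL1 -mulrBr -cintB; [|exact: L1_kernel..].
by congr (_ * cintegral _); apply/funext => t; rewrite mulrBl.
Qed.

Lemma fourierL1D u v : L1 u -> L1 v ->
  fourierL1 (fun t => u t + v t) = (fun xi => fourierL1 u xi + fourierL1 v xi).
Proof.
move=> lu lv; apply/funext => xi; rewrite /fourierL1 -mulrDr -cintD; [|exact: L1_kernel..].
by congr (_ * cintegral _); apply/funext => t; rewrite mulrDl.
Qed.

Lemma fourierL1Z c u : L1 u ->
  fourierL1 (fun t => c * u t) = (fun xi => c * fourierL1 u xi).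
Proof.
move=> lu; apply/funext => xi; rewrite /fourierL1 mulrCA -(cintZ c (L1_kernel xi lu)).
by congr (_ * cintegral _); apply/funext => t; rewrite mulrA.
Qed.

Lemma continuous_Rintegral_param (F : R -> R -> R) (b : R -> R) :
  (forall xi, measurable_fun [set: R] (F xi)) -> mu.-integrable setT (EFin \o b) ->
  (forall xi t, `|F xi t| <= b t) -> (forall t, continuous (F ^~ t)) ->
  continuous (fun xi => \int[mu]_t F xi t).
Proof.
move=> mF ib Fb cF a.
have := @continuity_under_integral _ _ _ mu F setT measurableT (a - 1) (a + 1).
have iF xi : mu.-integrable setT (EFin \o F xi).
  apply: (le_integrable _ _ _ ib) => //.
    by apply/measurable_EFinP; exact: (mF xi).
  by move=> t _ /=; rewrite lee_fin (le_trans (Fb _ _))// ler_norm.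
move=> /(_ (fun xi _ => iF xi)) H; apply: (H _ b ib _ a).
- by apply: nearW => t _ xi _; exact: cF.
- by move=> xi _; apply: nearW => t _; exact: Fb.
- by rewrite inE /= in_itv /=; apply/andP; split; lra.
Qed.

(** The transform is continuous in [xi], its integrand being dominated independently of [xi];
    continuity gives measurability. *)
Lemma cmeas_fourierL1 u : L1 u -> cmeas (fourierL1 u).
Proof.
move=> lu; apply: cmeasM; first exact: cmeas_cst.
have [mr mi] := L1_cmeas lu; have [ir ii] := lu.
pose b x := `|Re (u x)| + `|Im (u x)|.
have ib : mu.-integrable setT (EFin \o b).
  by apply: integrableDR; exact: integrable_normR.
have mk xi : cmeas (fun t => u t * expi (- (t * xi))) by apply: L1_cmeas; exact: L1_kernel.
have cc t : continuous (fun xi : R => cos (- (t * xi))).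
  move=> xi; apply: (continuous_comp (f := fun xi => - (t * xi)) (g := cos)).
    by apply: cvgN; apply: cvgM; [exact: cvg_cst|exact: cvg_id].
  exact: continuous_cos.
have cs t : continuous (fun xi : R => sin (- (t * xi))).
  move=> xi; apply: (continuous_comp (f := fun xi => - (t * xi)) (g := sin)).
    by apply: cvgN; apply: cvgM; [exact: cvg_cst|exact: cvg_id].
  exact: continuous_sin.
have c1 a : `|cos a| <= 1 :> R by rewrite ler_norml cos_geN1 cos_le1.
have s1 a : `|sin a| <= 1 :> R by rewrite ler_norml sin_geN1 sin_le1.
split; apply: continuous_measurable_fun.
- rewrite (_ : (fun x => _) = (fun xi => \int[mu]_t Re (u t * expi (- (t * xi)))))//.
  apply: (@continuous_Rintegral_param _ b) => //.
  + by move=> xi; case: (mk xi).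
  + move=> xi t; rewrite cReM; apply: le_trans (ler_normB _ _) _.
    by rewrite !normrM /b lerD// ler_piMr//=.
  + move=> t xi; under eq_fun do rewrite cReM.
    by apply: cvgB; apply: cvgM; try exact: cvg_cst; [exact: cc|exact: cs].
- rewrite (_ : (fun x => _) = (fun xi => \int[mu]_t Im (u t * expi (- (t * xi)))))//.
  apply: (@continuous_Rintegral_param _ b) => //.
  + by move=> xi; case: (mk xi).
  + move=> xi t; rewrite cImM; apply: le_trans (ler_normD _ _) _.
    by rewrite !normrM /b lerD// ler_piMr//=.
  + move=> t xi; under eq_fun do rewrite cImM.
    by apply: cvgD; apply: cvgM; try exact: cvg_cst; [exact: cs|exact: cc].
Qed.

(** The intervals [[n w, (n + 1) w[] tile the line, and each is shifted back onto [[0, w[]. *)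
Lemma ge0_integral_tile (w : R) (f : R -> \bar R) : 0 < w ->
  measurable_fun [set: R] f -> (forall x, 0 <= f x)%E ->
  (\int[mu]_x f x =
   \int[mu]_(x in `[0%R, w[) \sum_(0 <= i <oo) f ((x : R) + (zenum i)%:~R * w)%R)%E.
Proof.
move=> w0 mf f0.
pose J i := `[(zenum i)%:~R * w, (zenum i)%:~R * w + w[%classic : set R.
have mJ i : measurable (J i) by exact: measurable_itv.
have JP i x : J i x = ((zenum i)%:~R <= x / w < (zenum i + 1)%:~R) :> Prop.
  rewrite /J /= in_itv/= intrD -[X in _ < _ + X]mul1r -mulrDl.
  by rewrite ler_pdivlMr// ltr_pdivrMr.
have JT : \bigcup_i J i = [set: R].
  apply/seteqP; split => // x _.
  exists (zrank (Num.floor (x / w))); first by [].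
  by rewrite JP zrankK; exact: floor_itv.
have tJ : trivIset setT J.
  apply/trivIsetP => i j _ _ ij; apply/seteqP; split => // x [].
  rewrite !JP => /andP[i1 i2] /andP[j1 j2]; move/eqP: ij; apply.
  apply: (can_inj zenumK); apply/eqP; rewrite eq_le -!ltzD1 -!(ltr_int R).
  by rewrite (le_lt_trans i1 j2) (le_lt_trans j1 i2).
rewrite -{1}JT ge0_integral_bigcup//; last by rewrite JT.
rewrite integral_nneseries//; last first.
  move=> i; apply: measurable_funTS.
  exact: (measurableT_comp mf (measurable_shift _)).
apply: eq_eseriesr => i _.
rewrite integral_mkcond -(@ge0_integral_shift _ ((zenum i)%:~R * w)).
- rewrite [RHS]integral_mkcond; apply: eq_integral => x _.
  rewrite /patch !mem_setE !in_itv/=.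
  by rewrite lerDr addrC ltrD2l.
- by apply/(measurable_restrictT _ _).1 => //; exact: measurable_funTS.
- by move=> x; rewrite /patch; case: ifP.
Qed.

(** * Plancherel's identity *)

Lemma nsq_fourier_const : nsq ((Num.sqrt (2 * pi))^-1)%:C%C = (2 * pi)^-1 :> R.
Proof. by rewrite nsqC exprVn sqr_sqrtr// mulr_ge0// pi_ge0. Qed.

Lemma plancherel_cell (p : R) u : 0 < p -> L2 u ->
  (forall x, x \notin `[- (p / 2), p / 2[ -> u x = 0) ->
  L2 (fourierL1 u) /\ sqn (fourierL1 u) = sqn u.
Proof.
move=> p0 lu u0.
pose w := 2 * pi / p.
have wp : w * p = 2 * pi by rewrite /w mulfVK// gt_eqF.
have pi0 : 0 < 2 * pi :> R by rewrite mulr_gt0// pi_gt0.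
have w0 : 0 < w by rewrite /w divr_gt0.
have l1u : L1 u := L2_L1_itv lu u0.
pose F xi x := u x * expi (- (x * xi)).
have lF xi : L2 (F xi) by apply: L2_expi => //; exact: measurable_Nmulr.
have F0 xi x : x \notin `[- (p / 2), p / 2[ -> F xi x = 0.
  by move=> /u0; rewrite /F => ->; rewrite mul0r.
have sF xi : sqn (F xi) = sqn u.
  by apply: eq_Rintegral => x _; rewrite /F nsqM nsq_expi mulr1.
have fcF xi n : nsq (fc w (F xi) n) = 2 * pi * nsq (fourierL1 u (xi + n%:~R * w)).
  rewrite /fourierL1 nsqM nsq_fourier_const mulrA divff ?gt_eqF// mul1r.
  congr (nsq (cintegral _)); apply/funext => x; rewrite /F /ev -mulrA -expiD.
  by congr (_ * expi _); rewrite mulrNz; ring.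
(* Parseval at fixed [xi]: the periodization of the squared modulus of the transform is constant in
   [xi]. *)
have S xi : (\sum_(0 <= i <oo) (nsq (fourierL1 u (xi + (zenum i)%:~R * w)))%:E =
    (w^-1 * sqn u)%:E)%E.
  apply: cvg_lim => //; under eq_fun do rewrite sumEFin.
  apply: cvg_EFin_seq.
  rewrite (_ : (fun n => _) = (fun n =>
      (2 * pi)^-1 * \sum_(0 <= i < n) nsq (fc w (F xi) (zenum i)))); last first.
    apply/funext => n; rewrite mulr_sumr; apply: eq_bigr => i _.
    by rewrite fcF mulKf ?gt_eqF.
  rewrite (_ : w^-1 * sqn u = (2 * pi)^-1 * (p * sqn (F xi))); last first.
    by rewrite sF -wp mulrA; congr (_ * _); field; rewrite !gt_eqF.
  apply: cvgM; first exact: cvg_cst.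
  exact: (parseval_cvg p0 wp (lF xi) (F0 xi)).
have mf : cmeas (fourierL1 u) by exact: cmeas_fourierL1.
have I : (\int[mu]_x (nsq (fourierL1 u x))%:E = (sqn u)%:E)%E.
  rewrite (@ge0_integral_tile w)//; last 2 first.
  - by apply/measurable_EFinP; exact: measurable_nsq.
  - by move=> x; rewrite lee_fin nsq_ge0.
  under eq_integral do rewrite S.
  rewrite integral_cst//= lebesgue_measure_itv/= lte_fin w0 sube0 -EFinM.
  by rewrite mulrAC mulVf ?gt_eqF// mul1r.
have lf : L2 (fourierL1 u) by split=> //; rewrite I ltry.
by split => //; apply: EFin_inj; rewrite -sqnE.
Qed.

(** The bounds are written as the cell of period [2 n], the form that [plancherel_cell] expects. *)
Definition trunc (n : nat) u x : R[i] :=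
  if x \in `[- ((2 * n%:R) / 2), (2 * n%:R) / 2[ then u x else 0.

Lemma truncE n u x : trunc n u x = if - n%:R <= x < n%:R then u x else 0.
Proof. by rewrite /trunc in_itv/= mulrAC divff// mul1r. Qed.

Lemma cmeas_trunc n u : cmeas u -> cmeas (trunc n u).
Proof. by move=> mu_; apply: cmeas_if (measurable_itv_fun _) mu_ (cmeas_cst 0). Qed.

Lemma L2_trunc n u : L2 u -> L2 (trunc n u).
Proof.
move=> lu; apply: (L2_dom (cmeas_trunc n lu.1) (L2_int lu)) => x.
by rewrite /trunc; case: ifP => // _; rewrite nsq0 nsq_ge0.
Qed.

Lemma L1_trunc n u : L2 u -> L1 (trunc n u).
Proof.
move=> lu.
apply: (@L2_L1_itv _ (- (2 * n%:R / 2)) (2 * n%:R / 2) _ (L2_trunc n lu)) => x xI.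
by rewrite /trunc (negbTE xI).
Qed.

Lemma trunc_eventually u x : \forall n \near \oo, trunc n u x = u x.
Proof.
near=> n; rewrite truncE ifT//.
have : `|x| < n%:R by near: n; exact: nbhs_infty_gtr.
by rewrite ltr_norml => /andP[h1 h2]; rewrite h2 ltW.
Unshelve. all: by end_near. Qed.

Lemma sqn_trunc_cvg u : L2 u -> sqn (trunc n u) @[n --> \oo] --> sqn u.
Proof.
move=> lu; apply: (@Rintegral_dct _ (fun n x => nsq (trunc n u x)) _ (fun x => nsq (u x))).
- by move=> n; apply: measurable_nsq; exact: cmeas_trunc lu.1.
- move=> x; apply: cvg_near_cst; have := trunc_eventually u x.
  by apply: filterS => n ->.
- exact: L2_int.
- move=> n x; rewrite ger0_norm ?nsq_ge0// /trunc.
  by case: ifP => // _; rewrite nsq0 nsq_ge0.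
Qed.

Lemma sqn_trunc n u : L2 u -> sqn (fun x => u x - trunc n u x) = sqn u - sqn (trunc n u).
Proof.
move=> lu; rewrite /sqn -RintegralB//; [|exact: L2_int..|]; last first.
  by apply: L2_int; exact: L2_trunc.
by apply: eq_Rintegral => x _; rewrite /trunc; case: ifP; rewrite ?subrr ?subr0 ?nsq0 ?subr0.
Qed.

Lemma sqn_trunc_cvg0 u : L2 u -> sqn (fun x => u x - trunc n u x) @[n --> \oo] --> 0.
Proof.
move=> lu.
have H : sqn u - sqn (trunc n u) @[n --> \oo] --> sqn u - sqn u.
  by apply: cvgB; [exact: cvg_cst|exact: sqn_trunc_cvg].
by under eq_fun do rewrite sqn_trunc//; rewrite subrr in H; exact: H.
Qed.

Lemma sqn_trunc_cvg0C u : L2 u -> sqn (fun x => trunc n u x - u x) @[n --> \oo] --> 0.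
Proof. by move=> lu; under eq_fun do rewrite sqnBC; exact: sqn_trunc_cvg0. Qed.

Lemma fourierL1_trunc_cvg u xi : L1 u -> L2 u ->
  (Re (fourierL1 (trunc n u) xi) @[n --> \oo] --> Re (fourierL1 u xi)) /\
  (Im (fourierL1 (trunc n u) xi) @[n --> \oo] --> Im (fourierL1 u xi)).
Proof.
move=> l1u lu; have [ir ii] := L1_kernel xi l1u.
have [H1 H2] : (Re (cintegral (fun t => trunc n u t * expi (- (t * xi)))) @[n --> \oo] -->
    Re (cintegral (fun t => u t * expi (- (t * xi))))) /\
   (Im (cintegral (fun t => trunc n u t * expi (- (t * xi)))) @[n --> \oo] -->
    Im (cintegral (fun t => u t * expi (- (t * xi))))).
  pose b t := `|Re (u t * expi (- (t * xi)))| + `|Im (u t * expi (- (t * xi)))|.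
  apply: (@cint_dct _ _ _ b).
  - by move=> n; apply: L1_cmeas; apply: L1_kernel; exact: L1_trunc.
  - move=> t; apply: cvg_near_cst; have := trunc_eventually u t.
    by apply: filterS => n ->.
  - move=> t; apply: cvg_near_cst; have := trunc_eventually u t.
    by apply: filterS => n ->.
  - by apply: integrableDR; exact: integrable_normR.
  - by move=> n t; rewrite /trunc /b; case: ifP => _; rewrite ?mul0r ?normr0 ?lerDl ?addr_ge0.
  - by move=> n t; rewrite /trunc /b; case: ifP => _; rewrite ?mul0r ?normr0 ?lerDr ?addr_ge0.
rewrite /fourierL1; split.
  rewrite cReM; under eq_fun do rewrite cReM.
  by apply: cvgB; apply: cvgM => //; exact: cvg_cst.
rewrite cImM; under eq_fun do rewrite cImM.
by apply: cvgD; apply: cvgM => //; exact: cvg_cst.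
Qed.

Lemma plancherel_trunc n u : L2 u ->
  L2 (fourierL1 (trunc n u)) /\ sqn (fourierL1 (trunc n u)) = sqn (trunc n u).
Proof.
case: n => [|n] lu; last first.
  apply: (@plancherel_cell (2 * n.+1%:R)) => //; first exact: L2_trunc.
  by move=> x xI; rewrite /trunc (negbTE xI).
(* For [n = 0] the period would be 0; the truncation vanishes identically, so the cell of period 1
   is used instead. *)
apply: (@plancherel_cell 1) => //; first exact: L2_trunc.
move=> x _; rewrite truncE oppr0; case: ifPn => // /andP[x0 x1].
by have := le_lt_trans x0 x1; rewrite ltxx.
Qed.

(** At this stage the transforms of the truncations are known to converge only pointwise, so Fatou's
    lemma gives an inequality. *)
Lemma fourierL1_le v : L1 v -> L2 v -> L2 (fourierL1 v) /\ sqn (fourierL1 v) <= sqn v.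
Proof.
move=> l1v lv.
apply: (@fatou_sqn _ (fun n => fourierL1 (trunc n v))).
- by move=> n; case: (plancherel_trunc n lv).
- exact: cmeas_fourierL1.
- apply: nearW => xi; apply: nsq_cvg.
    by have [] := fourierL1_trunc_cvg xi l1v lv.
  by have [] := fourierL1_trunc_cvg xi l1v lv.
- move=> n; have [_ ->] := plancherel_trunc n lv.
  by rewrite -subr_ge0 -sqn_trunc// sqn_ge0.
Qed.

(** The inequality above, applied to [trunc n u - u], makes the transforms of the truncations
    converge in norm; the isometry known for truncations then passes to the limit. *)
Lemma plancherel u : L1 u -> L2 u -> L2 (fourierL1 u) /\ sqn (fourierL1 u) = sqn u.
Proof.
move=> l1u lu; have [lf _] := fourierL1_le l1u lu; split => //.
have lt n := L1_trunc n lu.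
have H : sqn (fun xi => fourierL1 (trunc n u) xi - fourierL1 u xi) @[n --> \oo] --> 0.
  apply: (@squeeze_cvgr _ _ _ _ (cst 0) (fun n => sqn (fun x => trunc n u x - u x))).
  - apply: nearW => n; rewrite sqn_ge0/= -fourierL1B//.
    apply: (fourierL1_le _ _).2; first by apply: L1D => //; exact: L1N.
    by apply: L2B => //; exact: L2_trunc.
  - exact: cvg_cst.
  - exact: sqn_trunc_cvg0C.
have lft n : L2 (fourierL1 (trunc n u)) by case: (plancherel_trunc n lu).
have H1 := sqn_cvg _ lft lf H.
have H2 : sqn (fourierL1 (trunc n u)) @[n --> \oo] --> sqn u.
  rewrite (_ : (fun n => _) = (fun n => sqn (trunc n u))); first exact: sqn_trunc_cvg.
  by apply/funext => n; have [_ ->] := plancherel_trunc n lu.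
by apply: (cvg_unique _ (H1 _) H2) => //; exact: Rhausdorff.
Qed.

(** * Fubini and the multiplication formula *)

Lemma Rintegral_Fubini (r : R * R -> R) :
  (mu \x mu)%E.-integrable setT (EFin \o r) ->
  (forall x, mu.-integrable setT (EFin \o (fun y => r (x, y)))) ->
  (forall y, mu.-integrable setT (EFin \o (fun x => r (x, y)))) ->
  \int[mu]_x \int[mu]_y r (x, y) = \int[mu]_y \int[mu]_x r (x, y).
Proof.
move=> ir i1 i2; rewrite /Rintegral; congr fine.
transitivity (\int[mu]_x \int[mu]_y (r (x, y))%:E)%E.
  apply: eq_integral => x _; rewrite fineK//.
  exact: (integrable_fin_num measurableT (i1 x)).
rewrite (Fubini ir); apply: eq_integral => y _; rewrite fineK//.
exact: (integrable_fin_num measurableT (i2 y)).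
Qed.

Lemma Rintegral_norm_prod (A B : R -> R) : mu.-integrable setT (EFin \o A) ->
  mu.-integrable setT (EFin \o B) ->
  (mu \x mu)%E.-integrable setT (EFin \o (fun z : R * R => A z.1 * B z.2)).
Proof.
move=> iA iB.
have mA := measurable_int _ iA; have mB := measurable_int _ iB.
apply/integrable12ltyP.
  apply/measurable_EFinP; apply: measurable_funM.
    by apply: (measurableT_comp _ measurable_fst); exact/measurable_EFinP.
  by apply: (measurableT_comp _ measurable_snd); exact/measurable_EFinP.
have [_ fA] := integrableP _ _ _ iA; have [_ fB] := integrableP _ _ _ iB.
have nA x : (0 <= `|(EFin \o A) x|)%E by [].
rewrite [X in (X < _)%E](_ : _ =
    (\int[mu]_x (`|(EFin \o A) x| * \int[mu]_y `|(EFin \o B) y|))%E); last first.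
  apply: eq_integral => x _.
  rewrite -ge0_integralZl//; last by apply: measurableT_comp.
  by apply: eq_integral => y _ /=; rewrite normrM EFinM.
rewrite ge0_integralZr//; last 2 first.
- by apply: measurableT_comp.
- exact: integral_ge0.
by rewrite lte_mul_pinfty// ?integral_ge0// ge0_fin_numE// integral_ge0.
Qed.

Lemma cint_Fubini (K : R * R -> R[i]) (A B : R -> R) :
  measurable_fun [set: R * R] (fun z => Re (K z)) ->
  measurable_fun [set: R * R] (fun z => Im (K z)) ->
  mu.-integrable setT (EFin \o A) -> mu.-integrable setT (EFin \o B) ->
  (forall z, `|Re (K z)| <= A z.1 * B z.2) ->
  (forall z, `|Im (K z)| <= A z.1 * B z.2) ->
  (forall x, L1 (fun y => K (x, y))) -> (forall y, L1 (fun x => K (x, y))) ->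
  cintegral (fun x => cintegral (fun y => K (x, y))) =
  cintegral (fun y => cintegral (fun x => K (x, y))).
Proof.
move=> mr mi iA iB bR bI l1 l2.
have iAB := Rintegral_norm_prod iA iB.
have iR : (mu \x mu)%E.-integrable setT (EFin \o (fun z => Re (K z))).
  apply: (le_integrable _ _ _ iAB) => //; first exact/measurable_EFinP.
  by move=> z _ /=; rewrite lee_fin (le_trans (bR z)) ?ler_norm.
have iI : (mu \x mu)%E.-integrable setT (EFin \o (fun z => Im (K z))).
  apply: (le_integrable _ _ _ iAB) => //; first exact/measurable_EFinP.
  by move=> z _ /=; rewrite lee_fin (le_trans (bI z)) ?ler_norm.
apply: complexP.
  exact: (Rintegral_Fubini iR (fun x => (l1 x).1) (fun y => (l2 y).1)).
exact: (Rintegral_Fubini iI (fun x => (l1 x).2) (fun y => (l2 y).2)).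
Qed.

(** Fubini's theorem and the symmetry of the kernel. This identity is what makes the inversion below
    possible. *)
Lemma fourierL1_mul v k : L1 v -> L1 k ->
  cintegral (fun xi => fourierL1 v xi * k xi) =
  cintegral (fun t => v t * fourierL1 k t).
Proof.
move=> lv lk; set c : R[i] := ((Num.sqrt (2 * pi))^-1)%:C%C.
pose K (z : R * R) := (c * v z.1) * k z.2 * expi (- (z.1 * z.2)).
have lcv : L1 (fun t => c * v t) by exact: L1Z.
have E1 xi : fourierL1 v xi * k xi = cintegral (fun t => K (t, xi)).
  rewrite /fourierL1 -/c mulrAC -cintZ; last exact: L1_kernel.
  by congr cintegral; apply/funext => t; rewrite /K /=; ring.
have E2 t : v t * fourierL1 k t = cintegral (fun xi => K (t, xi)).
  rewrite /fourierL1 -/c mulrA -cintZ; last exact: L1_kernel.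
  congr cintegral; apply/funext => xi; rewrite /K /= (mulrC xi t); ring.
under eq_fun do rewrite E1; under [in RHS]eq_fun do rewrite E2.
have [cr ci] := L1_cmeas lcv; have [kr ki] := L1_cmeas lk.
pose A t := `|Re (c * v t)| + `|Im (c * v t)|.
pose B x := 2 * (`|Re (k x)| + `|Im (k x)|).
have iA : mu.-integrable setT (EFin \o A).
  by case: lcv => *; apply: integrableDR; exact: integrable_normR.
have iB : mu.-integrable setT (EFin \o B).
  by case: lk => *; apply: integrableZR; apply: integrableDR; exact: integrable_normR.
have m1 : measurable_fun [set: R * R] (fun z : R * R => - (z.1 * z.2)).
  by apply: measurable_funN; apply: measurable_funM.
have mc : measurable_fun [set: R * R] (fun z : R * R => cos (- (z.1 * z.2))).
  exact: (measurableT_comp (continuous_measurable_fun (@continuous_cos R))).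
have ms : measurable_fun [set: R * R] (fun z : R * R => sin (- (z.1 * z.2))).
  exact: (measurableT_comp (continuous_measurable_fun (@continuous_sin R))).
have mcr : measurable_fun [set: R * R] (fun z : R * R => Re (c * v z.1)).
  exact: (measurableT_comp cr measurable_fst).
have mci : measurable_fun [set: R * R] (fun z : R * R => Im (c * v z.1)).
  exact: (measurableT_comp ci measurable_fst).
have mkr : measurable_fun [set: R * R] (fun z : R * R => Re (k z.2)).
  exact: (measurableT_comp kr measurable_snd).
have mki : measurable_fun [set: R * R] (fun z : R * R => Im (k z.2)).
  exact: (measurableT_comp ki measurable_snd).
have c1 a : `|cos a| <= 1 :> R by rewrite ler_norml cos_geN1 cos_le1.
have s1 a : `|sin a| <= 1 :> R by rewrite ler_norml sin_geN1 sin_le1.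
have bnd (a b a' b' x y : R) : `|x| <= 1 -> `|y| <= 1 ->
    `|(a * a' - b * b') * x| + `|(a * b' + b * a') * y| <=
    (`|a| + `|b|) * (2 * (`|a'| + `|b'|)).
  move=> x1 y1; rewrite !normrM.
  have h1 : `|a * a' - b * b'| * `|x| <= `|a| * `|a'| + `|b| * `|b'|.
    apply: (@le_trans _ _ (`|a * a' - b * b'| * 1)); first exact: ler_wpM2l.
    by rewrite mulr1 -!normrM; exact: ler_normB.
  have h2 : `|a * b' + b * a'| * `|y| <= `|a| * `|b'| + `|b| * `|a'|.
    apply: (@le_trans _ _ (`|a * b' + b * a'| * 1)); first exact: ler_wpM2l.
    by rewrite mulr1 -!normrM; exact: ler_normD.
  apply: (le_trans (lerD h1 h2)).
  have : 0 <= (`|a| + `|b|) * (`|a'| + `|b'|) by rewrite mulr_ge0// addr_ge0.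
  lra.
apply/esym; apply: (@cint_Fubini K A B) => //.
- under eq_fun do rewrite /K cReM [Re (_ * k _)]cReM [Im (_ * k _)]cImM.
  apply: measurable_funB; apply: measurable_funM; [|exact: mc| |exact: ms].
    by apply: measurable_funB; exact: measurable_funM.
  by apply: measurable_funD; exact: measurable_funM.
- under eq_fun do rewrite /K cImM [Re (_ * k _)]cReM [Im (_ * k _)]cImM.
  apply: measurable_funD; apply: measurable_funM; [|exact: ms| |exact: mc].
    by apply: measurable_funB; exact: measurable_funM.
  by apply: measurable_funD; exact: measurable_funM.
- move=> [x y]; rewrite /K cReM [Re (_ * k _)]cReM [Im (_ * k _)]cImM.
  by apply: le_trans (ler_normB _ _) _; apply: bnd; [exact: c1|exact: s1].
- move=> [x y]; rewrite /K cImM [Re (_ * k _)]cReM [Im (_ * k _)]cImM.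
  by apply: le_trans (ler_normD _ _) _; apply: bnd; [exact: s1|exact: c1].
- move=> x; apply: (@L1_expi (fun y => c * v x * k y) (fun y => - (x * y))).
    exact: L1Z.
  by apply: measurable_funN; exact: measurable_funM.
- move=> y; apply: (@L1_expi (fun x => c * v x * k y) (fun x => - (x * y))).
    by under eq_fun do rewrite mulrC; exact: L1Z.
  by apply: measurable_funN; exact: measurable_funM.
Qed.

(** * The graph of the Fourier transform on L^2 *)

Lemma isfP f g : is_fourier f g <-> [/\ L2 f, L2 g & exists u : nat -> R -> R[i],
  [/\ forall n, L1 (u n) /\ L2 (u n),
      sqn (fun x => u n x - f x) @[n --> \oo] --> 0 &
      sqn (fun x => fourierL1 (u n) x - g x) @[n --> \oo] --> 0]].
Proof.
split=> -[].
  move=> /cLfun2P lf /cLfun2P lg [u [lu uf ug]]; split => //; exists u.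
  have lu' n : L1 (u n) /\ L2 (u n) by case: (lu n) => /cLfun1P ? /cLfun2P.
  split => //.
  - by apply/(L2norm_cvg0 _ (fun n => L2B (lu' n).2 lf)).1.
  - apply/(L2norm_cvg0 _ (fun n => L2B (plancherel (lu' n).1 (lu' n).2).1 lg)).1.
    exact: ug.
move=> lf lg [u [lu uf ug]]; split; [exact/cLfun2P|exact/cLfun2P|exists u].
split.
- by move=> n; split; [apply/cLfun1P; case: (lu n)|apply/cLfun2P; case: (lu n)].
- exact/(L2norm_cvg0 _ (fun n => L2B (lu n).2 lf)).2.
- exact/(L2norm_cvg0 _ (fun n => L2B (plancherel (lu n).1 (lu n).2).1 lg)).2.
Qed.

Lemma isf_L2l f g : is_fourier f g -> L2 f. Proof. by move=> /isfP[]. Qed.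
Lemma isf_L2r f g : is_fourier f g -> L2 g. Proof. by move=> /isfP[]. Qed.

(** The inverse transform is the conjugate of the transform of the conjugate. By the multiplication
    formula the inner product of the transform of [trunc n f] with [g] is [sqn (trunc n f)];
    expanding the square, the error of the truncated transform is exactly
    [sqn f - sqn (trunc n f)]. *)
Lemma fourier_inverse g (a b : R) : L2 g ->
  (forall x, x \notin `[a, b[ -> g x = 0) -> exists f, is_fourier f g.
Proof.
move=> lg g0; pose k x := conjc (g x).
have lk : L2 k by exact: L2J.
have l1k : L1 k by apply: L1J; exact: L2_L1_itv lg g0.
have [lfk sfk] := plancherel l1k lk.
pose f x := conjc (fourierL1 k x).
have lf : L2 f by exact: L2J.
have sf : sqn f = sqn g.
  have -> : sqn f = sqn (fourierL1 k) by apply: eq_Rintegral => x _; rewrite nsqJ.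
  by rewrite sfk; apply: eq_Rintegral => x _; rewrite nsqJ.
exists f; apply/isfP; split => //; exists (fun n => trunc n f); split.
- by move=> n; split; [exact: L1_trunc|exact: L2_trunc].
- exact: sqn_trunc_cvg0C.
- have E n : sqn (fun x => fourierL1 (trunc n f) x - g x) = sqn f - sqn (trunc n f).
    have [lt st] := plancherel_trunc n lf.
    rewrite sqnB// st.
    have -> : inner (fourierL1 (trunc n f)) g = (sqn (trunc n f))%:C%C.
      rewrite /inner (fourierL1_mul (L1_trunc n lf) l1k) -inner_self /inner.
      congr cintegral; apply/funext => x; rewrite /trunc; case: ifP => _.
        by rewrite {3}/f conjcK.
      by rewrite !mul0r.
    by rewrite -sf cReC; ring.
  under eq_fun do rewrite E -sqn_trunc//.
  exact: sqn_trunc_cvg0.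
Qed.

Lemma isf_isom f g : is_fourier f g -> sqn f = sqn g.
Proof.
move=> /isfP[lf lg [u [lu uf ug]]].
have H1 := sqn_cvg _ (fun n => (lu n).2) lf uf.
have H2 := sqn_cvg _ (fun n => (plancherel (lu n).1 (lu n).2).1) lg ug.
have E : (fun n => sqn (fourierL1 (u n))) = (fun n => sqn (u n)).
  by apply/funext => n; case: (plancherel (lu n).1 (lu n).2).
have H3 : sqn (u n) @[n --> \oo] --> sqn g by rewrite -E; exact: H2.
by apply: (cvg_unique _ (H1 _) H3) => //; exact: Rhausdorff.
Qed.

Lemma sqn_lin_cvg0 (v v' : nat -> R -> R[i]) c f f' :
  (forall n, L2 (v n)) -> (forall n, L2 (v' n)) -> L2 f -> L2 f' ->
  sqn (fun x => v n x - f x) @[n --> \oo] --> 0 ->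
  sqn (fun x => v' n x - f' x) @[n --> \oo] --> 0 ->
  sqn (fun x => (c * v n x + v' n x) - (c * f x + f' x)) @[n --> \oo] --> 0.
Proof.
move=> lv lv' lf lf' h h'.
apply: (@squeeze_cvgr _ _ _ _ (cst 0) (fun n => 2 * (nsq c * sqn (fun x => v n x - f x)) +
   2 * sqn (fun x => v' n x - f' x))).
- apply: nearW => n; rewrite sqn_ge0/= -sqnZ; last exact: L2B.
  apply: le_trans (sqnD_le (L2Z _ (L2B (lv n) lf)) (L2B (lv' n) lf')).
  rewrite le_eqVlt; apply/orP; left; apply/eqP; congr sqn.
  by apply/funext => x; ring.
- exact: cvg_cst.
- rewrite [X in _ --> X](_ : _ = 2 * (nsq c * 0) + 2 * 0); last by rewrite !mulr0 addr0.
  apply: cvgD; apply: cvgM => //; try exact: cvg_cst.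
  by apply: cvgM => //; exact: cvg_cst.
Qed.

Lemma isf_lin c f g f' g' : is_fourier f g -> is_fourier f' g' ->
  is_fourier (fun x => c * f x + f' x) (fun x => c * g x + g' x).
Proof.
move=> /isfP[lf lg [u [lu uf ug]]] /isfP[lf' lg' [u' [lu' uf' ug']]].
apply/isfP; split.
- by apply: L2D => //; exact: L2Z.
- by apply: L2D => //; exact: L2Z.
exists (fun n x => c * u n x + u' n x); split.
- move=> n; have [a b] := lu n; have [a' b'] := lu' n.
  by split; [apply: L1D => //; exact: L1Z|apply: L2D => //; exact: L2Z].
- by apply: sqn_lin_cvg0 => // n; [case: (lu n)|case: (lu' n)].
- have E n : fourierL1 (fun x => c * u n x + u' n x) =
      (fun xi => c * fourierL1 (u n) xi + fourierL1 (u' n) xi).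
    have [a b] := lu n; have [a' b'] := lu' n.
    by rewrite fourierL1D ?fourierL1Z//; exact: L1Z.
  under eq_fun do rewrite E.
  apply: sqn_lin_cvg0 => // n.
    exact: (plancherel (lu n).1 (lu n).2).1.
  exact: (plancherel (lu' n).1 (lu' n).2).1.
Qed.

Lemma isf0 : is_fourier (fun=> 0) (fun=> 0 : R[i]).
Proof.
apply/isfP; split; [exact: L2_0|exact: L2_0|exists (fun n x => 0)].
have E : fourierL1 (fun=> 0) = (fun=> 0) :> (R -> R[i]).
  apply/funext => xi; rewrite /fourierL1; under eq_fun do rewrite mul0r.
  by rewrite cint0 mulr0.
split; first by move=> n; split; [exact: L1_0|exact: L2_0].
- by under eq_fun do (under [X in sqn X]eq_fun do rewrite subrr); rewrite sqn0; exact: cvg_cst.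
- by rewrite E; under eq_fun do (under [X in sqn X]eq_fun do rewrite subrr); rewrite sqn0; exact: cvg_cst.
Qed.

Lemma isfZ c f g : is_fourier f g -> is_fourier (fun x => c * f x) (fun x => c * g x).
Proof.
move=> fg; have := isf_lin c fg isf0.
by congr is_fourier; apply/funext => x; rewrite addr0.
Qed.

Lemma isfD f g f' g' : is_fourier f g -> is_fourier f' g' ->
  is_fourier (fun x => f x + f' x) (fun x => g x + g' x).
Proof.
move=> fg fg'; have := isf_lin 1 fg fg'.
by congr is_fourier; apply/funext => x; rewrite mul1r.
Qed.

Lemma isfB f g f' g' : is_fourier f g -> is_fourier f' g' ->
  is_fourier (fun x => f x - f' x) (fun x => g x - g' x).
Proof.
move=> fg fg'; have := isf_lin (-1) fg' fg.
by congr is_fourier; apply/funext => x; rewrite mulN1r addrC.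
Qed.

Lemma isf_sum (I : Type) (s : seq I) (F G : I -> R -> R[i]) :
  (forall i, is_fourier (F i) (G i)) ->
  is_fourier (fun x => \sum_(i <- s) F i x) (fun x => \sum_(i <- s) G i x).
Proof.
move=> FG; elim: s => [|i s IH].
  under eq_fun do rewrite big_nil; under [X in is_fourier _ X]eq_fun do rewrite big_nil.
  exact: isf0.
under eq_fun do rewrite big_cons; under [X in is_fourier _ X]eq_fun do rewrite big_cons.
exact: isfD.
Qed.

Lemma isf_congr f g g' : is_fourier f g -> L2 g' -> {ae mu, forall x, g x = g' x} ->
  is_fourier f g'.
Proof.
move=> /isfP[lf lg [u [lu uf ug]]] lg' gg'; apply/isfP; split => //.
exists u; split => //.
rewrite (_ : (fun n => _) = (fun n => sqn (fun x => fourierL1 (u n) x - g x)))//.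
have lfu n := (plancherel (lu n).1 (lu n).2).1.
apply/funext => n; apply: sqn_ae; [exact: L2B|exact: L2B|].
by apply: ae_imp gg' => x ->.
Qed.

Lemma fourierL1_tau (a : R) u : L1 u ->
  fourierL1 (tau a u) = (fun xi => expi (a * xi) * fourierL1 u xi).
Proof.
move=> lu; apply/funext => xi; rewrite /fourierL1 mulrCA; congr (_ * _).
rewrite -(cint_shift a (L1_cmeas (L1_kernel xi lu))) -cintZ; last first.
  exact: (L1_shift a (L1_kernel xi lu)).
congr cintegral; apply/funext => t; rewrite /tau mulrCA -expiD.
by congr (_ * expi _); ring.
Qed.

Lemma sqn_expi (a : R -> R) f : sqn (fun x => expi (a x) * f x) = sqn f.
Proof. by apply: eq_Rintegral => x _; rewrite nsqM nsq_expi mul1r. Qed.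

Lemma isf_tau (a : R) f g : is_fourier f g ->
  is_fourier (tau a f) (fun xi => expi (a * xi) * g xi).
Proof.
move=> /isfP[lf lg [u [lu uf ug]]]; apply/isfP; split.
- exact: L2_shift.
- by under eq_fun do rewrite mulrC; apply: L2_expi => //; exact: measurable_funM.
exists (fun n => tau a (u n)); split.
- by move=> n; split; [apply: L1_shift; case: (lu n)|apply: L2_shift; case: (lu n)].
- rewrite (_ : (fun n => _) = (fun n => sqn (fun x => u n x - f x)))//.
  by apply/funext => n; exact: (sqn_shift a (cmeasB (lu n).2.1 lf.1)).
- rewrite (_ : (fun n => _) = (fun n => sqn (fun x => fourierL1 (u n) x - g x)))//.
  apply/funext => n; rewrite fourierL1_tau; last by case: (lu n).
  under eq_fun do rewrite -mulrBr.
  exact: sqn_expi.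
Qed.

(** Polarization: the isometry is applied to [f + c f'] with [c = 1] and [c = i]. *)
Lemma isf_inner f g f' g' : is_fourier f g -> is_fourier f' g' ->
  inner f f' = inner g g'.
Proof.
move=> fg fg'; have lf := isf_L2l fg; have lg := isf_L2r fg.
have lf' := isf_L2l fg'; have lg' := isf_L2r fg'.
have K c : Re (inner f (fun x => c * f' x)) = Re (inner g (fun x => c * g' x)).
  have := isf_isom (isfD fg (isfZ c fg')).
  rewrite !sqnD//; try exact: L2Z.
  rewrite !sqnZ// (isf_isom fg) (isf_isom fg') => /addrI.
  by apply: mulfI.
have Z (F G : R -> R[i]) c : L2 F -> L2 G -> inner F (fun x => c * G x) = conjc c * inner F G.
  move=> lF lG; rewrite (innerC (L2Z c lG) lF) innerZl// (innerC lF lG).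
  by case: c (inner F G) => [a b] [d e]; apply: complexP => /=; ring.
apply: complexP.
  by have := K 1; rewrite !Z// conjc1 !mul1r.
by have := K 'i%C; rewrite !Z// !cReM /= !mul0r !sub0r !mulN1r !opprK.
Qed.

End FourierTransform.

(** * Periodization over three cells *)

Section Tiling.
Variable R : realType.
Variable h : R.
Implicit Types (f g F m : R -> R[i]) (x c : R).
Local Notation cell := `[- (h / 2), h / 2[.
Local Notation cell3 := `[- (3 * h / 2), 3 * h / 2[.

(** [cut F c] brings a translate of the cell back to the central one. [fold] sums the three cells
    into the central one, [per] copies a function on the central cell to all three; on functions so
    supported they are adjoint, whence their joint presence in the frame operator. *)
Definition cut F c x : R[i] := if x \in cell then F (x + c) else 0.
Definition fold F x : R[i] := cut F (- h) x + cut F 0 x + cut F h x.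
Definition per m x : R[i] := m (x + h) + m x + m (x - h).

Lemma cmeas_cut F c : cmeas F -> cmeas (cut F c).
Proof.
move=> mF; apply: cmeas_if (measurable_itv_fun _) _ (cmeas_cst 0).
exact: cmeas_comp (measurable_shift _) mF.
Qed.

Lemma cut_out F c x : x \notin cell -> cut F c x = 0.
Proof. by rewrite /cut => /negbTE ->. Qed.

Lemma fold_out F x : x \notin cell -> fold F x = 0.
Proof. by move=> xc; rewrite /fold !cut_out// !addr0. Qed.

Lemma foldE F x : x \in cell -> fold F x = F (x - h) + F x + F (x + h).
Proof. by rewrite /fold /cut => ->; rewrite addr0. Qed.

Lemma L2_cut F c : L2 F -> L2 (cut F c).
Proof.
move=> lF; apply: (L2_dom (cmeas_cut c lF.1) (L2_int (L2_shift c lF))) => x.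
by rewrite /cut; case: ifP => // _; rewrite nsq0 nsq_ge0.
Qed.

Lemma L2_fold F : L2 F -> L2 (fold F).
Proof. by move=> lF; apply: L2D; [apply: L2D|]; exact: L2_cut. Qed.

Lemma L1_cut F c : L1 F -> L1 (cut F c).
Proof.
move=> lF.
have -> : cut F c = (fun x => F (x + c) * (if x \in cell then 1 else 0)).
  by apply/funext => x; rewrite /cut; case: ifP; rewrite ?mulr1 ?mulr0.
apply: (@L1_bnd _ _ _ 1); first exact: L1_shift.
  exact: cmeas_if (measurable_itv_fun _) (cmeas_cst 1) (cmeas_cst 0).
by move=> x; case: ifP => _; rewrite /nsq /= ?expr0n ?expr1n ?addr0.
Qed.

Lemma cell3_split x : x \in cell3 ->
  [\/ [/\ x + h \in cell, x \notin cell & x - h \notin cell],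
      [/\ x + h \notin cell, x \in cell & x - h \notin cell] |
      [/\ x + h \notin cell, x \notin cell & x - h \in cell]].
Proof.
rewrite !in_itv /= => /andP[x1 x2].
have [xa|xa] := ltP x (- (h / 2)); first by constructor 1; split; lra.
have [xb|xb] := ltP x (h / 2); first by constructor 2; split; lra.
by constructor 3; split; lra.
Qed.

Lemma cell3_out x : x \notin cell3 -> [/\ x + h \notin cell, x \notin cell & x - h \notin cell].
Proof. by rewrite !in_itv /= => H; split; apply/negP => K; move/negP: H; apply; lra. Qed.

Lemma cint_fold F : L1 F -> (forall x, x \notin cell3 -> F x = 0) ->
  cintegral F = cintegral (fold F).
Proof.
move=> lF F0.
pose G c x := cut F c (x - c).
have lG c : L1 (G c) by exact: (L1_shift (- c) (L1_cut c lF)).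
have GE c : cintegral (G c) = cintegral (cut F c).
  exact: (cint_shift (- c) (L1_cmeas (L1_cut c lF))).
rewrite /fold cintD; [|by apply: L1D; exact: L1_cut|exact: L1_cut].
rewrite cintD; [|exact: L1_cut..].
rewrite -!GE -cintD// -cintD//; last exact: L1D.
congr cintegral; apply/funext => x; rewrite /G /cut opprK subr0 addr0 !subrK addrK.
have [/cell3_split|xn] := boolP (x \in cell3).
  by case=> -[/[dup] ? h1 /[dup] ? h2 /[dup] ? h3];
    rewrite ?(negbTE h1) ?(negbTE h2) ?(negbTE h3) ?h1 ?h2 ?h3 ?addr0 ?add0r.
have [h1 h2 h3] := cell3_out xn.
by rewrite (negbTE h1) (negbTE h2) (negbTE h3) F0// !addr0.
Qed.

Lemma sqn_fold F : L2 F -> (forall x, x \notin cell3 -> F x = 0) ->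
  sqn F = sqn (cut F (- h)) + sqn (cut F 0) + sqn (cut F h).
Proof.
move=> lF F0.
pose N x : R[i] := (nsq (F x))%:C%C.
have lN : L1 N.
  by split; [exact: L2_int|exact: integrable0].
have := cint_fold lN; rewrite /fold.
have lc c : L1 (cut N c) by exact: L1_cut.
rewrite cintD ?cintD//; last exact: L1D.
have cE c : Re (cintegral (cut N c)) = sqn (cut F c).
  rewrite Re_cint; apply: eq_Rintegral => x _; rewrite /cut; case: ifP => //.
  by rewrite nsq0.
move=> /(_ _)/(congr1 (@complex.Re R)); rewrite !cReD !cE Re_cint; apply.
by move=> x /F0; rewrite /N => ->; rewrite nsq0.
Qed.

Lemma L2_per m : L2 m -> L2 (per m).
Proof. by move=> lm; apply: L2D; [apply: L2D|] => //; exact: L2_shift. Qed.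

(** Two uses of [sqnD_le] give the constant [2 (2 + 2) + 2]. *)
Lemma sqn_per m : L2 m -> sqn (per m) <= 10 * sqn m.
Proof.
move=> lm; have l1 := L2_shift h lm; have l2 := L2_shift (- h) lm.
apply: (le_trans (sqnD_le (L2D l1 lm) l2)).
rewrite (sqn_shift (- h) lm.1).
have := sqnD_le l1 lm; rewrite (sqn_shift h lm.1) => H.
have := sqn_ge0 m; lra.
Qed.

Lemma perE m x : (forall x, x \notin cell -> m x = 0) -> x \in cell ->
  [/\ per m (x - h) = m x, per m x = m x & per m (x + h) = m x].
Proof.
move=> m0; rewrite in_itv/= => /andP[x1 x2]; rewrite /per.
have O y : (y < - (h / 2)) || (h / 2 <= y) -> m y = 0.
  move=> H; apply: m0; rewrite in_itv/=; apply/negP; lra.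
split.
- by rewrite subrK (O (x - h)) ?(O (x - h - h)) ?addr0//; apply/orP; left; lra.
- rewrite (O (x + h)) ?(O (x - h)) ?addr0 ?add0r//.
    by apply/orP; left; lra.
  by apply/orP; right; lra.
- by rewrite addrK (O (x + h)) ?(O (x + h + h)) ?add0r//; apply/orP; right; lra.
Qed.

End Tiling.

(** * Interpolation at three nodes *)

Section Nodes.
Variable R : realType.
Implicit Types (x y a b c M : R) (u v w U V W z : R[i]).
Local Open Scope complex_scope.

Lemma sum3 (V : nmodType) (F : 'I_3 -> V) :
  \sum_(j < 3) F j = F ord0 + F (lift ord0 ord0) + F ord_max.
Proof.
rewrite !big_ord_recl big_ord0 addr0 addrA; congr (_ + _ + F _).
exact: val_inj.
Qed.

Lemma forall3 (P : 'I_3 -> Prop) :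
  P ord0 -> P (lift ord0 ord0) -> P ord_max -> forall j, P j.
Proof.
move=> p0 p1 p2 [[|[|[|//]]] hj].
- by rewrite (_ : Ordinal hj = ord0)//; exact: val_inj.
- by rewrite (_ : Ordinal hj = lift ord0 ord0)//; exact: val_inj.
- by rewrite (_ : Ordinal hj = ord_max)//; exact: val_inj.
Qed.

Definition q (j : 'I_3) y : R[i] := vec3 1 ('i * y%:C) (- (y ^+ 2)%:C) j.

Lemma vec30 (a b c : R[i]) : vec3 a b c ord0 = a. Proof. by []. Qed.
Lemma vec31 (a b c : R[i]) : vec3 a b c (lift ord0 ord0) = b. Proof. by []. Qed.
Lemma vec32 (a b c : R[i]) : vec3 a b c ord_max = c. Proof. by []. Qed.

Definition vec3E := (vec30, vec31, vec32).

(** The Gram matrix of the nodes. Multiplied by [h], it is the matrix of the frame operator over a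
    fibre. *)
Lemma sum_qJ a b : \sum_j q j a * (q j b)^*%C = (1 + a * b + (a * b) ^+ 2)%:C.
Proof.
rewrite sum3 /q !vec3E; apply: complexP; rewrite !reim /=; ring.
Qed.

Lemma nsq_q_le j y M : `|y| <= M -> nsq (q j y) <= 1 + M ^+ 2 + M ^+ 4.
Proof.
move=> yM.
have y2 : y ^+ 2 <= M ^+ 2 by rewrite -(real_normK (num_real y)) ler_sqr ?nnegrE// (le_trans _ yM).
have m2 := sqr_ge0 M; have yy := sqr_ge0 y.
have y4 : (y ^+ 2) ^+ 2 <= M ^+ 4 by rewrite (exprM M 2 2) ler_sqr ?nnegrE.
have m4 : 0 <= M ^+ 4 by rewrite (le_trans (sqr_ge0 _) y4).
by elim/forall3: j; rewrite /q !vec3E /nsq !reim /=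
  ?(expr0n, expr1n, mul0r, mul1r, sub0r, addr0, add0r, oppr0, sqrrN); lra.
Qed.

Lemma nsqD3_le u v w : nsq (u + v + w) <= 3 * (nsq u + nsq v + nsq w).
Proof.
rewrite /nsq !reim.
set a := Re u; set b := Re v; set c := Re w; set d := Im u; set e := Im v; set f := Im w.
have := (sqr_ge0 (a - b), sqr_ge0 (a - c), sqr_ge0 (b - c)).
have := (sqr_ge0 (d - e), sqr_ge0 (d - f), sqr_ge0 (e - f)).
by move=> [[? ?] ?] [[? ?] ?]; nra.
Qed.

Lemma nsq_comb a b c M U V W : a ^+ 2 <= M -> b ^+ 2 <= M -> c ^+ 2 <= M ->
  nsq (a%:C * U + 'i * b%:C * V - c%:C * W) <= 3 * M * (nsq U + nsq V + nsq W).
Proof.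
move=> aM bM cM; apply: (le_trans (nsqD3_le _ _ _)).
rewrite nsqN !nsqM !nsqC (_ : nsq 'i = 1) ?mul1r; last by rewrite /nsq/= expr0n expr1n add0r.
have := (nsq_ge0 U, nsq_ge0 V, nsq_ge0 W) => -[[? ?] ?].
rewrite -mulrA ler_pM2l// [leRHS](mulrDr M) (mulrDr M (nsq U)).
by rewrite !lerD// ler_wpM2r ?nsq_ge0.
Qed.

End Nodes.

Section Lagrange.
Variable R : realType.
Variable h : R.
Hypothesis h0 : 0 < h.
Implicit Types (x : R) (u v w : R[i]).
Local Open Scope complex_scope.

(* [lag k e x] is the coefficient of [y ^+ e] in the Lagrange polynomial of the
   [k]-th node among [x - h], [x], [x + h]. *)
Definition lag (k e : 'I_3) x : R :=
  let t := h^-1 * x in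
  tnth (tnth [tuple [tuple t * (t + 1) / 2; - (2 * t + 1) * h^-1 / 2; h^-1 ^+ 2 / 2];
                    [tuple 1 - t ^+ 2; 2 * t * h^-1; - h^-1 ^+ 2];
                    [tuple t * (t - 1) / 2; (1 - 2 * t) * h^-1 / 2; h^-1 ^+ 2 / 2]] k) e.

Definition lagM : R := 1 + h^-1 ^+ 2 + h^-1 ^+ 4.

Lemma lagM_gt0 : 0 < lagM.
Proof. by rewrite /lagM (exprM _ 2 2) -addrA ltr_pwDl// addr_ge0// sqr_ge0. Qed.

(** With [t = x / h] in [[-1/2, 1/2]], the coefficient of degree [e] is [h^-e] times a number of
    [[-1, 1]], so its square is at most one of the three terms of [lagM]. *)
Lemma lag_le k e x : x \in `[- (h / 2), h / 2[ -> lag k e x ^+ 2 <= lagM.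
Proof.
rewrite in_itv/= => /andP[x1 x2]; rewrite /lag /lagM.
have hk : h^-1 * h = 1 by rewrite mulVf ?gt_eqF.
have k0 : 0 < h^-1 by rewrite invr_gt0.
have t1 : - (1 / 2) <= h^-1 * x by rewrite -(ler_pM2l h0) mulrA mulfV ?gt_eqF//; lra.
have t2 : h^-1 * x <= 1 / 2 by rewrite -(ler_pM2l h0) mulrA mulfV ?gt_eqF//; lra.
set t := _ * x in t1 t2 *; set s := h^-1 in k0 *; clearbody t s.
rewrite (exprM s 2 2).
have s2 : 0 <= s ^+ 2 by exact: sqr_ge0.
have s4 : 0 <= (s ^+ 2) ^+ 2 by exact: sqr_ge0.
have ts : t ^+ 2 <= 1 / 4.
  by rewrite -subr_ge0 (_ : _ - _ = (1 / 2 - t) * (t - - (1 / 2))) ?mulr_ge0 ?subr_ge0//; field.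
have ts0 := sqr_ge0 t.
have A b : `|b| <= 1 -> b ^+ 2 <= 1 + s ^+ 2 + (s ^+ 2) ^+ 2.
  by move=> b1; rewrite -real_normK ?num_real//; have := expr_le1 (n:=2) isT (normr_ge0 b); rewrite b1; lra.
have B b : `|b| <= 1 -> (b * s) ^+ 2 <= 1 + s ^+ 2 + (s ^+ 2) ^+ 2.
  move=> b1; have b2 : b ^+ 2 <= 1.
    by rewrite -real_normK ?num_real//; have := expr_le1 (n:=2) isT (normr_ge0 b); rewrite b1.
  by rewrite exprMn; have := ler_wpM2r s2 b2; lra.
have C b : `|b| <= 1 -> (b * s ^+ 2) ^+ 2 <= 1 + s ^+ 2 + (s ^+ 2) ^+ 2.
  move=> b1; have b2 : b ^+ 2 <= 1.
    by rewrite -real_normK ?num_real//; have := expr_le1 (n:=2) isT (normr_ge0 b); rewrite b1.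
  by rewrite exprMn; have := ler_wpM2r s4 b2; lra.
elim/forall3: k; elim/forall3: e; rewrite /tnth /=.
- by apply: A; rewrite ler_norml; apply/andP; split; nra.
- rewrite (_ : _ / 2 = - (2 * t + 1) / 2 * s); last by ring.
  by apply: B; rewrite ler_norml; apply/andP; split; lra.
- rewrite (_ : _ / 2 = 2^-1 * s ^+ 2); last by ring.
  by apply: C; rewrite ler_norml; apply/andP; split; lra.
- by apply: A; rewrite ler_norml; apply/andP; split; lra.
- by apply: B; rewrite ler_norml; apply/andP; split; lra.
- rewrite (_ : - _ = -1 * s ^+ 2); last by ring.
  by apply: C; rewrite ler_norml; apply/andP; split; lra.
- by apply: A; rewrite ler_norml; apply/andP; split; nra.
- rewrite (_ : _ / 2 = (1 - 2 * t) / 2 * s); last by ring.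
  by apply: B; rewrite ler_norml; apply/andP; split; lra.
- rewrite (_ : _ / 2 = 2^-1 * s ^+ 2); last by ring.
  by apply: C; rewrite ler_norml; apply/andP; split; lra.
Qed.

Definition ana x u v w (j : 'I_3) : R[i] :=
  u * conjc (q j (x - h)) + v * conjc (q j x) + w * conjc (q j (x + h)).

(** The factors [1], [i], [-1] turn [conjc (q j y)] into [y^j]; the sum thus evaluates the [k]-th
    Lagrange polynomial at the three nodes, where it is 1 at the [k]-th and 0 at the others. *)
Lemma ana_recover x u v w (k : 'I_3) : vec3 u v w k =
  (lag k ord0 x)%:C * ana x u v w ord0 +
  'i * (lag k (lift ord0 ord0) x)%:C * ana x u v w (lift ord0 ord0) -
  (lag k ord_max x)%:C * ana x u v w ord_max.
Proof.
have hn : h != 0 by rewrite gt_eqF.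
elim/forall3: k; rewrite /lag /ana /q !vec3E /tnth /=;
  apply: complexP; rewrite !reim /=; field; exact: hn.
Qed.

(** In the constant 9, one factor 3 comes from squaring a sum of three terms and the other from
    adding up the three nodes. *)
Lemma ana_lower x u v w : x \in `[- (h / 2), h / 2[ ->
  nsq u + nsq v + nsq w <= 9 * lagM * \sum_(j < 3) nsq (ana x u v w j).
Proof.
move=> xc; have H k : nsq (vec3 u v w k) <= 3 * lagM * \sum_(j < 3) nsq (ana x u v w j).
  by rewrite (ana_recover x) sum3; apply: nsq_comb; exact: lag_le.
have := H ord0; have := H (lift ord0 ord0); have := H ord_max; rewrite !vec3E; lra.
Qed.

Definition syn (m : 'I_3 -> R[i]) y : R[i] := \sum_(j < 3) q j y * m j.

(** Interpolation at three nodes reproduces the monomials of degree at most 2. Compared with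
    [ana_recover], this is the product of the two inverse matrices in the other order. *)
Lemma lag_moment x (e f : 'I_3) :
  lag ord0 e x * (x - h) ^+ f + lag (lift ord0 ord0) e x * x ^+ f +
  lag ord_max e x * (x + h) ^+ f = (e == f)%:R.
Proof.
have hn : h != 0 by rewrite gt_eqF.
by elim/forall3: e; elim/forall3: f; rewrite /lag /tnth /=; field; exact: hn.
Qed.

Lemma syn_comb m a b c (A B C : R) :
  A%:C * syn m a + B%:C * syn m b + C%:C * syn m c =
  (A * a ^+ (@ord0 2) + B * b ^+ (@ord0 2) + C * c ^+ (@ord0 2))%:C * m ord0 +
  'i * (A * a ^+ (lift ord0 (@ord0 1)) + B * b ^+ (lift ord0 (@ord0 1)) +
        C * c ^+ (lift ord0 (@ord0 1)))%:C * m (lift ord0 ord0) -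
  (A * a ^+ (@ord_max 2) + B * b ^+ (@ord_max 2) + C * c ^+ (@ord_max 2))%:C * m ord_max.
Proof.
rewrite /syn !sum3 /q !vec3E /=.
by case: (m ord0) (m (lift _ _)) (m ord_max) => ? ? [? ?] [? ?];
  apply: complexP; rewrite !reim /=; ring.
Qed.

(** [syn m] is a quadratic polynomial whose coefficient of degree [j] is [m j] times the phase of
    [q j]; interpolation finds that coefficient and the conjugate phase removes the factor. *)
Lemma syn_recover m x (j : 'I_3) :
  m j = vec3 1 (- 'i) (-1) j *
    ((lag ord0 j x)%:C * syn m (x - h) + (lag (lift ord0 ord0) j x)%:C * syn m x +
     (lag ord_max j x)%:C * syn m (x + h)).
Proof.
rewrite syn_comb !lag_moment.
elim/forall3: j; rewrite !vec3E /= ?mulr0n ?mulr1n;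
  apply: complexP; rewrite !reim /=; ring.
Qed.

Lemma syn_lower m x : x \in `[- (h / 2), h / 2[ ->
  \sum_(j < 3) nsq (m j) <=
  9 * lagM * (nsq (syn m (x - h)) + nsq (syn m x) + nsq (syn m (x + h))).
Proof.
move=> xc; have H j : nsq (m j) <=
    3 * lagM * (nsq (syn m (x - h)) + nsq (syn m x) + nsq (syn m (x + h))).
  have -> : nsq (m j) = nsq ((lag ord0 j x)%:C * syn m (x - h) +
      'i * (lag (lift ord0 ord0) j x)%:C * (- 'i * syn m x) -
      (lag ord_max j x)%:C * (- syn m (x + h))).
    rewrite {1}(syn_recover m x j) nsqM (_ : nsq (vec3 _ _ _ _) = 1) ?mul1r.
      congr nsq; apply: complexP; rewrite !reim /=; ring.
    by elim/forall3: j; rewrite !vec3E /nsq !reim /=; ring.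
  apply: (le_trans (nsq_comb _ _ _ (lag_le _ _ xc) (lag_le _ _ xc) (lag_le _ _ xc))).
  by rewrite !nsqM !nsqN (_ : nsq 'i = 1) ?mul1r//= /nsq/= expr0n expr1n add0r.
by rewrite sum3; have := H ord0; have := H (lift ord0 ord0); have := H ord_max; lra.
Qed.

End Lagrange.

(** * The frame operator *)

Section Frame.
Variable R : realType.
Local Notation mu := (@lebesgue_measure R).
Variables omega t0 h : R.
Hypothesis h0 : 0 < h.
Hypothesis wp : t0 * h = 2 * pi.
Hypothesis omega_le : omega <= 3 * h / 2.
Implicit Types (f g F : R -> R[i]) (x y xi : R) (j : 'I_3) (n : int).
Local Notation cell := `[- (h / 2), h / 2[.
Local Notation cell3 := `[- (3 * h / 2), 3 * h / 2[.
Local Notation I := `[- omega, omega[.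

(* [phi_hat] without its right endpoint: half-open intervals are tiled by
   translates of the cell. *)
Definition phi' j y : R[i] := if y \in I then q j y else 0.

Lemma phi'_out j y : y \notin I -> phi' j y = 0.
Proof. by rewrite /phi' => /negbTE ->. Qed.

Lemma I_abs y : y \in I -> `|y| <= omega.
Proof. by rewrite in_itv/= ler_norml => /andP[-> /ltW ->]. Qed.

Lemma I_cell3 y : y \in I -> y \in cell3.
Proof. by rewrite !in_itv/= => /andP[a b]; apply/andP; split; move: a b omega_le; lra. Qed.

Lemma cmeas_id_real : cmeas (fun y : R => y%:C%C).
Proof. by apply: cmeas_real; exact: measurable_id. Qed.

Lemma cmeas_q j : cmeas (@q R j).
Proof.
elim/forall3: j; rewrite /q /=.
- exact: cmeas_cst.
- by apply: cmeasM (cmeas_cst _) cmeas_id_real.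
- by apply: cmeasN; apply: cmeas_real; exact: measurable_funX.
Qed.

Definition qM : R := 1 + omega ^+ 2 + omega ^+ 4.

Lemma qM_gt0 : 0 < qM.
Proof. by rewrite /qM (exprM _ 2 2) -addrA ltr_pwDl// addr_ge0// sqr_ge0. Qed.

Lemma nsq_phi'_le j y : nsq (phi' j y) <= qM.
Proof.
rewrite /phi'; case: ifPn => [/I_abs|_]; first exact: nsq_q_le.
by rewrite nsq0 ltW// qM_gt0.
Qed.

Lemma cmeas_phi' j : cmeas (phi' j).
Proof. exact: cmeas_if (measurable_itv_fun _) (cmeas_q j) (cmeas_cst 0). Qed.

Lemma L2_phi' j : L2 (phi' j).
Proof.
by apply: (@L2_itv _ _ _ _ qM (cmeas_q j)) => x /I_abs; exact: nsq_q_le.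
Qed.

Definition W g j : R -> R[i] := fold h (fun y => g y * conjc (phi' j y)).

Lemma L2_W g j : L2 g -> L2 (W g j).
Proof.
move=> lg; apply: L2_fold; apply: (L2_bnd (M := qM) lg); first exact/cmeasJ/cmeas_phi'.
by move=> x; rewrite nsqJ nsq_phi'_le.
Qed.

Lemma W_out g j x : x \notin cell -> W g j x = 0.
Proof. exact: fold_out. Qed.

Lemma mulJ_out g j x : x \notin cell3 -> g x * conjc (phi' j x) = 0.
Proof.
move=> xc; rewrite phi'_out ?rmorph0 ?mulr0//.
by apply: contra xc; exact: I_cell3.
Qed.

Lemma fold_ev F n x : fold h (fun y => F y * ev t0 n y) x = fold h F x * ev t0 n x.
Proof.
rewrite /fold /cut; case: ifP => _; last by rewrite !addr0 mul0r.
have := ev_shift wp n 1 x; rewrite mul1r => ->.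
have := ev_shift wp n (-1) x; rewrite mulrN1z mulN1r => ->.
by rewrite addr0 !mulrDl.
Qed.

(** Here the Fourier series have period [h] and fundamental frequency [t0], so the exponentials are
    [h]-periodic and come out of the folding. *)
Lemma coef_fc g j n : L2 g ->
  inner g (fun xi => ev t0 n xi * phi' j xi) = fc t0 (W g j) n.
Proof.
move=> lg; rewrite /inner /fc.
pose G y := (g y * conjc (phi' j y)) * ev t0 (- n) y.
rewrite (_ : (fun x => _) = G); last first.
  by apply/funext => x; rewrite /G -evJ -mulrA; congr (_ * _); rewrite mulrC rmorphM.
rewrite (@cint_fold _ h).
- by congr cintegral; apply/funext => x; rewrite fold_ev.
- apply: (@L1_bnd _ _ _ 1); [exact: L2_mulJ (L2_phi' j)|exact: cmeas_ev|].
  by move=> x; rewrite nsq_ev.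
- by move=> x xc; rewrite /G mulJ_out ?mul0r.
Qed.

Lemma sum_sqn_le (K : R) (u v : 'I_3 -> R -> R[i]) :
  (forall j, L2 (u j)) -> (forall j, L2 (v j)) ->
  (forall x, \sum_(j < 3) nsq (u j x) <= K * \sum_(j < 3) nsq (v j x)) ->
  \sum_(j < 3) sqn (u j) <= K * \sum_(j < 3) sqn (v j).
Proof.
move=> lu lv uv.
have E (w : 'I_3 -> R -> R[i]) : (forall j, L2 (w j)) ->
    mu.-integrable setT (EFin \o (fun x => \sum_(j < 3) nsq (w j x))) /\
    \int[mu]_x (\sum_(j < 3) nsq (w j x)) = \sum_(j < 3) sqn (w j).
  move=> lw; have i j := L2_int (lw j).
  under [X in EFin \o X]eq_fun do rewrite sum3.
  split; first by apply: integrableDR; [apply: integrableDR|]; exact: i.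
  under eq_Rintegral do rewrite sum3.
  rewrite RintegralD//; last by apply: integrableDR; exact: i.
  by rewrite RintegralD// sum3.
have [iu <-] := E u lu; have [iv <-] := E v lv.
rewrite -RintegralZl//; apply: le_Rintegral => //; exact: integrableZR.
Qed.

Definition cuts g (k : 'I_3) := cut h g (tnth [tuple - h; 0; h] k).

Lemma L2_cuts g k : L2 g -> L2 (cuts g k).
Proof. exact: L2_cut. Qed.

Lemma sqn_cuts g : L2 g -> (forall x, x \notin I -> g x = 0) ->
  sqn g = \sum_(k < 3) sqn (cuts g k).
Proof.
move=> lg g0; rewrite (@sqn_fold _ h)// ?sum3// => x xc.
by apply: g0; apply: contra xc; exact: I_cell3.
Qed.

(** At a node outside the band [g] vanishes, so [phi'] may be replaced by [q]. The full three-node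
    matrix thus applies over every point of the cell. *)
Lemma W_ana g j x : (forall x, x \notin I -> g x = 0) -> x \in cell ->
  W g j x = ana h x (g (x - h)) (g x) (g (x + h)) j.
Proof.
move=> g0 xc; rewrite /W (foldE _ xc) /ana.
have E y : g y * conjc (phi' j y) = g y * conjc (q j y).
  by rewrite /phi'; case: ifPn => // /g0 ->; rewrite !mul0r.
by rewrite !E.
Qed.

Lemma W_lower g : L2 g -> (forall x, x \notin I -> g x = 0) ->
  sqn g <= 9 * lagM h * \sum_(j < 3) sqn (W g j).
Proof.
move=> lg g0; rewrite sqn_cuts//; apply: sum_sqn_le => [j|j|x].
- exact: L2_cuts.
- exact: L2_W.
have [xc|xc] := boolP (x \in cell); last first.
  rewrite !sum3 /cuts !cut_out// nsq0 !W_out// nsq0; lra.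
rewrite sum3 /cuts /cut xc /= addr0.
under eq_bigr do rewrite W_ana//.
exact: ana_lower.
Qed.

Lemma W_upper g : L2 g -> (forall x, x \notin I -> g x = 0) ->
  \sum_(j < 3) sqn (W g j) <= 9 * qM * sqn g.
Proof.
move=> lg g0; rewrite (sqn_cuts lg g0); apply: sum_sqn_le => [j|j|x].
- exact: L2_W.
- exact: L2_cuts.
have H j : nsq (W g j x) <= 3 * qM * \sum_(k < 3) nsq (cuts g k x).
  have [xc|xc] := boolP (x \in cell); last first.
    by rewrite W_out// !sum3 /cuts !cut_out// nsq0 !addr0 mulr0.
  rewrite /W (foldE _ xc) sum3 /cuts /cut xc /= addr0.
  apply: (le_trans (nsqD3_le _ _ _)); rewrite !nsqM !nsqJ -mulrA ler_pM2l//.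
  rewrite [leRHS](mulrDr qM) (mulrDr qM (nsq (g (x - h)))).
  by rewrite !lerD// mulrC ler_wpM2r ?nsq_ge0// nsq_phi'_le.
have := H ord0; have := H (lift ord0 ord0); have := H ord_max.
rewrite [X in _ -> _ -> _ -> X <= _]sum3; lra.
Qed.

Lemma ae_neq (a : R) : {ae mu, forall x, x != a}.
Proof.
exists [set a]; split => //; first exact: lebesgue_measure_set1.
by move=> x /= /negP; rewrite negbK => /eqP.
Qed.

(** A transform is a class: its representative is reset to 0 on a null set and at the right
    endpoint, so as to vanish exactly off the half-open band. *)
Lemma bandlimitedP f : bandlimited omega f ->
  exists2 g, is_fourier f g & forall x, x \notin I -> g x = 0.
Proof.
move=> [g fg g0]; pose g' x := if x \in I then g x else 0.
have lg := isf_L2r fg.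
exists g'; last by move=> x; rewrite /g' => /negbTE ->.
apply: (isf_congr fg).
  apply: (L2_dom _ (L2_int lg)) => [|x].
    exact: cmeas_if (measurable_itv_fun _) lg.1 (cmeas_cst 0).
  by rewrite /g'; case: ifP => // _; rewrite nsq0 nsq_ge0.
apply: ae_imp2 g0 (ae_neq omega) => x g0 xo; rewrite /g'; case: ifPn => // xI.
apply: g0; apply: contra xI; rewrite !in_itv/= => /andP[-> xle]/=.
by rewrite lt_neqAle xo.
Qed.

Variable Phi : 'I_3 -> R -> R[i].
Hypothesis Phi_hat : forall j, is_fourier (Phi j) (phi_hat omega j).

Lemma isf_Phi j : is_fourier (Phi j) (phi' j).
Proof.
apply: (isf_congr (Phi_hat j) (L2_phi' j)).
apply: ae_imp (ae_neq omega) => x xo; rewrite /phi_hat /phi' /q.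
have -> // : (x \in I) = (x \in `[- omega, omega]).
by rewrite !in_itv/=; congr andb; rewrite lt_neqAle xo.
Qed.

Lemma isf_translate j n : is_fourier (translate t0 Phi j n) (fun xi => ev t0 n xi * phi' j xi).
Proof.
have := isf_tau (n%:~R * t0) (isf_Phi j).
by rewrite (_ : (fun xi => expi _ * _) = (fun xi => ev t0 n xi * phi' j xi))//;
  apply/funext => xi; rewrite /ev mulrA.
Qed.

Lemma coefE f g j n : is_fourier f g -> coef t0 Phi f j n = fc t0 (W g j) n.
Proof.
by move=> fg; rewrite /coef (isf_inner fg (isf_translate j n)) coef_fc//; exact: isf_L2r fg.
Qed.

Lemma sqsum_coef f g : is_fourier f g ->
  sqsum (coef t0 Phi f) = (h * \sum_(j < 3) sqn (W g j))%:E.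
Proof.
move=> fg; rewrite mulr_sumr -sumEFin; apply: eq_bigr => j _.
rewrite -(parseval h0 wp (L2_W j (isf_L2r fg)) (@W_out g j)).
by apply: eq_esum => n _; rewrite -nsqE (coefE _ _ fg).
Qed.

Lemma frame : is_frame t0 Phi omega.
Proof.
have lM := lagM_gt0 h; have qp := qM_gt0.
(* The minimum secures [A <= B]. *)
exists (Num.min (h / (9 * lagM h)) (9 * qM * h)), (9 * qM * h); split.
- by rewrite lt_min divr_gt0 ?mulr_gt0.
- by rewrite ge_min lexx orbT.
move=> f /bandlimitedP[g fg g0]; rewrite (sqsum_coef fg).
have lg := isf_L2r fg.
rewrite L2norm_sqr; last exact: isf_L2l fg.
rewrite (isf_isom fg) -!EFinM !lee_fin; apply/andP; split; last first.
  by rewrite [leLHS]mulrC mulrAC ler_pM2r// W_upper.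
apply: (@le_trans _ _ (h / (9 * lagM h) * sqn g)).
  by apply: ler_wpM2r; rewrite ?sqn_ge0// ge_min lexx.
rewrite -mulrA ler_pM2l// ler_pdivrMl; last exact: mulr_gt0.
exact: W_lower.
Qed.

(** * Synthesis on the frequency side and the Riesz basis property *)

Implicit Types m : 'I_3 -> R -> R[i].

(** The transform of the synthesis of [c], where [m j] is the function on the cell with Fourier
    coefficients [c j]. *)
Definition synF m y : R[i] := \sum_(j < 3) phi' j y * per h (m j) y.

Lemma L2_mul_phi' j f : L2 f -> L2 (fun y => phi' j y * f y).
Proof.
move=> lf; rewrite (_ : (fun y => _) = (fun y => f y * phi' j y)).
  by apply: (L2_bnd (M := qM) lf (cmeas_phi' j)) => x; exact: nsq_phi'_le.
by apply/funext => y; rewrite mulrC.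
Qed.

Lemma L2_synF m : (forall j, L2 (m j)) -> L2 (synF m).
Proof.
move=> lm; apply: L2_sum => j; apply: L2_mul_phi'; exact: L2_per.
Qed.

Lemma synFB m m' y : synF m y - synF m' y = synF (fun j x => m j x - m' j x) y.
Proof.
rewrite /synF -sumrB; apply: eq_bigr => j _.
by rewrite -mulrBr /per; congr (_ * _); ring.
Qed.

Lemma sqn_synF m : (forall j, L2 (m j)) ->
  sqn (synF m) <= 4 * (qM * 10) * \sum_(j < 3) sqn (m j).
Proof.
move=> lm.
have lp j : L2 (fun y => phi' j y * per h (m j) y).
  by apply: L2_mul_phi'; exact: L2_per.
have H j : sqn (fun y => phi' j y * per h (m j) y) <= qM * 10 * sqn (m j).
  rewrite -mulrA; apply: (@le_trans _ _ (qM * sqn (per h (m j)))); last first.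
    by rewrite ler_pM2l ?qM_gt0//; exact: sqn_per.
  rewrite /sqn -RintegralZl//; last exact: L2_int (L2_per h (lm j)).
  apply: le_Rintegral => //; first exact: L2_int (lp j).
    exact: integrableZR (L2_int (L2_per h (lm j))).
  by move=> x _; rewrite nsqM ler_wpM2r ?nsq_ge0// nsq_phi'_le.
rewrite (_ : synF m = (fun y => phi' ord0 y * per h (m ord0) y +
  phi' (lift ord0 ord0) y * per h (m (lift ord0 ord0)) y +
  phi' ord_max y * per h (m ord_max) y)); last by apply/funext => y; rewrite /synF sum3.
apply: (le_trans (sqnD_le (L2D (lp _) (lp _)) (lp _))).
have := sqnD_le (lp ord0) (lp (lift ord0 ord0)).
have := H ord0; have := H (lift ord0 ord0); have := H ord_max.
rewrite sum3; have := sqn_ge0 (fun y => phi' ord_max y * per h (m ord_max) y); lra.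
Qed.

Lemma per_trig a (s : seq int) y : y \in cell3 ->
  per h (trig h t0 a s) y = \sum_(n <- s) a n * ev t0 n y.
Proof.
move=> yc; rewrite /per /trig -!big_split/=; apply: eq_bigr => n _.
rewrite -!mulrDr; congr (_ * _); rewrite /evI.
have := ev_shift wp n 1 y; rewrite mul1r => e1.
have := ev_shift wp n (-1) y; rewrite mulrN1z mulN1r => e2.
case: (cell3_split yc) => -[h1 h2 h3]; rewrite ?h1 ?h2 ?h3
  ?(negbTE h1) ?(negbTE h2) ?(negbTE h3) ?e1 ?e2; ring.
Qed.

Lemma isf_synth (c : 'I_3 -> int -> R[i]) (N : seq int) :
  is_fourier (fun x => \sum_(j < 3) \sum_(n <- N) c j n * translate t0 Phi j n x)
             (synF (fun j => trig h t0 (c j) N)).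
Proof.
rewrite (_ : synF _ = (fun y => \sum_(j < 3) \sum_(n <- N) c j n * (ev t0 n y * phi' j y))).
  by do 2 apply: isf_sum => ?; apply: isfZ; exact: isf_translate.
apply/funext => y; apply: eq_bigr => j _.
have [yI|yI] := boolP (y \in I); last first.
  by rewrite phi'_out// mul0r big1// => n _; rewrite !mulr0.
rewrite (per_trig _ _ (I_cell3 yI)) mulr_sumr; apply: eq_bigr => n _; ring.
Qed.

(** The isometry lets unconditional convergence be tested on the transforms of the finite sums. *)
Lemma synthesisP (c : 'I_3 -> int -> R[i]) f F : is_fourier f F ->
  is_synthesis t0 Phi c f <->
  sqn (fun y => synF (fun j => trig h t0 (c j) (N : {fset int})) y - F y)
    @[N --> totally] --> 0.
Proof.
move=> fF; have tF : ProperFilter (@totally int) := totally_filter.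
have E (N : {fset int}) := isfB (isf_synth c N) fF.
have -> : (fun N : {fset int} => sqn (fun y => synF (fun j => trig h t0 (c j) N) y - F y)) =
    (fun N : {fset int} => sqn ((fun x => \sum_(j < 3) \sum_(n <- N) c j n * translate t0 Phi j n x) \- f)).
  by apply/funext => N; rewrite -(isf_isom (E N)).
have H := L2norm_cvg0 (F := @totally int) _ (fun N => isf_L2l (E N)).
split => [[_ /(H _)]//|K]; split; last exact/(H _).
by apply/cLfun2P; exact: isf_L2l fF.
Qed.

(** [synF] is linear and bounded for the norm, so it carries over the unconditional convergence of
    the Fourier series of each [m j]. *)
Lemma synthesis_coefs (m : 'I_3 -> R -> R[i]) (c : 'I_3 -> int -> R[i]) f :
  (forall j, L2 (m j)) -> (forall j x, x \notin cell -> m j x = 0) ->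
  (forall j n, c j n = coefs h t0 (m j) n) ->
  is_fourier f (synF m) -> is_synthesis t0 Phi c f.
Proof.
move=> lm m0 cm fF; apply/(synthesisP c fF).
have tF : ProperFilter (@totally int) := totally_filter.
pose d (N : {fset int}) j x := trig h t0 (c j) N x - m j x.
have ld N j : L2 (d N j) by apply: L2B => //; exact: L2_trig.
apply: (@squeeze_cvgr _ _ _ _ (cst 0) (fun N => 4 * (qM * 10) * \sum_(j < 3) sqn (d N j))).
- apply: nearW => N; rewrite sqn_ge0/=.
  rewrite (_ : (fun y => _) = synF (d N)); first exact: sqn_synF.
  by apply/funext => y; rewrite synFB.
- exact: cvg_cst.
rewrite -[X in _ --> X](mulr0 (4 * (qM * 10))); apply: cvgMl_tmp.
have H j : sqn (d N j) @[N --> totally] --> 0.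
  rewrite (_ : (fun N => _) = (fun N : {fset int} => sqn (fun x => m j x - trig h t0 (coefs h t0 (m j)) N x))).
    exact: fourier_series_uncond (lm j) (@m0 j).
  apply/funext => N; rewrite sqnBC /d.
  by rewrite (_ : c j = coefs h t0 (m j))//; apply/funext => n.
rewrite (_ : (fun N => _) = (fun N => sqn (d N ord0) + sqn (d N (lift ord0 ord0)) + sqn (d N ord_max))).
  by rewrite -(addr0 0) -{1}(addr0 0); apply: cvgD; [apply: cvgD|]; exact: H.
by apply/funext => N; rewrite sum3.
Qed.

Lemma in_l2_bnd (c : 'I_3 -> int -> R[i]) j : in_l2 c ->
  exists C, forall n : nat, \sum_(0 <= i < n) nsq (c j (zenum i)) <= C.
Proof.
move=> cl; apply: (esum_int_bnd (a := fun n => nsq (c j n))) => [n|]; first exact: nsq_ge0.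
apply: le_lt_trans cl; rewrite /sqsum (bigD1 j)//=.
rewrite (_ : (\esum_(n in [set: int]) _)%E = (\esum_(n in [set: int]) (normc (c j n) ^+ 2)%:E)%E); last first.
  by apply: eq_esum => n _; rewrite nsqE.
by rewrite leeDl// sume_ge0// => k _; apply: esum_ge0 => n _; rewrite lee_fin sqr_ge0.
Qed.

Lemma synF_out m y : y \notin I -> synF m y = 0.
Proof. by move=> yI; rewrite /synF big1// => j _; rewrite phi'_out ?mul0r. Qed.

Lemma isf_synF m : (forall j, L2 (m j)) -> exists f, is_fourier f (synF m).
Proof.
by move=> lm; apply: (fourier_inverse (L2_synF lm)) => x; exact: synF_out.
Qed.

Lemma synthesis_exists (c : 'I_3 -> int -> R[i]) : in_l2 c ->
  exists f, is_synthesis t0 Phi c f.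
Proof.
move=> cl.
have H j : exists m : R -> R[i], [/\ L2 m, forall x, x \notin cell -> m x = 0 &
    forall n, coefs h t0 m n = c j n].
  have [C cC] := in_l2_bnd j cl.
  (* [coefs] divides by the period [h], hence the factor [h] put on the sequence. *)
  have := @riesz_fischer R h t0 h0 wp (fun n => h%:C%C * c j n) (h ^+ 2 * C).
  case=> [n|m [lm m0 mE _]].
    under eq_bigr do rewrite nsqM nsqC.
    by rewrite -mulr_sumr ler_wpM2l// sqr_ge0.
  exists m; split => // n; rewrite /coefs mE mulrA -rmorphM/= mulVf ?mul1r//.
  by rewrite gt_eqF.
have /choice [m mP] := H.
have lm j : L2 (m j) by case: (mP j).
have [f fF] := isf_synF lm.
exists f; apply: (@synthesis_coefs m) => // j; first by case: (mP j).
by move=> n; case: (mP j) => _ _ ->.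
Qed.

Lemma synF_lower m : omega = 3 * h / 2 -> (forall j, L2 (m j)) ->
  (forall j x, x \notin cell -> m j x = 0) ->
  \sum_(j < 3) sqn (m j) <= 9 * lagM h * sqn (synF m).
Proof.
move=> oh lm m0; rewrite (sqn_cuts (L2_synF lm)); last by move=> x; exact: synF_out.
apply: sum_sqn_le => // [k|x]; first exact/L2_cuts/L2_synF.
have [xc|xc] := boolP (x \in cell); last first.
  by rewrite !sum3 !m0// /cuts !cut_out// nsq0; lra.
have E y : y \in I -> synF m y = \sum_(j < 3) q j y * per h (m j) y.
  by move=> yI; apply: eq_bigr => j _; rewrite /phi' yI.
have P j := perE (m0 j) xc.
have [y1 y2 y3] : [/\ x - h \in I, x \in I & x + h \in I].
  by move: xc; rewrite !in_itv/= oh => /andP[? ?]; split; apply/andP; split; lra.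
rewrite [X in _ <= _ * X]sum3 /cuts /cut xc /= addr0 !E//.
have -> : \sum_(j < 3) q j (x - h) * per h (m j) (x - h) = syn (fun j => m j x) (x - h).
  by apply: eq_bigr => j _; case: (P j) => ->.
have -> : \sum_(j < 3) q j x * per h (m j) x = syn (fun j => m j x) x.
  by apply: eq_bigr => j _; case: (P j) => _ ->.
have -> : \sum_(j < 3) q j (x + h) * per h (m j) (x + h) = syn (fun j => m j x) (x + h).
  by apply: eq_bigr => j _; case: (P j) => _ _ ->.
exact: syn_lower.
Qed.

(** The partial sums of [c] and [c'] differ by a quantity tending to 0. By [synF_lower], as soon as
    the finite set contains [n], its squared norm is at least a positive multiple of
    [nsq (c j n - c' j n)], which is therefore 0. *)
Lemma synthesis_inj (c c' : 'I_3 -> int -> R[i]) f : omega = 3 * h / 2 ->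
  is_synthesis t0 Phi c f -> is_synthesis t0 Phi c' f -> c = c'.
Proof.
move=> oh [/cLfun2P lf cf] [_ cf'].
have tF : ProperFilter (@totally int) := totally_filter.
pose S (c : 'I_3 -> int -> R[i]) (N : {fset int}) x :=
  \sum_(j < 3) \sum_(n <- N) c j n * translate t0 Phi j n x.
have lS c0 N : L2 (S c0 N) := isf_L2l (isf_synth c0 N).
have lSf c0 N : L2 (fun x => S c0 N x - f x) by exact: L2B.
move/(L2norm_cvg0 _ (lSf c)) : cf => cf; move/(L2norm_cvg0 _ (lSf c')) : cf' => cf'.
have H : sqn (fun x => S c N x - S c' N x) @[N --> totally] --> 0.
  apply: (@squeeze_cvgr _ _ _ _ (cst 0) (fun N =>
     2 * sqn (fun x => S c N x - f x) + 2 * sqn (fun x => S c' N x - f x))).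
  - apply: nearW => N; rewrite sqn_ge0/=.
    by rewrite [X in _ <= _ + 2 * X]sqnBC; exact: sqn_tri.
  - exact: cvg_cst.
  - rewrite [X in _ --> X](_ : 0 = 2 * 0 + 2 * 0 :> R); last by rewrite mulr0 addr0.
    by apply: cvgD; apply: cvgMl_tmp; [exact: cf|exact: cf'].
apply/funext => j; apply/funext => n; apply/eqP; rewrite -subr_eq0.
apply/eqP/nsq_eq0/eqP; rewrite eq_le nsq_ge0 andbT.
have K0 : 0 < 9 * lagM h by rewrite mulr_gt0// lagM_gt0.
suff : (9 * lagM h)^-1 * (h * nsq (c j n - c' j n)) <= 0.
  by rewrite pmulr_rle0 ?invr_gt0// pmulr_rle0.
apply: (@cvgr_to_ge _ _ _ _ _ _ _ H).
exists [fset n]%fset => // N /= /fsubsetP nN.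
have {}nN : n \in (N : seq int) by apply: nN; rewrite inE.
rewrite (isf_isom (isfB (isf_synth c N) (isf_synth c' N))) ler_pdivrMl//.
pose d k x := trig h t0 (c k) N x - trig h t0 (c' k) N x.
have ld k : L2 (d k) by apply: L2B; exact: L2_trig.
rewrite (_ : (fun y => _) = synF d); last by apply/funext => y; rewrite synFB.
apply: le_trans (synF_lower oh ld _); last first.
  by move=> k x xc; rewrite /d !trig_out// subr0.
have dE k : d k = trig h t0 (fun n => c k n - c' k n) N.
  by apply/funext => x; rewrite /d /trig -sumrB; apply: eq_bigr => i _; rewrite mulrBl.
rewrite (bigD1 j)//= dE sqn_trig ?fset_uniq// (bigD1_seq n) ?fset_uniq//=.
rewrite ler_wpDr ?sumr_ge0// => [i _|]; first exact: sqn_ge0.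
by rewrite ler_pM2l// lerDl sumr_ge0// => i _; exact: nsq_ge0.
Qed.

Lemma riesz : omega = 3 * h / 2 -> is_riesz_basis t0 Phi omega.
Proof.
move=> oh; split; [exact: frame|exact: synthesis_exists|].
by move=> c c' f _ _; exact: synthesis_inj.
Qed.

(* The frame operator seen on the Fourier side. *)
Definition SF g := synF (fun j x => h%:C%C * W g j x).

Lemma L2_hW g j : L2 g -> L2 (fun x => h%:C%C * W g j x).
Proof. by move=> lg; apply: L2Z; exact: L2_W. Qed.

Lemma SFB g b y : SF (fun x => g x - b x) y = SF g y - SF b y.
Proof.
rewrite /SF synFB; congr synF; apply/funext => j; apply/funext => x.
rewrite -mulrBr; congr (_ * _); rewrite /W /fold /cut.
by case: ifP => _; ring.
Qed.

(** The frame coefficients are the unnormalized [fc] of [W g j], that is [coefs] of [h W g j]: the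
    origin of the factor [h] in [SF]. *)
Lemma frame_op f g f' : is_fourier f g -> is_fourier f' (SF g) -> is_frame_op t0 Phi f f'.
Proof.
move=> fg; have lg := isf_L2r fg; apply: synthesis_coefs => [j|j x xc|j n].
- exact: L2_hW.
- by rewrite W_out// mulr0.
rewrite (coefE _ _ fg) /coefs /fc.
under [in RHS]eq_fun do rewrite -mulrA.
rewrite (@cintZ _ _ (fun x => W g j x * ev t0 (- n) x)).
  by rewrite mulrA -rmorphM/= mulVf ?gt_eqF// mul1r.
apply: (@L1_bnd _ _ _ 1); [|exact: cmeas_ev|by move=> x; rewrite nsq_ev].
by apply: L2_L1_itv (L2_W j lg) _ => x; exact: W_out.
Qed.

Lemma synthesis_unique (c : 'I_3 -> int -> R[i]) f f' F F' :
  is_fourier f F -> is_fourier f' F' ->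
  is_synthesis t0 Phi c f -> is_synthesis t0 Phi c f' -> {ae mu, forall x, F x = F' x}.
Proof.
move=> fF fF' /(synthesisP c fF) H /(synthesisP c fF') H'.
have tF : ProperFilter (@totally int) := totally_filter.
have lF := isf_L2r fF; have lF' := isf_L2r fF'.
apply: ae_imp (sqn_eq0_ae (L2B lF lF') _) => [x /eqP|].
  by rewrite subr_eq0 => /eqP.
apply/eqP; rewrite eq_le sqn_ge0 andbT.
have S0 : 2 * sqn (fun y => synF (fun j => trig h t0 (c j) (N : {fset int})) y - F y) +
    2 * sqn (fun y => synF (fun j => trig h t0 (c j) N) y - F' y) @[N --> totally] --> 0.
  rewrite [X in _ --> X](_ : 0 = 2 * 0 + 2 * 0 :> R); last by rewrite mulr0 addr0.
  by apply: cvgD; apply: cvgMl_tmp; [exact: H|exact: H'].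
apply: (@cvgr_to_ge _ _ _ _ _ _ _ S0); apply: nearW => N.
rewrite [X in _ <= 2 * X + _]sqnBC; apply: sqn_tri => //.
by apply: L2_synF => j; exact: L2_trig.
Qed.

(** Folding the integrand undoes [per]: over the cell, [W g j] is multiplied by the folded product
    of [phi' j] and the conjugate of [g], which is the conjugate of [W g j]. *)
Lemma inner_SF g : L2 g ->
  inner (SF g) g = (h * \sum_(j < 3) sqn (W g j))%:C%C.
Proof.
move=> lg; have lp j : L2 (per h (fun x => h%:C%C * W g j x)) by apply: L2_per; exact: L2_hW.
rewrite /SF /synF inner_suml//; last by move=> j; apply: L2_mul_phi'; exact: lp.
rewrite mulr_sumr rmorph_sum; apply: eq_bigr => j _.
rewrite rmorphM/= -inner_self -innerZl; [|exact: L2_W..].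
rewrite /inner (@cint_fold _ h).
- congr cintegral; apply/funext => x.
  have [xc|xc] := boolP (x \in cell); last by rewrite fold_out// W_out// rmorph0 mulr0.
  rewrite foldE//.
  have [|-> -> ->] := @perE _ h (fun x => h%:C%C * W g j x) x _ xc.
    by move=> y yc; rewrite W_out ?mulr0.
  set w := W g j x.
  have -> : conjc w = conjc (g (x - h)) * phi' j (x - h) + conjc (g x) * phi' j x +
      conjc (g (x + h)) * phi' j (x + h).
    by rewrite /w /W foldE// !rmorphD !rmorphM/= !conjcK.
  ring.
- by apply: L2_mulJ => //; exact: L2_mul_phi'.
move=> x xc; rewrite phi'_out ?mul0r//; apply: contra xc; exact: I_cell3.
Qed.

(** * Dual generators from a solution of the frame equation *)

Section DualGenerators.
Variable b : 'I_3 -> R -> R[i].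
Hypothesis lb : forall l, L2 (b l).
Hypothesis b_out : forall l x, x \notin I -> b l x = 0.
Hypothesis SFb : forall l, {ae mu, forall x, SF (b l) x = phi' l x}.

Lemma dual_exists : exists Psi, is_dual t0 Phi omega Psi.
Proof.
have /choice[Psi P] : forall l, exists f, is_fourier f (b l).
  by move=> l; apply: fourier_inverse (lb l) (@b_out l).
exists Psi => l; split.
  exists (b l); first exact: P.
  apply: (@filterS _ _ (ae_filter_ringOfSetsType mu) setT); last exact: filterT.
  move=> x _ xo; apply: b_out; apply: contra xo; rewrite !in_itv/= => /andP[-> /ltW ->]//.
have [f' f'S] := @isf_synF (fun j x => h%:C%C * W (b l) j x) (fun j => L2_hW j (lb l)).
apply: (frame_op (P l)); apply: isf_congr (isf_Phi l) _ _.
  exact: isf_L2r f'S.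
by apply: ae_imp (SFb l) => x ->.
Qed.

(** The difference [d] of two solutions satisfies [SF d = 0] almost everywhere, so every [W d j] has
    norm 0, and the lower bound [W_lower] forces [d] to vanish. *)
Lemma dual_unique Psi : is_dual t0 Phi omega Psi -> forall l, is_fourier (Psi l) (b l).
Proof.
move=> dP l; have [/bandlimitedP[g Pg g0] fop] := dP l.
have lg := isf_L2r Pg.
apply: (isf_congr Pg (lb l)).
have [f' f'S] := @isf_synF (fun j x => h%:C%C * W g j x) (fun j => L2_hW j lg).
have E1 := synthesis_unique f'S (isf_Phi l) (frame_op Pg f'S) fop.
pose d x := g x - b l x.
have ld : L2 d by exact: L2B.
have d0 x : x \notin I -> d x = 0 by move=> xI; rewrite /d g0// b_out// subr0.
have lSd : L2 (SF d) by apply: L2_synF => j; exact: L2_hW.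
have SFd : {ae mu, forall x, SF d x = 0}.
  by apply: ae_imp2 E1 (SFb l) => x e1 e2; rewrite SFB e2 [SF g x]e1 subrr.
have I0 : inner (SF d) d = 0.
  apply: nsq_eq0; apply/eqP; rewrite eq_le nsq_ge0 andbT.
  apply: (le_trans (cauchy_schwarz lSd ld)).
  by rewrite (sqn_ae lSd (L2_0 R) SFd) sqn0 mul0r.
have W0 : \sum_(j < 3) sqn (W d j) = 0.
  have := congr1 (@complex.Re R) (inner_SF ld); rewrite I0/= => /esym/eqP.
  by rewrite mulf_eq0 gt_eqF//= => /eqP.
apply: ae_imp (sqn_eq0_ae ld _) => [x /eqP|].
  by rewrite subr_eq0 => /eqP.
apply/eqP; rewrite eq_le sqn_ge0 andbT (le_trans (W_lower ld d0))//.
by rewrite W0 mulr0.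
Qed.

End DualGenerators.

Lemma SF_ana g x xi : (forall x, x \notin I -> g x = 0) -> x \in cell -> xi \in I ->
  [\/ xi = x - h, xi = x | xi = x + h] ->
  SF g xi = \sum_(j < 3) q j xi * (h%:C%C * ana h x (g (x - h)) (g x) (g (x + h)) j).
Proof.
move=> g0 xc xiI xi_x; apply: eq_bigr => j _; rewrite /phi' xiI -W_ana//.
have [|p1 p2 p3] := @perE _ h (fun x => h%:C%C * W g j x) x _ xc.
  by move=> y yc; rewrite W_out ?mulr0.
by case: xi_x => ->; rewrite ?p1 ?p2 ?p3.
Qed.

Lemma sum_q_ana x xi (u v w : R[i]) :
  \sum_(j < 3) q j xi * (h%:C%C * ana h x u v w j) =
  h%:C%C * ((1 + xi * (x - h) + (xi * (x - h)) ^+ 2)%:C%C * u +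
          (1 + xi * x + (xi * x) ^+ 2)%:C%C * v +
          (1 + xi * (x + h) + (xi * (x + h)) ^+ 2)%:C%C * w).
Proof. by rewrite -!sum_qJ /ana !sum3; ring. Qed.

Lemma ae_notin (s : seq R) : {ae mu, forall x, x \notin s}.
Proof.
elim: s => [|a s IH]; first by apply: ae_imp (ae_neq 0).
by apply: ae_imp2 (ae_neq a) IH => x xa xs; rewrite in_cons negb_or xa.
Qed.

End Frame.

(** * The dual generators *)

Section DualHat.
Variable R : realType.
Variables omega h : R.
Hypothesis h0 : 0 < h.
Hypothesis oh1 : h < omega.
Hypothesis oh2 : omega <= 3 * h / 2.
Implicit Types (x y xi : R) (j l : 'I_3).
Local Open Scope complex_scope.
Local Notation b := (dual_hat omega h).

(** [s^2 den s x] is the determinant of the Gram matrix of the nodes [x] and [x + s]: by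
    Cauchy-Binet, the sum of the squares of the minors [s], [s (2x + s)] and [s x (x + s)] of the
    two Vandermonde rows. *)
Lemma den_ge1 (s x : R) : 1 <= den s x.
Proof. by rewrite /den -addrA lerDl -exprMn addr_ge0// sqr_ge0. Qed.

(** The same pair of nodes seen from its right end, with step [-h]; this is why the functions for
    [h] and [-h] occur together. *)
Lemma den_sym y : den (- h) (y + h) = den h y.
Proof. by rewrite /den; ring. Qed.

(** One row of the two-node system, with [v] the phase [1] or [-i] of the component: the complex
    equation is reduced to a polynomial identity between reals. *)
Lemma side_comb (v : R[i]) (a1 a2 N1 N2 D r : R) : D != 0 ->
  a1 * N1 - a2 * N2 = h * D * r ->
  h%:C * (a1%:C * (v * ((h ^+ 2)^-1 * (N1 / D))%:C) +
          a2%:C * - (v * (((- h) ^+ 2)^-1 * (N2 / D))%:C)) = v * r%:C.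
Proof.
move=> D0 E; have hn : h != 0 by rewrite gt_eqF.
have -> : r = h * (a1 * ((h ^+ 2)^-1 * (N1 / D)) - a2 * (((- h) ^+ 2)^-1 * (N2 / D))).
  have -> : r = (a1 * N1 - a2 * N2) / (h * D) by rewrite E; field; rewrite D0.
  by rewrite sqrrN; field; rewrite D0.
rewrite !(rmorphM, rmorphB)/=; ring.
Qed.

(* Only the nodes [y] and [y + h] lie in the band here, and [A], [B], [C] come
   from the pseudo-inverse of the corresponding 2 x 3 matrix of the [q_j]. *)
Lemma side_identity l y xi : xi = y \/ xi = y + h ->
  h%:C * ((1 + xi * y + (xi * y) ^+ 2)%:C *
            vec3 (Afun h y) (Bfun h y) (Cfun h y) l +
          (1 + xi * (y + h) + (xi * (y + h)) ^+ 2)%:C *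
            - vec3 (Afun (- h) (y + h)) (Bfun (- h) (y + h)) (Cfun (- h) (y + h)) l) =
  q l xi.
Proof.
move=> xi_y; have dn : den h y != 0 by rewrite gt_eqF// (lt_le_trans _ (den_ge1 h y)).
elim/forall3: l; rewrite !vec3E /q /Afun /Bfun /Cfun !vec3E den_sym.
- rewrite -[X in _ * (_ * X + _)]mul1r -[X in _ * - X]mul1r.
  rewrite (side_comb (r := 1) _ dn) ?mul1r//.
  by rewrite /den; case: xi_y => ->; ring.
- rewrite (side_comb (r := - xi) _ dn) ?rmorphN ?mulrNN//.
  by rewrite /den; case: xi_y => ->; ring.
- rewrite -[X in _ * (_ * X + _)]mul1r -[X in _ * - X]mul1r.
  rewrite (side_comb (r := - xi ^+ 2) _ dn) ?mul1r// ?rmorphN//.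
  by rewrite /den; case: xi_y => ->; ring.
Qed.

Lemma dual_hat1 l y : - omega < y < omega - 2 * h -> b l y =
  ((2 * h ^+ 3)^-1)%:C * vec3 (y ^+ 2 + 3 * h * y + 2 * h ^+ 2)%:C
    (- 'i * (2 * y + 3 * h)%:C) (- 1) l.
Proof. by move=> yI; rewrite /dual_hat ifT. Qed.

Lemma dual_hat2 l y : omega - 2 * h < y < h - omega ->
  b l y = vec3 (Afun h y) (Bfun h y) (Cfun h y) l.
Proof.
move=> yI; have /andP[y1 y2] := yI; rewrite /dual_hat.
by rewrite ifN ?ifT// in_itv/=; apply/negP => /andP[? ?]; move: h0 oh1 oh2; lra.
Qed.

Lemma dual_hat3 l y : h - omega < y < omega - h -> b l y =
  ((h ^+ 3)^-1)%:C * vec3 (h ^+ 2 - y ^+ 2)%:C ('i * (2 * y)%:C) 1 l.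
Proof.
move=> yI; have /andP[y1 y2] := yI; rewrite /dual_hat.
do 2 (rewrite ifN; last by rewrite in_itv/=; apply/negP => /andP[? ?]; move: h0 oh1 oh2; lra).
by rewrite ifT.
Qed.

Lemma dual_hat4 l y : omega - h < y < 2 * h - omega ->
  b l y = - vec3 (Afun (- h) y) (Bfun (- h) y) (Cfun (- h) y) l.
Proof.
move=> yI; have /andP[y1 y2] := yI; rewrite /dual_hat.
do 3 (rewrite ifN; last by rewrite in_itv/=; apply/negP => /andP[? ?]; move: h0 oh1 oh2; lra).
by rewrite ifT.
Qed.

Lemma dual_hat5 l y : 2 * h - omega < y < omega -> b l y =
  ((2 * h ^+ 3)^-1)%:C * vec3 (y ^+ 2 - 3 * h * y + 2 * h ^+ 2)%:C
    (- 'i * (2 * y - 3 * h)%:C) (- 1) l.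
Proof.
move=> yI; have /andP[y1 y2] := yI; rewrite /dual_hat.
do 4 (rewrite ifN; last by rewrite in_itv/=; apply/negP => /andP[? ?]; move: h0 oh1 oh2; lra).
by rewrite ifT.
Qed.

Lemma dual_hat_out l y : y \notin `[- omega, omega[ -> b l y = 0.
Proof.
rewrite in_itv/= => /negP yI; rewrite /dual_hat.
by do 5 (rewrite ifN; last by rewrite in_itv/=; apply/negP => /andP[? ?]; apply: yI;
  apply/andP; split; move: h0 oh1 oh2; lra).
Qed.

(** The nodes [x - h], [x], [x + h] fall in the first, third and fifth branches, which are the
    Lagrange coefficients of degree [l] divided by [h], up to a phase. *)
Lemma dual_hat_mid l x : h - omega < x < omega - h ->
  [/\ h%:C * b l (x - h) = vec3 1 'i (-1) l * (lag h ord0 l x)%:C,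
      h%:C * b l x = vec3 1 'i (-1) l * (lag h (lift ord0 ord0) l x)%:C &
      h%:C * b l (x + h) = vec3 1 'i (-1) l * (lag h ord_max l x)%:C].
Proof.
move=> /andP[x1 x2]; have hn : h != 0 by rewrite gt_eqF.
rewrite (@dual_hat1 l (x - h)) ?(@dual_hat3 l x) ?(@dual_hat5 l (x + h));
  [|by apply/andP; split; move: h0 oh1 oh2; lra..].
by split; elim/forall3: l; rewrite !vec3E /lag /tnth /=;
  apply: complexP; rewrite !reim /=; field; exact: hn.
Qed.

(** Biorthogonality over a three-node fibre; it amounts to [lag_moment]. *)
Lemma ana_mid l j x : h - omega < x < omega - h ->
  h%:C * ana h x (b l (x - h)) (b l x) (b l (x + h)) j = (l == j)%:R.
Proof.
move=> xI; have [e1 e2 e3] := dual_hat_mid l xI.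
rewrite /ana !mulrDr !mulrA e1 e2 e3.
have E y : conjc (q j y) = vec3 1 (- 'i) (-1) j * (y ^+ j)%:C.
  by elim/forall3: j; rewrite /q !vec3E /=; apply: complexP; rewrite !reim /=; ring.
rewrite !E.
rewrite (_ : _ + _ + _ = vec3 1 'i (-1) l * vec3 1 (- 'i) (-1) j *
  (lag h ord0 l x * (x - h) ^+ j + lag h (lift ord0 ord0) l x * x ^+ j +
   lag h ord_max l x * (x + h) ^+ j)%:C); last by rewrite !(rmorphM, rmorphD)/=; ring.
rewrite lag_moment// {e1 e2 e3 E}; elim/forall3: l; elim/forall3: j; rewrite !vec3E /= ?mulr0//;
  apply: complexP; rewrite !reim /=; ring.
Qed.
Local Notation cell := `[- (h / 2), h / 2[.
Local Notation I := `[- omega, omega[.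

(** Left of [h - omega] the node [x - h] leaves the band, and [x], [x + h] fall in the second and
    fourth branches; right of [omega - h] it is [x + h] that leaves, and [x - h], [x] fall in these
    branches. Between the two points all three nodes remain. *)
Lemma SF_dual_cell l x xi : x \in cell -> x != omega - h -> x != h - omega ->
  xi \in I -> [\/ xi = x - h, xi = x | xi = x + h] -> SF omega h (b l) xi = q l xi.
Proof.
move=> xc xr xl xiI xi_x.
rewrite (SF_ana (@dual_hat_out l) xc xiI xi_x).
move: xc xiI; rewrite !in_itv/= => /andP[x1 x2] /andP[xi1 xi2].
have [xL|xL] := ltP x (h - omega).
  have xh : x - h \notin I by rewrite in_itv/=; apply/negP => /andP[? ?]; move: h0 oh1 oh2; lra.
  rewrite sum_q_ana (dual_hat_out l xh) mulr0 add0r.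
  rewrite dual_hat2 ?dual_hat4; [|by apply/andP; split; move: h0 oh1 oh2; lra..].
  by apply: side_identity; case: xi_x => e; [exfalso; move: h0 oh1 oh2; lra|left|right].
have [xR|xR] := ltP (omega - h) x.
  have xh : x + h \notin I by rewrite in_itv/=; apply/negP => /andP[? ?]; move: h0 oh1 oh2; lra.
  rewrite sum_q_ana (dual_hat_out l xh) mulr0 addr0.
  rewrite (@dual_hat4 l x) ?dual_hat2; [|by apply/andP; split; move: h0 oh1 oh2; lra..].
  have := @side_identity l (x - h) xi; rewrite subrK; apply.
  by case: xi_x => e; [left|right|exfalso; move: h0 oh1 oh2; lra].
have xI : h - omega < x < omega - h by rewrite !lt_neqAle xL xR eq_sym xl xr.
under eq_bigr do rewrite ana_mid//.
rewrite (bigD1 l)//= eqxx mulr1 big1 ?addr0// => j jl.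
by rewrite eq_sym (negbTE jl) mulr0.
Qed.

Lemma SF_dual_ae l :
  {ae (@lebesgue_measure R), forall xi, SF omega h (b l) xi = phi' omega l xi}.
Proof.
set e := omega - h.
(* The two points of the cell where the number of nodes changes, with their translates by [h] and
   [-h], since [xi] may be any node of the fibre. *)
apply: ae_imp (ae_notin [:: e; - e; e - h; - e - h; e + h; - e + h]) => xi.
rewrite !inE !negb_or => /and5P[n1 n2 n3 n4 /andP[n5 n6]].
have [xiI|xiI] := boolP (xi \in I); last by rewrite phi'_out// /SF synF_out.
rewrite /phi' xiI.
have eE : h - omega = - e by rewrite /e opprB.
have hE a : (xi + h != a) = (xi != a - h) by rewrite -subr_eq0 -[in RHS]subr_eq0 opprB addrA.
have hE' a : (xi - h != a) = (xi != a + h) by rewrite -subr_eq0 -[in RHS]subr_eq0 opprD addrA addrAC.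
case: (cell3_split (I_cell3 oh2 xiI)) => -[c1 c2 c3].
- apply: (@SF_dual_cell l (xi + h)) => //; rewrite ?eE ?hE//.
  by constructor 1; rewrite addrK.
- by apply: (@SF_dual_cell l (xi)) => //; [rewrite eE|constructor 2].
- apply: (@SF_dual_cell l (xi - h)) => //; rewrite ?eE ?hE'//.
  by constructor 3; rewrite subrK.
Qed.

(** * Square integrability of [dual_hat], from boundedness on the band *)

Definition bounded_measurable (r : R -> R) := measurable_fun [set: R] r /\
  exists M, forall x, `|x| <= omega -> `|r x| <= M.

Lemma bmC (a : R) : bounded_measurable (fun=> a).
Proof. by split; [exact: measurable_cst|exists `|a|]. Qed.

Lemma bm_id : bounded_measurable (fun x => x).
Proof. by split; [exact: measurable_id|exists omega]. Qed.

Lemma bmD r s : bounded_measurable r -> bounded_measurable s ->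
  bounded_measurable (fun x => r x + s x).
Proof.
move=> [mr [M rM]] [ms [N sN]]; split; first exact: measurable_funD.
by exists (M + N) => x xo; apply: (le_trans (ler_normD _ _)); rewrite lerD ?rM ?sN.
Qed.

Lemma bmN r : bounded_measurable r -> bounded_measurable (fun x => - r x).
Proof.
move=> [mr [M rM]]; split; first exact: measurableT_comp.
by exists M => x xo; rewrite normrN rM.
Qed.

Lemma bmM r s : bounded_measurable r -> bounded_measurable s ->
  bounded_measurable (fun x => r x * s x).
Proof.
move=> [mr [M rM]] [ms [N sN]]; split; first exact: measurable_funM.
by exists (M * N) => x xo; rewrite normrM ler_pM ?rM ?sN.
Qed.

Lemma bmX r n : bounded_measurable r -> bounded_measurable (fun x => r x ^+ n).
Proof.
move=> br; elim: n => [|n IH]; first by under eq_fun do rewrite expr0; exact: bmC.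
by under eq_fun do rewrite exprS; exact: bmM.
Qed.

Lemma bmV r : (forall x, 1 <= r x) -> bounded_measurable r ->
  bounded_measurable (fun x => (r x)^-1).
Proof.
move=> r1 [mr _].
have rp x : 0 < r x by rewrite (lt_le_trans _ (r1 x)).
split; last first.
  by exists 1 => x _; rewrite gtr0_norm ?invr_gt0// invf_le1.
under eq_fun do rewrite -(powR_inv1 (ltW (rp _))).
exact: measurableT_comp (measurable_powR _) mr.
Qed.

Definition cbounded (f : R -> R[i]) := cmeas f /\
  exists M, forall x, `|x| <= omega -> nsq (f x) <= M.

Lemma cb_real r : bounded_measurable r -> cbounded (fun x => (r x)%:C).
Proof.
move=> [mr [M rM]]; split; first exact: cmeas_real.
exists (M ^+ 2) => x xo; rewrite nsqC -real_normK ?num_real//.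
by rewrite ler_sqr ?nnegrE ?rM// (le_trans _ (rM x xo)).
Qed.

Lemma cbC (z : R[i]) : cbounded (fun=> z).
Proof. by split; [exact: cmeas_cst|exists (nsq z)]. Qed.

Lemma cbM f g : cbounded f -> cbounded g -> cbounded (fun x => f x * g x).
Proof.
move=> [mf [M fM]] [mg [N gN]]; split; first exact: cmeasM.
by exists (M * N) => x xo; rewrite nsqM ler_pM ?nsq_ge0 ?fM ?gN.
Qed.

Lemma cbN f : cbounded f -> cbounded (fun x => - f x).
Proof.
move=> [mf [M fM]]; split; first exact: cmeasN.
by exists M => x xo; rewrite nsqN fM.
Qed.

Lemma cb_if f g (i : interval R) : cbounded f -> cbounded g ->
  cbounded (fun x => if x \in i then f x else g x).
Proof.
move=> [mf [M fM]] [mg [N gN]]; split; first exact: cmeas_if (measurable_itv_fun _) mf mg.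
exists (Num.max M N) => x xo; rewrite le_max.
by case: ifP => _; rewrite ?fM ?gN ?orbT.
Qed.

Lemma cb_vec3 f1 f2 f3 l : cbounded f1 -> cbounded f2 -> cbounded f3 ->
  cbounded (fun x => vec3 (f1 x) (f2 x) (f3 x) l).
Proof. by move=> *; elim/forall3: l. Qed.

Lemma cb_dual_hat l : cbounded (b l).
Proof.
have id := bm_id; have cst := bmC.
have bd s : bounded_measurable (fun x => (den s x)^-1).
  apply: bmV; first exact: den_ge1.
  by do ?[exact: id|exact: cst|apply: bmD|apply: bmM|apply: bmX].
by do ?[apply: cb_if|apply: cbN|apply: cbM|apply: cb_vec3|apply: cbC|apply: cb_real
  |exact: bd|exact: id|exact: cst|apply: bmD|apply: bmN|apply: bmM|apply: bmX].
Qed.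

Lemma L2_dual_hat l : L2 (b l).
Proof.
have [mb [M bM]] := cb_dual_hat l.
rewrite (_ : b l = (fun x => if x \in I then b l x else 0)).
  by apply: (@L2_itv _ _ _ _ M mb) => x /I_abs; exact: bM.
by apply/funext => x; case: ifPn => // /(dual_hat_out l).
Qed.

End DualHat.

Theorem corollary5p4 (R : realType) (omega t0 h : R)
    (Phi : 'I_3 -> R -> R[i])
    (homega : 0 < omega) (ht0 : 0 < t0) (hh : h = 2 * pi / t0)
    (PhiB : forall j, bandlimited omega (Phi j))
    (Phi_hat : forall j, is_fourier (Phi j) (phi_hat omega j)) :
  [/\ 2 * omega / 3 <= h < omega -> is_frame t0 Phi omega,
      h = 2 * omega / 3 -> is_riesz_basis t0 Phi omega,
      2 * omega / 3 <= h < omega ->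
        (exists Psi, is_dual t0 Phi omega Psi) /\
        (forall Psi, is_dual t0 Phi omega Psi ->
           forall j, is_fourier (Psi j) (dual_hat omega h j)) &
      h = 2 * omega / 3 ->
        [set` `]omega - h, 2 * h - omega[%R] = set0 :> set R /\
        [set` `]omega - 2 * h, h - omega[%R] = set0 :> set R].
Proof.
have h0 : 0 < h by rewrite hh divr_gt0// mulr_gt0// pi_gt0.
have wp : t0 * h = 2 * pi by rewrite hh mulrC divfK// gt_eqF.
split.
- move=> /andP[h1 h2]; have oh : omega <= 3 * h / 2 by lra.
  exact: (frame h0 wp oh Phi_hat).
- move=> h1; have oh : omega = 3 * h / 2 by lra.
  by apply: (riesz h0 wp _ Phi_hat oh); rewrite oh.
- move=> /andP[h1 h2]; have oh : omega <= 3 * h / 2 by lra.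
  have lb := @L2_dual_hat R omega h h0 h2 oh; have out := @dual_hat_out R omega h h0 h2 oh.
  have S := @SF_dual_ae R omega h h0 h2 oh.
  split; first exact: (dual_exists h0 wp oh Phi_hat lb out S).
  by move=> Psi; exact: (dual_unique h0 wp oh Phi_hat lb out S).
- move=> h1; split; apply/seteqP; split => // x; rewrite /= in_itv/= => /andP[? ?];
    by lra.
Qed.
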